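(* Let $(P,\sigma)$ be a signed matroid on $[n]$ whose underlying partition $P=P_1\sqcup\dots\sqcup P_m$ has $m$ parts and $l$ loops, and let $r$ be an integer. (1) If $3\le r<m$, then $(P,\sigma)$ is $r$-momentum conserving if and only if there exist distinct $i,j,k,l'\in[n]$ with $\sigma_i=\sigma_j=+$ and $\sigma_k=\sigma_{l'}=-$ (for one of the two representatives $\pm\sigma$) such that the restriction of $P$ to $\{i,j,k,l'\}$ is either the uniform matroid $U_4$ (all four elements are non-loops lying in four distinct parts) or the matroid $\{ik,jl'\}$ (all four are non-loops, $i,k$ lie in one part, $j,l'$ lie in another part). (2) If $2\le r=m$, then $(P,\sigma)$ is $r$-momentum conserving if and only if every part $P_\mu$ contains two elements with opposite signs. Moreover, if $(P,\sigma)$ is $r$-momentum conserving, then $$\dim\bigl(\mathcal{C}^0_{P,\sigma,r}\bigr)\;=\;(m-1)(r-1)-\binom{r}{2}+(n-l-m)-1.$$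
   Context: A real symmetric $n\times n$ matrix $S=[s_{ij}]$ of rank $r$ is a Mandelstam matrix if $s_{ii}\ge0$ for all $i$ and $S$ has exactly one positive and exactly $r-1$ negative eigenvalues. $\mathcal{M}^0_{n,r}$ is the set of such matrices of rank $r$ with zero diagonal. A (rank two) matroid on $[n]$ is a partition $P=P_1\sqcup\dots\sqcup P_m$ of a subset of $[n]$ into $m\ge2$ non-empty parts; elements of $[n]\setminus P$ are loops, $l=n-|P|$; bases are pairs $\{u,v\}$ with $u,v$ in different parts. A signed matroid is $(P,\sigma)$, $\sigma\in\{-,+\}^n$, with $\sigma$ identified with $-\sigma$. The kinematic stratum $\mathcal{M}^0_{P,\sigma,r}$ is the set of $S\in\mathcal{M}^0_{n,r}$ with $\operatorname{sign}(s_{ij})=\sigma_i\sigma_j$ for every basis $\{i,j\}$ and $s_{ij}=0$ for every non-basis pair $i\ne j$. The MMC stratum is $\mathcal{C}^0_{P,\sigma,r}=\{S\in\mathcal{M}^0_{P,\sigma,r}: \sum_{j=1}^n s_{ij}=0 \text{ for all } i=1,\dots,n\}$, and $(P,\sigma)$ is called $r$-momentum conserving if $\mathcal{C}^0_{P,\sigma,r}$ is non-empty. *)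

(* Defs.v *)
From HB Require Import structures.
From mathcomp Require Import all_boot all_order all_algebra.
From mathcomp Require Import boolp classical_sets reals topology normedtype.

Set Implicit Arguments.
Unset Strict Implicit.
Unset Printing Implicit Defensive.

Import Order.TTheory GRing.Theory Num.Theory.
Import numFieldNormedType.Exports.

Local Open Scope ring_scope.

Record matroid (n : nat) := Matroid {
  parts :> {set {set 'I_n}};
  parts_partition : finset.partition parts (finset.cover parts);
  parts_ge2 : (2 <= #|parts|)%N }.

Definition matroid_loops n (P : matroid n) : {set 'I_n} := (~: finset.cover P)%SET.

Definition matroid_basis n (P : matroid n) (u v : 'I_n) : bool :=
  [exists A in parts P, [exists B in parts P,
    [&& A != B, u \in A & v \in B]]].

Definition matroid_restrict n (P : matroid n) (X : {set 'I_n}) : {set {set 'I_n}} :=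
  ([set A :&: X | A in parts P] :\ finset.set0)%SET.

(* A sign vector is a Boolean vector, with true for + and false for -.  A     *)
(* signed matroid, where s and its negation are identified, is given by either *)
(* representative; lemma kstratum_opp shows that the strata do not depend on   *)
(* the choice.                                                                 *)
Definition signs (n : nat) := {ffun 'I_n -> bool}.

Definition opp_signs n (s : signs n) : signs n := [ffun i => ~~ s i].

Definition sign_val (R : pzRingType) (b : bool) : R := if b then 1 else - 1.

Local Open Scope classical_set_scope.

(* The sequence e lists the eigenvalues with multiplicity.                     *)
Definition mandelstam (R : realType) n (r : nat) (S : 'M[R]_n) : Prop :=
  [/\ S^T = S,
      \rank S = r,
      forall i, 0 <= S i i
    & exists e : seq R,
        [/\ char_poly S = \prod_(a <- e) ('X - a%:P),
            count (fun a => 0 < a) e = 1%N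
          & (count (fun a => a < 0) e).+1 = r]].

Definition massless (R : realType) n (r : nat) : set 'M[R]_n :=
  [set S | mandelstam r S /\ forall i, S i i = 0].

Definition kstratum (R : realType) n (P : matroid n) (s : signs n) (r : nat) :
    set 'M[R]_n :=
  [set S | [/\ massless r S,
    forall i j, matroid_basis P i j ->
      Num.sg (S i j) = sign_val R (s i) * sign_val R (s j)
  & forall i j, i != j -> ~~ matroid_basis P i j -> S i j = 0]].

Definition mmc_stratum (R : realType) n (P : matroid n) (s : signs n) (r : nat) :
    set 'M[R]_n :=
  [set S | kstratum P s r S /\ forall i, \sum_j S i j = 0].

Definition momentum_conserving (R : realType) n (P : matroid n) (s : signs n)
    (r : nat) : Prop :=
  mmc_stratum (R := R) P s r !=set0.

Lemma kstratum_opp (R : realType) n (P : matroid n) (s : signs n) r :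
  kstratum (R := R) P (opp_signs s) r = kstratum P s r.
Proof.
suff E i j : sign_val R (opp_signs s i) * sign_val R (opp_signs s j) =
             sign_val R (s i) * sign_val R (s j).
  by apply/seteqP; split=> S [S0 sgS nbS]; split=> // i j /sgS; rewrite E.
by rewrite !ffunE /sign_val; case: (s i) (s j) => [] [];
  rewrite /= ?mulrNN ?mulrN ?mulNr ?mulr1.
Qed.

Definition coord_proj (R : realType) n d (f : 'I_d -> 'I_n * 'I_n)
    (S : 'M[R]_n) : 'rV[R]_d :=
  \row_k S (f k).1 (f k).2.

(* The dimension of a nonempty semialgebraic set A of matrices: the largest d  *)
(* such that the image of A under the projection to some d of the n ^ 2        *)
(* coordinates has nonempty interior in R^d.  By convention it is 0 for        *)
(* A = set0.                                                                   *)
Definition sa_dim (R : realType) n (A : set 'M[R]_n) : nat :=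
  (\max_(d < (n * n).+1 |
     `[< exists2 f : 'I_d -> 'I_n * 'I_n, injective f &
           interior (coord_proj f @` A) !=set0 >]) d)%N.

(* Main.v *)
(* A matrix S in a stratum of rank d + 2 is the Gram matrix of n lightlike     *)
(* vectors for a Lorentzian form, the vectors in a part being proportional.    *)
(* In coordinates where one part is at infinity, the other parts are points    *)
(* z_i of R^d and S_ij = a_i a_j C(z_i - z_j, z_i - z_j), for a positive       *)
(* definite form C and weights a_i with the signs of sigma.                    *)
(*                                                                             *)
(* Placing d + 2 parts at infinity, at the origin and at the unit vectors, the *)
(* weights of one element in each of them are polynomial functions of the      *)
(* other data, by momentum conservation.  So the stratum is covered by         *)
(* finitely many polynomial images of a space of the claimed dimension D, and  *)
(* counting monomials shows that the image of no coordinate projection to more *)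
(* than D coordinates has an interior point.  Conversely, a chart is immersive *)
(* where C = 1, so by the inverse function theorem some D matrix entries fill  *)
(* an open set, as soon as the stratum has a point with C = 1.                 *)
(*                                                                             *)
(* Momentum conservation is a linear relation between the vectors of the parts *)
(* whose coefficients are the sums of the weights in each part.  As lightlike  *)
(* vectors on one cone pair positively, either all sums vanish, or two are     *)
(* positive and two are negative.  If r = m, the vectors of the parts are      *)
(* independent and all sums vanish.  The conditions obtained are sufficient    *)
(* by explicit configurations with C = 1.                                      *)

Require Import Defs.
From HB Require Import structures.
From mathcomp Require Import all_boot all_order all_algebra.
From mathcomp Require Import boolp classical_sets reals topology normedtype.
From mathcomp Require Import functions interval_inference sequences complex.
From mathcomp Require Import ring lra zify.

Set Implicit Arguments.
Unset Strict Implicit.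
Unset Printing Implicit Defensive.

Import Order.TTheory GRing.Theory Num.Theory.
Import numFieldNormedType.Exports.

Local Open Scope ring_scope.

(** * Polynomial maps do not increase the dimension *)

(** The three claims meet in [good_point]: a chart point with form [C = 1], weights of the
    prescribed signs, and distinct positions for distinct parts. A nonempty stratum forces a
    combinatorial sign condition ([stratum_condition]), and this condition yields an explicit good
    point ([good_point_full] when r = m, [good_point_generic] when r < m). A good point lies in the
    stratum, which gives the equivalences. It is also the point at which the dimension is computed,
    so the form [C] of the point given at first does not matter ([conserving_good_point]).

    Charts come from Lorentzian geometry. In a Lorentzian form an isotropic vector orthogonal to a
    positive one lies in the kernel, so elements of one part have proportional rows. The Schur
    complement on two elements of different parts then supplies Euclidean coordinates for the other
    parts ([stratum_chart]), and every such configuration is a value of a polynomial chart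
    ([chart_onto]).

    For the upper bound, more than D polynomials in D variables are algebraically dependent
    ([algebraic_dependence]); finitely many charts therefore cover only a finite union of
    hypersurfaces, which has no interior point ([polyimage_interior_dim]). For the lower bound, the
    stratum conditions are open around a good point ([dec_mmc_near]), the chart has injective
    differential there ([chart_gradient_inj]), and [local_surjectivity] applies to D well chosen
    matrix entries.

    Necessity rests on [two_positive]: the sums of weights over the parts are the coefficients of a
    linear relation between vectors with positive pairwise products. *)

Inductive polyfun (R : realType) D : ('rV[R]_D -> R) -> Prop :=
| polyfunC c : polyfun (fun=> c)
| polyfunX i : polyfun (fun y => y 0 i)
| polyfunD f g : polyfun f -> polyfun g -> polyfun (fun y => f y + g y)
| polyfunM f g : polyfun f -> polyfun g -> polyfun (fun y => f y * g y).

Arguments polyfunC {R D} c.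
Arguments polyfunX {R D} i.

Section PolyFun.
Variables (R : realType) (D : nat).
Implicit Types (f g : 'rV[R]_D -> R).

Lemma eq_polyfun f g : f =1 g -> polyfun f -> polyfun g.
Proof. by move=> /funext ->. Qed.

Lemma polyfunN f : polyfun f -> polyfun (fun y => - f y).
Proof.
move=> pf; apply: (@eq_polyfun (fun y => -1 * f y)).
  by move=> y; rewrite mulN1r.
by apply: polyfunM => //; apply: polyfunC.
Qed.

Lemma polyfun_sum (I : Type) (r : seq I) (P : pred I) (F : I -> 'rV[R]_D -> R) :
  (forall i, P i -> polyfun (F i)) -> polyfun (fun y => \sum_(i <- r | P i) F i y).
Proof.
move=> pF; elim: r => [|i r IH].
  by apply: eq_polyfun (polyfunC 0) => y; rewrite big_nil.
have [Pi|/negPf Pi] := boolP (P i); last first.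
  by apply: eq_polyfun IH => y; rewrite big_cons Pi.
by apply: eq_polyfun (polyfunD (pF _ Pi) IH) => y; rewrite big_cons Pi.
Qed.

Lemma polyfun_cont f : polyfun f -> continuous f.
Proof.
elim=> {f} [c|i|f g _ cf _ cg|f g _ cf _ cg] y.
- exact: cst_continuous.
- exact: coord_continuous.
- exact: (cvgD (cf y) (cg y)).
- exact: (cvgM (cf y) (cg y)).
Qed.

(** The bound is on each variable separately, so the admissible exponents form a box and monomials
    can be counted as finite functions. The list may repeat monomials. *)
Definition has_degree e f := exists2 l : seq (R * {ffun 'I_D -> nat}),
  all (fun t : R * {ffun 'I_D -> nat} => [forall i, t.2 i <= e]%N) l &
  forall y, f y = \sum_(t <- l) t.1 * \prod_i y 0 i ^+ t.2 i.

Lemma has_degreeM e e' f g : has_degree e f -> has_degree e' g ->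
  has_degree (e + e') (fun y => f y * g y).
Proof.
move=> [l le fE] [l' le' gE].
pose mulm (t t' : R * {ffun 'I_D -> nat}) :=
  (t.1 * t'.1, [ffun i => t.2 i + t'.2 i]%N).
exists [seq mulm t t' | t <- l, t' <- l'].
  apply/allP => x /allpairsP[[t t'] /= [tl tl' ->]] /=.
  apply/forallP => i; rewrite ffunE leq_add //.
    by have /forallP := allP le _ tl.
  by have /forallP := allP le' _ tl'.
move=> y; rewrite fE gE big_allpairs_dep mulr_suml; apply: eq_bigr => t _.
rewrite mulr_sumr; apply: eq_bigr => t' _ /=.
rewrite mulrACA -big_split; congr (_ * _); apply: eq_bigr => i _.
by rewrite ffunE exprD.
Qed.

Lemma has_degree_le e e' f : (e <= e')%N -> has_degree e f -> has_degree e' f.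
Proof.
move=> ee' [l le fE]; exists l => //; apply: sub_all le => t /forallP te.
by apply/forallP => i; apply: leq_trans ee'.
Qed.

Lemma has_degreeC c : has_degree 0 (fun=> c).
Proof.
exists [:: (c, [ffun=> 0%N])] => [|y] /=.
  by rewrite andbT; apply/forallP => i; rewrite ffunE.
by rewrite big_seq1 big1 ?mulr1 // => i _; rewrite ffunE.
Qed.

Lemma polyfun_degree f : polyfun f -> exists e, has_degree e f.
Proof.
elim=> {f} [c|i|f g _ [e fe] _ [e' ge']|f g _ [e fe] _ [e' ge']].
- by exists 0%N; apply: has_degreeC.
- exists 1%N; exists [:: (1, [ffun j => (i == j) : nat])] => [|y] /=.
    by rewrite andbT; apply/forallP => j; rewrite ffunE leq_b1.
  rewrite big_seq1 mul1r (bigD1 i) //= ffunE eqxx expr1 big1 ?mulr1 //.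
  by move=> j; rewrite eq_sym ffunE => /negPf->.
- exists (maxn e e').
  have [l le fE] := has_degree_le (leq_maxl e e') fe.
  have [l' le' gE] := has_degree_le (leq_maxr e e') ge'.
  exists (l ++ l') => [|y]; first by rewrite all_cat le.
  by rewrite big_cat fE gE.
- by exists (e + e')%N; apply: has_degreeM.
Qed.

Lemma has_degreeX e f k : has_degree e f -> has_degree (e * k) (fun y => f y ^+ k).
Proof.
move=> fe; elim: k => [|k IH].
  rewrite muln0; have := has_degreeC 1; congr has_degree.
rewrite mulnS (_ : (fun _ => _) = fun y => f y * f y ^+ k); last first.
  by apply/funext => y; rewrite exprS.
exact: has_degreeM.
Qed.

Lemma has_degree_prod (I : Type) (r : seq I) (E : I -> nat) (F : I -> 'rV[R]_D -> R) :
  (forall i, has_degree (E i) (F i)) ->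
  has_degree (\sum_(i <- r) E i) (fun y => \prod_(i <- r) F i y).
Proof.
move=> FE; elim: r => [|i r IH].
  rewrite big_nil (_ : (fun _ => _) = fun=> 1); first exact: has_degreeC.
  by apply/funext => y; rewrite big_nil.
rewrite big_cons (_ : (fun _ => _) = fun y => F i y * \prod_(j <- r) F j y).
  exact: has_degreeM.
by apply/funext => y; rewrite big_cons.
Qed.

(** Collects equal monomials of the list; [inord] loses nothing because the exponents are bounded by
    [e]. *)
Lemma has_degree_coef e f : has_degree e f ->
  exists c : {ffun 'I_D -> 'I_e.+1} -> R,
  forall y, f y = \sum_b c b * \prod_i y 0 i ^+ b i.
Proof.
move=> [l le fE].
pose tr (t : {ffun 'I_D -> nat}) : {ffun 'I_D -> 'I_e.+1} := [ffun i => inord (t i)].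
exists (fun b => \sum_(t <- l | tr t.2 == b) t.1) => y.
rewrite fE; under [RHS]eq_bigr do rewrite mulr_suml.
rewrite (exchange_big_dep xpredT) //= big_seq [RHS]big_seq.
apply: eq_bigr => t tl; rewrite (big_pred1 (tr t.2)); last first.
  by move=> b; rewrite eq_sym.
congr (_ * _); apply: eq_bigr => i _; rewrite ffunE inordK // ltnS.
by have /forallP := allP le _ tl.
Qed.

Definition evalp d N (c : {ffun 'I_d -> 'I_N} -> R) (x : 'I_d -> R) :=
  \sum_a c a * \prod_k x k ^+ a k.

(* Dimension count: there are N ^ d monomials of degree < N in each F k, and   *)
(* they live in a space of polynomials of dimension O(N ^ D).                  *)
Lemma algebraic_dependence d (F : 'I_d -> 'rV[R]_D -> R) :
  (D < d)%N -> (forall k, polyfun (F k)) ->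
  exists N, exists2 c : {ffun 'I_d -> 'I_N} -> R,
    exists a, c a != 0 & forall y, evalp c (F^~ y) = 0.
Proof.
move=> ltDd pF.
have [e Fe] : exists e, forall k, has_degree e (F k).
  have [E FE] := choice (fun k => polyfun_degree (pF k)).
  exists (\max_k E k) => k; apply: has_degree_le (FE k).
  exact: (leq_bigmax_cond k).
(* The products have degree at most [M = e * d * N], and this [N] gives (M + 1)^D <= ((e d + 1) N)^D
   < N^(D + 1) <= N^d: there are more products than monomials. *)
pose N := (((e * d).+1) ^ D).+1; exists N.
pose M := (e * d * N)%N.
have mon (a : {ffun 'I_d -> 'I_N}) : has_degree M (fun y => \prod_k F k y ^+ a k).
  have := has_degree_prod (index_enum 'I_d)
    (fun k => has_degreeX (a k) (Fe k)).
  apply: has_degree_le.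
  apply: (@leq_trans (\sum_(k < d) e * N)%N).
    by apply: leq_sum => k _; rewrite leq_mul2l (ltnW (ltn_ord _)) orbT.
  by rewrite sum_nat_const card_ord /M mulnC mulnAC leqnn.
have [q qE] := choice (fun a => has_degree_coef (mon a)).
pose A := \matrix_(i < #|{ffun 'I_d -> 'I_N}|, j < #|{ffun 'I_D -> 'I_M.+1}|)
  q (enum_val i) (enum_val j).
have nfree : ~~ row_free A.
  apply/negP => /eqP rA; have := rank_leq_col A; rewrite rA leqNgt => /negP; apply.
  rewrite !card_ffun !card_ord.
  have M1 : (M.+1 <= (e * d).+1 * N)%N by rewrite /M mulSn -addn1 addnC leq_add.
  apply: (@leq_ltn_trans (((e * d).+1 * N) ^ D)).
    by have [->|D0] := posnP D; rewrite ?expn0 ?leq_exp2r.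
  rewrite expnMn; apply: (@leq_trans (N ^ D.+1)); last by rewrite leq_pexp2l.
  by rewrite expnS ltn_mul2r expn_gt0 /= /N ltnS leqnn.
have : kermx A != 0 by rewrite kermx_eq0.
move=> /rowV0Pn[u /sub_kermxP uA u0].
exists (fun a => u 0 (enum_rank a)).
  have [j uj] := rV0Pn _ u0.
  by exists (enum_val j); rewrite enum_valK.
move=> y; rewrite /evalp.
under eq_bigr do rewrite qE mulr_sumr.
rewrite exchange_big big1 //= => b _.
under eq_bigr do rewrite mulrA.
rewrite -mulr_suml; have /rowP/(_ (enum_rank b)) := uA.
rewrite !mxE => uAb.
rewrite (reindex (@enum_val {ffun 'I_d -> 'I_N} predT)) /=; last first.
  by apply/onW_bij/enum_val_bij.
under eq_bigr do rewrite enum_valK.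
rewrite [X in X * _](_ : _ = 0) ?mul0r // -[RHS]uAb.
by apply: eq_bigr => i _; rewrite !mxE enum_rankK.
Qed.
End PolyFun.

Section Nonvanishing.
Variables (R : realType) (d : nat).

(** The inverse Vandermonde matrix: weights on the nodes that read off one coefficient of a
    polynomial of degree less than [N]. *)
Lemma interp N (x : 'I_N -> R) : injective x ->
  exists l : 'I_N -> 'I_N -> R,
    forall a b : 'I_N, \sum_j l a j * x j ^+ b = (a == b)%:R.
Proof.
move=> xinj; pose V := Vandermonde N (\row_j x j).
have Vu : V \in unitmx.
  rewrite unitmxE det_Vandermonde unitfE; apply/prodf_neq0 => i _.
  apply/prodf_neq0 => j ltij; rewrite !mxE subr_eq0; apply: contraTN ltij => /eqP/xinj->.
  by rewrite ltnn.
exists (fun a j => invmx V j a) => a b.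
have /matrixP/(_ b a) := mulmxV Vu; rewrite !mxE eq_sym => <-.
by apply: eq_bigr => j _; rewrite !mxE mulrC.
Qed.

Local Open Scope classical_set_scope.

(** A grid of [N ^ d] points fits in the neighbourhood, and the product of the one-variable
    functionals of [interp] extracts each coefficient from the values on the grid. *)
Lemma evalp_eq0 N (c : {ffun 'I_d -> 'I_N} -> R) (x0 : 'rV[R]_d) :
  (\forall x \near x0, evalp c ((x : 'rV[R]_d) 0) = 0) -> forall a, c a = 0.
Proof.
move=> /nbhs_ballP[e /= e0 c0] a.
have e1 : 0 < e / N.+1%:R by rewrite divr_gt0.
pose x (k : 'I_d) (j : 'I_N) := x0 0 k + j%:R * (e / N.+1%:R).
have xinj k : injective (x k).
  move=> i j /addrI/(mulIf (lt0r_neq0 e1))/eqP.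
  by rewrite eqr_nat => /eqP/val_inj.
have [l lE] := choice (fun k => interp (xinj k)).
have sum0 : \sum_(b : {ffun 'I_d -> 'I_N}) (\prod_k l k (a k) (b k)) *
    evalp c (fun k => x k (b k)) = 0.
  apply: big1 => b _; rewrite [evalp _ _](_ : _ = 0) ?mulr0 //.
  have <- : evalp c ((\row_k x k (b k)) 0) = evalp c (fun k => x k (b k)).
    by apply: eq_bigr => a' _; under eq_bigr do rewrite mxE.
  apply: c0; rewrite mx_norm_ball /ball_ /=.
  apply: le_lt_trans (_ : N%:R * (e / N.+1%:R) < e); last first.
    by rewrite mulrCA gtr_pMr // ltr_pdivrMr // mul1r ltr_nat.
  rewrite [leLHS]mx_normrE; apply: bigmax_le => /=.
    by rewrite mulr_ge0 // ltW.
  move=> [i k] _ /=; rewrite ord1 !mxE opprD addNKr normrN.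
  by rewrite normrM (ger0_norm (ltW e1)) ger0_norm // ler_pM2r // ler_nat ltnW.
rewrite -sum0.
under eq_bigr do rewrite mulr_sumr.
rewrite exchange_big (bigD1 a) //= [X in _ = _ + X]big1 ?addr0 => [|a' a'a].
  transitivity (c a * \prod_k \sum_j l k (a k) j * x k j ^+ a k).
    by rewrite big1 ?mulr1 ?mul1r // => k _; rewrite lE eqxx.
  rewrite bigA_distr_bigA mulr_sumr; apply: eq_bigr => b _.
  by rewrite mulrCA; congr (_ * _); rewrite -big_split.
transitivity (c a' * \prod_k \sum_j l k (a k) j * x k j ^+ a' k); last first.
  have [k ak] : exists k, a' k != a k.
    by apply/existsP; apply: contraNT a'a => /existsPn aa; apply/eqP/ffunP => k;
       apply/eqP; have := aa k; rewrite negbK.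
  by rewrite (bigD1 k) //= lE eq_sym (negPf ak) mul0r mulr0.
rewrite bigA_distr_bigA mulr_sumr; apply: eq_bigr => b _.
by rewrite mulrCA; congr (_ * _); rewrite -big_split.
Qed.

Lemma evalp_cont N (c : {ffun 'I_d -> 'I_N} -> R) :
  continuous (fun x : 'rV[R]_d => evalp c (x 0)).
Proof.
apply: polyfun_cont; apply: polyfun_sum => a _; apply: polyfunM (polyfunC _) _.
elim: (index_enum _) => [|k r IH].
  by apply: eq_polyfun (polyfunC 1) => y; rewrite big_nil.
apply: (eq_polyfun (f := fun x : 'rV[R]_d => x 0 k ^+ a k * \prod_(j <- r) x 0 j ^+ a j)).
  by move=> y; rewrite big_cons.
apply: polyfunM => //; elim: (a k : nat) => [|i IHi]; first exact: polyfunC.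
by apply: eq_polyfun (polyfunM (polyfunX k) IHi) => y; rewrite exprS.
Qed.

(** Induction on the list: each polynomial is nonzero somewhere on the current open set, which is
    then shrunk to the nonvanishing locus. *)
Lemma common_nonzero (T : eqType) (p : T -> {N & {ffun 'I_d -> 'I_N} -> R})
    (l : seq T) (O : set 'rV[R]_d) :
  (forall t, exists a, projT2 (p t) a != 0) -> open O -> O !=set0 ->
  exists2 x, O x & {in l, forall t, evalp (projT2 (p t)) (x 0) != 0}.
Proof.
move=> nz; elim: l O => [|t l IH] O oO [x0 Ox0]; first by exists x0.
pose f (x : 'rV[R]_d) := evalp (projT2 (p t)) (x 0).
have [x1 Ox1 cx1] : exists2 x, O x & f x != 0.
  apply: contrapT => /forall2NP vanish.
  have [a /negP] := nz t; apply; apply/eqP.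
  apply: (@evalp_eq0 _ _ x0); have := open_nbhs_nbhs (conj oO Ox0).
  apply: filterS => x Ox; apply/eqP; apply: contrapT => /negP cx.
  by have [] := vanish x.
have oO' : open (O `&` [set x | f x != 0]).
  apply: openI oO _.
  by apply: (open_comp _ (@open_neq _ (0 : R))) => x _; apply: evalp_cont.
have [|x [Ox cx] lx] := IH _ oO'; first by exists x1.
by exists x => // t'; rewrite inE => /predU1P[->|/lx].
Qed.

(** If [m < d], each of the finitely many images lies in the zero set of a nonzero polynomial, and
    some interior point of [A] avoids all these zero sets. *)
Lemma polyimage_interior_dim m (T : finType) (D : T -> nat)
    (F : forall t, 'I_d -> 'rV[R]_(D t) -> R) (A : set 'rV[R]_d) :
  (forall t, D t <= m)%N -> (forall t k, polyfun (F t k)) ->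
  (forall x, A x -> exists t y, forall k, x 0 k = F t k y) ->
  interior A !=set0 -> (d <= m)%N.
Proof.
move=> Dm pF AF A0; rewrite leqNgt; apply/negP => ltmd.
have ex t : exists p : {N & {ffun 'I_d -> 'I_N} -> R},
    (exists a, projT2 p a != 0) /\ forall y, evalp (projT2 p) ((F t)^~ y) = 0.
  have [N [c c0 cF]] := algebraic_dependence (leq_ltn_trans (Dm t) ltmd) (pF t).
  by exists (existT _ N c).
have [p pP] := choice ex.
have [x Ax xp] := common_nonzero (enum T) (fun t => (pP t).1) (open_interior A) A0.
have [t [y xE]] := AF _ (interior_subset Ax).
have /negP[] := xp t (mem_enum T t).
rewrite /= -((pP t).2 y) /evalp; apply/eqP; apply: eq_bigr => a _.
by congr (_ * _); apply: eq_bigr => k _; rewrite xE.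
Qed.

End Nonvanishing.

(** * Gradients and local surjectivity of polynomial maps *)

Local Open Scope classical_set_scope.

Section Gradient.
Variables (R : realType) (D : nat).
Implicit Types (f g : 'rV[R]_D -> R) (y : 'rV[R]_D).

(** A first-order expansion with continuous coefficients, which replaces differentiability: on the
    diagonal, [H i (y, y)] is the i-th partial derivative. The same [H] is the mean-value matrix
    used in [local_surjectivity]. *)
Definition hadamard f (H : 'I_D -> 'rV[R]_D * 'rV[R]_D -> R) :=
  (forall i, continuous (H i)) /\
  forall y y', f y - f y' = \sum_i (y 0 i - y' 0 i) * H i (y, y').

Lemma hadamardC c : hadamard (fun=> c) (fun _ _ => 0).
Proof.
split=> [i p|y y']; first exact: cst_continuous.
by rewrite subrr big1 // => i _; rewrite mulr0.
Qed.

Lemma hadamardX i : hadamard (fun y => y 0 i) (fun j _ => (j == i)%:R).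
Proof.
split=> [j p|y y']; first exact: cst_continuous.
rewrite (bigD1 i) //= eqxx mulr1 big1 ?addr0 // => j /negPf->.
by rewrite mulr0.
Qed.

Lemma hadamardD f g Hf Hg : hadamard f Hf -> hadamard g Hg ->
  hadamard (fun y => f y + g y) (fun i p => Hf i p + Hg i p).
Proof.
move=> [cf fE] [cg gE]; split=> [i p|y y'].
  exact: (cvgD (cf i p) (cg i p)).
rewrite opprD addrACA fE gE -big_split.
by apply: eq_bigr => i _; rewrite mulrDr.
Qed.

Lemma hadamardM f g Hf Hg : continuous f -> continuous g ->
  hadamard f Hf -> hadamard g Hg ->
  hadamard (fun y => f y * g y) (fun i p => f p.1 * Hg i p + Hf i p * g p.2).
Proof.
move=> cf0 cg0 [cf fE] [cg gE]; split=> [i p|y y'].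
  have f1 : continuous_at p (fun p : 'rV[R]_D * 'rV[R]_D => f p.1).
    by apply: continuous_comp; [exact: cvg_fst|exact: cf0].
  have g2 : continuous_at p (fun p : 'rV[R]_D * 'rV[R]_D => g p.2).
    by apply: continuous_comp; [exact: cvg_snd|exact: cg0].
  exact: (cvgD (cvgM f1 (cg i p)) (cvgM (cf i p) g2)).
transitivity (f y * (g y - g y') + (f y - f y') * g y'); first by ring.
rewrite fE gE mulr_sumr mulr_suml -big_split; apply: eq_bigr => i _ /=.
ring.
Qed.

Lemma polyfun_hadamard f : polyfun f -> exists H, hadamard f H.
Proof.
elim=> {f} [c|i|f g _ [Hf HfP] _ [Hg HgP]|f g pf [Hf HfP] pg [Hg HgP]].
- by exists (fun _ _ => 0); apply: hadamardC.
- by exists (fun j _ => (j == i)%:R); apply: hadamardX.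
- by exists (fun i p => Hf i p + Hg i p); apply: hadamardD.
- exists (fun i p => f p.1 * Hg i p + Hf i p * g p.2).
  by apply: hadamardM => //; apply: polyfun_cont.
Qed.

(** Off the diagonal [H] is not unique. Moving along coordinate [i] alone makes [H i] a difference
    quotient, so [H i] and [H' i] agree at nonzero steps and, by continuity, at step zero. *)
Lemma hadamard_diag_uniq f H H' y i : hadamard f H -> hadamard f H' ->
  H i (y, y) = H' i (y, y).
Proof.
move=> [cH HE] [cH' HE']; apply/eqP; rewrite -subr_eq0; apply/negPn/negP => nz.
pose K p := H i p - H' i p.
have cK : continuous K by move=> p; exact: (cvgB (cH i p) (cH' i p)).
have oK : open [set p | K p != 0].
  by apply: (open_comp _ (@open_neq _ (0 : R))) => p _; apply: cK.
have /nbhs_ballP[e /= e0 eK] : nbhs (y, y) [set p | K p != 0].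
  by apply: open_nbhs_nbhs.
pose v : 'rV[R]_D := (e / 2) *: delta_mx 0 i.
have /negP[] : K (y + v, y) != 0.
  apply: eK; split => /=; last exact: ballxx.
  rewrite mx_norm_ball /ball_ /= opprD addNKr normrN normrZ.
  rewrite ger0_norm ?divr_ge0 ?ltW //.
  apply: le_lt_trans (_ : e / 2 < e); last by rewrite ltr_pdivrMr // ltr_pMr // ltr1n.
  apply: ler_piMr; first by rewrite divr_ge0 ?ltW.
  rewrite [leLHS]mx_normrE; apply: bigmax_le => //= p _.
  by rewrite mxE; case: (_ && _); rewrite ?normr1 ?normr0.
have : (e / 2) * H i (y + v, y) = (e / 2) * H' i (y + v, y).
  have := HE (y + v) y; rewrite HE'.
  rewrite (bigD1 i) //= [X in _ + X]big1 ?addr0 => [|j ji]; last first.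
    by rewrite !mxE (negPf ji) andbF mulr0 addr0 subrr mul0r.
  rewrite (bigD1 i) //= [X in _ = _ + X -> _]big1 ?addr0 => [|j ji]; last first.
    by rewrite !mxE (negPf ji) andbF mulr0 addr0 subrr mul0r.
  by rewrite !mxE !eqxx mulr1 addrAC subrr add0r => ->.
have e2 : e / 2 != 0 by rewrite lt0r_neq0 // divr_gt0.
by move/(mulfI e2)/eqP; rewrite -subr_eq0.
Qed.

(** Any expansion may be chosen, by uniqueness on the diagonal; functions without one get the
    default 0. *)
Definition grad f y : 'rV[R]_D :=
  \row_i xget (fun _ _ => 0) [set H | hadamard f H] i (y, y).

Lemma gradE f H y : hadamard f H -> grad f y = \row_i H i (y, y).
Proof.
move=> fH; apply/rowP => i; rewrite !mxE; apply: hadamard_diag_uniq (fH).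
exact: (xgetPex _ (ex_intro _ H fH)).
Qed.

Lemma gradC c y : grad (fun=> c) y = 0.
Proof. by rewrite (gradE _ (hadamardC c)); apply/rowP => i; rewrite !mxE. Qed.

Lemma gradX i y : grad (fun y => y 0 i) y = delta_mx 0 i.
Proof. by rewrite (gradE _ (hadamardX i)); apply/rowP => j; rewrite !mxE. Qed.

Lemma gradD f g y : polyfun f -> polyfun g ->
  grad (fun y => f y + g y) y = grad f y + grad g y.
Proof.
move=> /polyfun_hadamard[Hf HfP] /polyfun_hadamard[Hg HgP].
rewrite (gradE _ HfP) (gradE _ HgP) (gradE _ (hadamardD HfP HgP)).
by apply/rowP => i; rewrite !mxE.
Qed.

Lemma gradM f g y : polyfun f -> polyfun g ->
  grad (fun y => f y * g y) y = f y *: grad g y + g y *: grad f y.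
Proof.
move=> pf pg; have [Hf HfP] := polyfun_hadamard pf.
have [Hg HgP] := polyfun_hadamard pg.
rewrite (gradE _ HfP) (gradE _ HgP).
rewrite (gradE _ (hadamardM (polyfun_cont pf) (polyfun_cont pg) HfP HgP)).
by apply/rowP => i; rewrite !mxE mulrC [X in _ + X]mulrC.
Qed.

Lemma grad_sum (I : Type) (r : seq I) (F : I -> 'rV[R]_D -> R) y :
  (forall i, polyfun (F i)) ->
  grad (fun y => \sum_(i <- r) F i y) y = \sum_(i <- r) grad (F i) y.
Proof.
move=> pF; elim: r => [|i r IH].
  rewrite big_nil -(gradC 0 y); congr (grad _ y).
  by apply/funext => z; rewrite big_nil.
rewrite big_cons -IH -gradD //; last exact: polyfun_sum.
by congr (grad _ y); apply/funext => z; rewrite big_cons.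
Qed.

End Gradient.

(** Joins completeness with the normed structure of matrices, for the Banach fixed point theorem. *)
HB.instance Definition _ (R : realType) m n := Complete.on 'M[R]_(m, n).

Section LocalSurjectivity.
Variables (R : realType) (D : nat).

Lemma mx_norm_mulmx m n p (A : 'M[R]_(m, n)) (B : 'M[R]_(n, p)) :
  `|A *m B| <= n%:R * (`|A| * `|B|).
Proof.
have le_norm k l (M : 'M[R]_(k, l)) i j : `|M i j| <= `|M|.
  by rewrite [leRHS]mx_normrE; apply: (le_bigmax _ _ (i, j)).
rewrite [leLHS]mx_normrE; apply: bigmax_le => /=; first by rewrite !mulr_ge0.
move=> [i j] _; rewrite mxE; apply: le_trans (ler_norm_sum _ _ _) _.
rewrite -[n in n%:R]card_ord -sumr_const mulr_suml; apply: ler_sum => k _.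
by rewrite mul1r normrM ler_pM.
Qed.

(** To solve [F y = t], iterate the Newton map [G y = y - (F y - t) *m J] with [J] frozen at [y0].
    Its increments are [(y - y') *m A (y, y')] with [A] small near the diagonal point, so it
    contracts a closed ball. *)
Lemma local_surjectivity (F : 'rV[R]_D -> 'rV[R]_D)
    (H : 'rV[R]_D * 'rV[R]_D -> 'M[R]_D) (y0 : 'rV[R]_D) :
  continuous H -> (forall y y', F y - F y' = (y - y') *m H (y, y')) ->
  H (y0, y0) \in unitmx -> forall U, nbhs y0 U -> nbhs (F y0) (F @` U).
Proof.
move=> cH FH Ju U yU; pose J := invmx (H (y0, y0)).
pose A p := 1%:M - H p *m J.
(* A product costs a factor [D] in the max norm; this [k] makes the contraction ratio 1/2, and
   [D.+1] keeps it positive when [D = 0]. *)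
pose k : R := (2 * D.+1%:R)^-1.
have k0 : 0 < k by rewrite invr_gt0 mulr_gt0.
have /nbhs_ballP[e1 /= e10 e1A] : \forall p \near (y0, y0), `|A p| < k.
  have k1 : 0 < k / (D.+1%:R * (`|J| + 1)).
    by rewrite divr_gt0 // mulr_gt0 // ltr_wpDl.
  have /cvgrPdist_lt/(_ _ k1) := cH (y0, y0); apply: filterS => p Hp.
  rewrite /A -(mulmxV Ju) -mulmxBl; apply: le_lt_trans (mx_norm_mulmx _ _) _.
  apply: le_lt_trans (_ : (D.+1%:R * (`|J| + 1)) * `|H (y0, y0) - H p| < _).
    rewrite [X in _ <= X]mulrAC -mulrA; apply: ler_pM => //; first by rewrite ler_nat.
    by apply: ler_wpM2l => //; rewrite lerDl.
  by rewrite mulrC -ltr_pdivlMr // mulr_gt0 // ltr_wpDl.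
have /nbhs_ballP[e2 /= e20 e2U] := yU.
pose e := Num.min e1 e2 / 2.
have e0 : 0 < e by rewrite divr_gt0 // lt_min e10.
have ee : e < Num.min e1 e2 by rewrite ltr_pdivrMr // ltr_pMr ?lt_min ?e10 // ltr1n.
pose B := closed_ball_ Num.norm y0 e.
have BA y y' : B y -> B y' -> `|A (y, y')| < k.
  move=> By By'; apply: e1A; split; rewrite mx_norm_ball /ball_ /=.
    by apply: le_lt_trans By _; apply: lt_le_trans ee _; rewrite ge_min lexx.
  by apply: le_lt_trans By' _; apply: lt_le_trans ee _; rewrite ge_min lexx.
(* Keeps the first Newton step from [y0] within [e / 2]; with ratio 1/2 the ball of radius [e] is
   mapped into itself. *)
pose dt := e / (2 * (D.+1%:R * (`|J| + 1))).
have J0 : 0 < D.+1%:R * (`|J| + 1) by rewrite mulr_gt0 // ltr_wpDl.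
have dt0 : 0 < dt by rewrite divr_gt0 // mulr_gt0.
apply/nbhs_ballP; exists dt => //= t; rewrite mx_norm_ball /ball_ /= => tF.
pose G y := y - (F y - t) *m J.
have GB y y' : G y - G y' = (y - y') *m A (y, y').
  rewrite /A mulmxBr mulmx1 mulmxA -FH /G !mulmxBl.
  move: (F y *m J) (F y' *m J) (t *m J) => a b c.
  by apply/rowP => i; rewrite !mxE; ring.
have Gc y y' : B y -> B y' -> `|G y - G y'| <= 2^-1 * `|y - y'|.
  move=> By By'; rewrite GB; apply: le_trans (mx_norm_mulmx _ _) _.
  apply: le_trans (_ : D.+1%:R * (`|y - y'| * k) <= _).
    apply: ler_pM; rewrite ?mulr_ge0 ?ler_nat //.
    by apply: ler_wpM2l => //; apply/ltW/BA.
  by rewrite /k mulrCA invfM [D.+1%:R * _]mulrCA mulfV ?mulr1 // mulrC.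
have By0 : B y0 by rewrite /B /closed_ball_ /= subrr normr0 ltW.
have GBB : set_fun B B G.
  move=> y By; rewrite /B /closed_ball_ /=.
  have -> : y0 - G y = (G y0 - G y) + (y0 - G y0) by rewrite [RHS]addrC addrA subrK.
  apply: le_trans (ler_normD _ _) _; rewrite [leRHS](splitr e); apply: lerD.
    apply: le_trans (Gc _ _ By0 By) _.
    by rewrite mulrC ler_pM2r ?invr_gt0.
  rewrite /G opprB addrCA subrr addr0.
  apply: le_trans (mx_norm_mulmx _ _) _.
  apply: le_trans (_ : (D.+1%:R * (`|J| + 1)) * dt <= _).
    rewrite [X in _ <= X]mulrAC -mulrA; apply: ler_pM => //; first by rewrite ler_nat.
    by apply: ler_pM => //; [exact: ltW|rewrite lerDl].
  by rewrite /dt mulrC -mulrA invfM -[in X in e * X]mulrA mulVf ?mulr1 // gt_eqF.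
have ctr : is_contraction (mkfun_fun GBB).
  exists (2^-1)%:nng; split => /=; first by rewrite invf_lt1 ?ltr1n.
  by move=> [y y'] [/= By By']; apply: Gc.
have [p Bp /esym pG] :=
  banach_fixed_point ctr (@closed_closed_ball_ _ _ _ _) (ex_intro _ y0 By0).
exists p.
  apply: e2U; rewrite mx_norm_ball /ball_ /=.
  by apply: le_lt_trans Bp _; apply: lt_le_trans ee _; rewrite ge_min lexx orbT.
move: pG; rewrite /= /mkfun /G => /eqP; rewrite -subr_eq0 addrAC subrr sub0r oppr_eq0.
move=> /eqP/(congr1 (mulmx^~ (H (y0, y0)))); rewrite mulmxKV // mul0mx.
by move/eqP; rewrite subr_eq0 => /eqP.
Qed.

End LocalSurjectivity.

Local Close Scope classical_set_scope.

(** * The spectral theorem *)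

Definition bform (R : pzRingType) n (S : 'M[R]_n) (x y : 'rV[R]_n) : R :=
  (x *m S *m y^T) 0 0.

Section BilinearForm.
Variables (R : comPzRingType) (n : nat) (S : 'M[R]_n).
Implicit Types x y z : 'rV[R]_n.

Lemma bformDl x y z : bform S (x + y) z = bform S x z + bform S y z.
Proof. by rewrite /bform !mulmxDl mxE. Qed.

Lemma bformDr x y z : bform S x (y + z) = bform S x y + bform S x z.
Proof. by rewrite /bform linearD /= mulmxDr mxE. Qed.

Lemma bformZl a x y : bform S (a *: x) y = a * bform S x y.
Proof. by rewrite /bform -!scalemxAl mxE. Qed.

Lemma bformZr a x y : bform S x (a *: y) = a * bform S x y.
Proof. by rewrite /bform linearZ /= -!scalemxAr mxE. Qed.

Lemma bformC x y : S^T = S -> bform S x y = bform S y x.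
Proof.
move=> Ss; rewrite /bform; have -> : y *m S *m x^T = (x *m S *m y^T)^T.
  by rewrite !trmx_mul trmxK Ss mulmxA.
by rewrite [RHS]mxE.
Qed.

Lemma bform_delta i j : bform S (delta_mx 0 i) (delta_mx 0 j) = S i j.
Proof. by rewrite /bform -rowE trmx_delta -colE !mxE. Qed.

Lemma bformE x y : bform S x y = \sum_i \sum_j x 0 i * S i j * y 0 j.
Proof.
rewrite /bform mxE exchange_big; apply: eq_bigr => j _; rewrite !mxE mulr_suml.
by apply: eq_bigr => i _.
Qed.

End BilinearForm.

Section Spectral.
Variable R : realType.

Lemma dot_ge0 n (v : 'rV[R]_n) : 0 <= (v *m v^T) 0 0.
Proof. by rewrite mxE sumr_ge0 // => i _; rewrite mxE sqr_ge0. Qed.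

Lemma dot_eq0 n (v : 'rV[R]_n) : (v *m v^T) 0 0 = 0 -> v = 0.
Proof.
rewrite mxE => /eqP; rewrite psumr_eq0 => [/allP v0|i _]; last by rewrite mxE sqr_ge0.
apply/rowP => i; rewrite mxE; have := v0 i (mem_index_enum i).
by rewrite mxE mulf_eq0 orbb => /eqP.
Qed.

(* An eigenvector x + i y over R[i] for the eigenvalue a + i b satisfies       *)
(* b (|x|^2 + |y|^2) = 0 because x S y^T = y S x^T.                            *)
Lemma symmetric_eigen n (S : 'M[R]_n.+1) : S^T = S ->
  exists a, exists2 v : 'rV[R]_n.+1, v *m S = a *: v & v != 0.
Proof.
move=> Ss; pose SC := map_mx (real_complex R) S.
have /closed_rootP[mu] : size (char_poly SC) != 1%N by rewrite size_char_poly.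
rewrite -eigenvalue_root_char => /eigenvalueP[v vS v0].
pose x := map_mx (@complex.Re R) v; pose y := map_mx (@complex.Im R) v.
pose a := complex.Re mu; pose b := complex.Im mu.
have xS : x *m S = a *: x - b *: y.
  apply/rowP => i; have /rowP/(_ i)/(congr1 (@complex.Re R)) := vS.
  rewrite !mxE raddf_sum /= => E; transitivity (\sum_j complex.Re (v 0 j * SC j i)).
    apply: eq_bigr => j _; rewrite !mxE /=.
    by case: (v 0 j) => vr vi /=; rewrite mulr0 subr0.
  by rewrite E /a /b; case: mu {vS E a b} => mr mi; case: (v 0 i) => vr vi.
have yS : y *m S = b *: x + a *: y.
  apply/rowP => i; have /rowP/(_ i)/(congr1 (@complex.Im R)) := vS.
  rewrite !mxE raddf_sum /= => E; transitivity (\sum_j complex.Im (v 0 j * SC j i)).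
    apply: eq_bigr => j _; rewrite !mxE /=.
    by case: (v 0 j) => vr vi /=; rewrite mulr0 add0r.
  rewrite E /a /b; case: mu {vS E a b xS} => mr mi; case: (v 0 i) => vr vi /=.
  by rewrite addrC.
have xy0 : (x != 0) || (y != 0).
  apply: contraNT v0; rewrite negb_or !negbK => /andP[/eqP x0 /eqP y0].
  apply/eqP/rowP => i; have /rowP/(_ i) := x0; have /rowP/(_ i) := y0.
  by rewrite !mxE; case: (v 0 i) => vr vi /= -> ->.
have b0 : b = 0.
  have := bformC x y Ss.
  have dotS u w : bform S u w = bform 1%:M (u *m S) w by rewrite /bform mulmx1.
  rewrite !dotS xS yS -scaleNr !bformDl !bformZl (bformC y x (trmx1 _ _)) => E.
  have dot u : bform 1%:M u u = (u *m u^T) 0 0 by rewrite /bform mulmx1.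
  have xx := dot_ge0 x; have yy := dot_ge0 y; move: xx yy E; rewrite -!dot.
  set xx := bform _ x x; set yy := bform _ y y => xx0 yy0 E.
  have [//|bn0] := eqVneq b 0; have : b * (xx + yy) = 0 by lra.
  move/eqP; rewrite mulf_eq0 (negPf bn0) /= paddr_eq0 // => /andP[/eqP x0 /eqP y0].
  have x00 : x = 0 by apply: dot_eq0; rewrite -dot.
  have y00 : y = 0 by apply: dot_eq0; rewrite -dot.
  by move: xy0; rewrite x00 y00 eqxx.
move: xS yS; rewrite b0 !scale0r subr0 add0r => xS yS; exists a.
by case/orP: xy0; [exists x|exists y].
Qed.

(** The reflection along [v - e] exchanges [v] and the first basis vector [e]; it degenerates to the
    identity when [v = e]. *)
Lemma householder n (v : 'rV[R]_n.+1) : v *m v^T = 1%:M ->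
  exists H : 'M[R]_n.+1, [/\ H^T = H, H *m H = 1%:M & row 0 H = v].
Proof.
move=> v1; pose e : 'rV[R]_n.+1 := delta_mx 0 0; pose w := v - e.
have ee : e *m e^T = 1%:M.
  by rewrite /e trmx_delta mul_delta_mx; apply/matrixP => i j; rewrite !ord1 !mxE.
have ev : e *m v^T = (v 0 0)%:M.
  by rewrite -rowE; apply/matrixP => i j; rewrite !ord1 !mxE mulr1n.
have ve : v *m e^T = (v 0 0)%:M.
  by rewrite trmx_delta -colE; apply/matrixP => i j; rewrite !ord1 !mxE mulr1n.
have [w0|w0] := eqVneq w 0.
  exists 1%:M; rewrite trmx1 mulmx1; split=> //.
  by move/eqP: w0; rewrite subr_eq0 => /eqP->; apply/rowP => i; rewrite !mxE eq_sym.
have ww : w *m w^T = (2 * (1 - v 0 0))%:M.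
  rewrite /w linearB /= mulmxBr !mulmxBl v1 ee ev ve -!raddfB /=; congr (_%:M).
  by ring.
have c0 : 1 - v 0 0 != 0.
  apply: contraNneq w0 => c0; apply/eqP/dot_eq0.
  by rewrite ww c0 mulr0 mxE mul0rn.
pose c := (1 - v 0 0)^-1; pose W := w^T *m w.
have WW : W *m W = (2 * (1 - v 0 0)) *: W.
  by rewrite /W mulmxA -[w^T *m w *m w^T]mulmxA ww mul_mx_scalar scalemxAl.
have Ws : W^T = W by rewrite /W trmx_mul trmxK.
exists (1%:M - c *: W); split.
- by rewrite linearB /= linearZ /= trmx1 Ws.
- have cc : (c *: W) *m (c *: W) = 2 *: (c *: W).
    rewrite -scalemxAl -scalemxAr WW !scalerA; congr (_ *: _).
    by rewrite /c; field.
  rewrite mulmxBr mulmx1 mulmxBl mul1mx cc; move: (c *: W) => M.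
  by apply/matrixP => i j; rewrite mxE [(1%:M - M) i j]mxE !mxE; ring.
rewrite rowE mulmxBr mulmx1 -scalemxAr /W mulmxA.
have -> : e *m w^T = (v 0 0 - 1)%:M by rewrite /w linearB /= mulmxBr ev ee raddfB.
rewrite mul_scalar_mx scalerA (_ : c * (v 0 0 - 1) = -1); last by rewrite /c; field.
by rewrite scaleN1r opprK addrC subrK.
Qed.

(** Conjugation by the Householder reflection of a unit eigenvector splits off a 1 x 1 block;
    induction diagonalizes the rest. *)
Theorem real_spectral n (S : 'M[R]_n) : S^T = S ->
  exists Q, exists2 d : 'rV[R]_n, Q *m Q^T = 1%:M & S = Q^T *m diag_mx d *m Q.
Proof.
elim: n S => [|n IH] S Ss.
  by exists 1%:M; exists 0; rewrite ?trmx1 ?mulmx1 //; apply/matrixP => -[].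
have [a [v0 v0S nz]] := symmetric_eigen Ss.
pose k := (v0 *m v0^T) 0 0.
have k0 : 0 < k.
  by rewrite lt_def dot_ge0 andbT; apply: contraNneq nz => /dot_eq0->.
pose v := (Num.sqrt k)^-1 *: v0.
have v1 : v *m v^T = 1%:M.
  rewrite /v linearZ /= -scalemxAl -scalemxAr scalerA [_ *m _]mx11_scalar -/k.
  rewrite scale_scalar_mx -invfM -expr2 sqr_sqrtr ?ltW // mulVf //.
  by rewrite gt_eqF.
have vS : v *m S = a *: v by rewrite /v -scalemxAl v0S !scalerA mulrC.
have [H [Hs HH Hv]] := householder v1.
pose T := H *m S *m H.
have Ts : T^T = T by rewrite /T !trmx_mul Hs Ss mulmxA.
have T0 : row 0 T = a *: delta_mx 0 0.
  rewrite /T !row_mul Hv vS -scalemxAl -Hv -row_mul HH.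
  by congr (_ *: _); apply/rowP => i; rewrite !mxE eq_sym.
have ST : S = H *m T *m H.
  by rewrite /T !mulmxA HH mul1mx -mulmxA HH mulmx1.
clearbody T; pose T' : 'M[R]_(1 + n) := T; pose T1 := drsubmx T'.
have T1s : T1^T = T1 by rewrite /T1 trmx_drsub /T' Ts.
have TE : T' = block_mx a%:M 0 0 T1.
  have ur : ursubmx T' = 0.
    apply/matrixP => i j; rewrite !mxE ord1; have /rowP/(_ (rshift 1 j)) := T0.
    by rewrite !mxE mulr0 => <-; congr (T _ _); apply: val_inj.
  rewrite -[LHS]submxK ur; congr block_mx.
    apply/matrixP => i j; rewrite !mxE !ord1; have /rowP/(_ 0) := T0.
    by rewrite !mxE eqxx mulr1 => <-; congr (T _ _); apply: val_inj.
  by rewrite -[LHS]trmxK trmx_dlsub (_ : T'^T = T') // ur trmx0.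
have [Q1 [d1 Q1o T1E]] := IH _ T1s.
pose B : 'M[R]_(1 + n) := block_mx 1%:M 0 0 Q1.
have BB : B *m B^T = 1%:M.
  rewrite /B tr_block_mx mulmx_block !trmx0 trmx1 !mulmx0 !mul0mx !addr0 add0r.
  by rewrite mulmx1 Q1o -scalar_mx_block.
exists (B *m H); exists (row_mx a%:M d1).
  by rewrite trmx_mul Hs mulmxA -[B *m H *m H]mulmxA HH mulmx1.
rewrite ST trmx_mul Hs -!mulmxA; congr (_ *m _); rewrite !mulmxA; congr (_ *m _).
have -> : T = B^T *m diag_mx (row_mx a%:M d1) *m B :> 'M_(1 + n); last by [].
rewrite -/T' TE T1E /B tr_block_mx diag_mx_row !trmx0 trmx1.
rewrite !mulmx_block !mulmx0 !mul0mx !addr0 !add0r mul1mx mulmx1.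
rewrite !mul0mx; congr block_mx.
by apply/matrixP => i j; rewrite !ord1 !mxE.
Qed.

End Spectral.

(** * Lorentzian forms *)

(* For a symmetric S, this says that S has exactly one positive eigenvalue.    *)
Definition lorentzian (R : realType) n (S : 'M[R]_n) : Prop :=
  (exists x, 0 < bform S x x) /\
  (exists l : 'cV[R]_n, forall x, x *m l = 0 -> bform S x x <= 0).

Section Lorentzian.
Variables (R : realType) (n : nat) (S : 'M[R]_n).
Hypotheses (Ss : S^T = S) (SL : lorentzian S).

(** Otherwise the form is positive definite on the span of [x] and [y], yet a nonzero combination
    [a *: x - b *: y] lies in the hyperplane where the form is nonpositive. *)
Lemma reverse_cauchy_schwarz x y : 0 < bform S x x ->
  bform S x x * bform S y y <= bform S x y ^+ 2.
Proof.
move=> qx; have [_ [l lS]] := SL; rewrite leNgt; apply/negP => D.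
pose a := (y *m l) 0 0; pose b := (x *m l) 0 0.
have b0 : b != 0.
  apply: contraTneq qx => b0; rewrite -leNgt; apply: lS.
  by apply/matrixP => i j; rewrite !ord1 [LHS]b0 mxE.
have : bform S (a *: x - b *: y) (a *: x - b *: y) <= 0.
  apply: lS; rewrite mulmxBl -!scalemxAl [x *m l]mx11_scalar [y *m l]mx11_scalar.
  by rewrite -/a -/b !scale_scalar_mx mulrC subrr.
rewrite -scaleNr !(bformDl, bformDr, bformZl, bformZr) (bformC y x Ss) => le0.
set qxx := bform S x x in qx D le0; set qxy := bform S x y in D le0.
set qyy := bform S y y in D le0.
have : 0 < (a * qxx - b * qxy) ^+ 2 + b ^+ 2 * (qxx * qyy - qxy ^+ 2).
  by rewrite ltr_wpDl ?sqr_ge0 // mulr_gt0 ?subr_gt0 // exprn_even_gt0.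
have -> : (a * qxx - b * qxy) ^+ 2 + b ^+ 2 * (qxx * qyy - qxy ^+ 2) =
   qxx * (a * (a * qxx) + a * (- b * qxy) + (- b * (a * qxy) + - b * (- b * qyy))).
  by ring.
by rewrite ltNge pmulr_rle0 // le0.
Qed.

(** Move [v] to [v + e *: u] with [u = v *m S]: its square is 2 e |u|^2 up to order e^2, while its
    product with [x] is of order e. For small e this violates the reverse Cauchy-Schwarz inequality
    unless [u = 0]. *)
Lemma isotropic_orthogonal x v : 0 < bform S x x -> bform S x v = 0 ->
  bform S v v = 0 -> v *m S = 0.
Proof.
move=> qx xv vv; apply: dot_eq0; apply/eqP; rewrite eq_le dot_ge0 andbT.
set u := v *m S.
have vu : bform S v u = (u *m u^T) 0 0 by rewrite /bform.
rewrite leNgt; apply/negP => pos.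
pose c := bform S x u ^+ 2 - bform S x x * bform S u u.
(* Small enough that the second-order term [e * c] is at most half of the first-order term; the
   added 1 avoids dividing by zero. *)
pose e := bform S x x * (u *m u^T) 0 0 / (`|c| + 1).
have e0 : 0 < e by rewrite divr_gt0 ?mulr_gt0 // ltr_wpDl.
have := reverse_cauchy_schwarz (v + e *: u) qx.
have -> : bform S (v + e *: u) (v + e *: u) =
    2 * e * (u *m u^T) 0 0 + e ^+ 2 * bform S u u.
  rewrite !(bformDl, bformDr, bformZl, bformZr) (bformC u v Ss) vv vu; ring.
rewrite bformDr bformZr xv add0r leNgt => /negP; apply; rewrite -subr_gt0.
set d := (u *m u^T) 0 0 in pos e e0 *; set q := bform S x x in qx c e e0 *.
have -> : q * (2 * e * d + e ^+ 2 * bform S u u) - (e * bform S x u) ^+ 2 =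
  e * (2 * (q * d) - e * c) by rewrite /c; ring.
rewrite mulr_gt0 // subr_gt0.
have ec : e * c <= q * d.
  apply: le_trans (_ : e * (`|c| + 1) <= _); last first.
    by rewrite /e divfK // gt_eqF // ltr_wpDl.
  by rewrite ler_pM2l // (le_trans (ler_norm _)) // lerDl.
by apply: le_lt_trans ec _; rewrite ltr_pMl ?mulr_gt0 // ltr1n.
Qed.

End Lorentzian.

Lemma rank_diag (F : fieldType) n (d : 'rV[F]_n) :
  \rank (diag_mx d) = count (fun a => a != 0) [seq d 0 i | i <- enum 'I_n].
Proof.
elim: n d => [|n IH] d; first by rewrite [diag_mx d]flatmx0 mxrank0 enum_ord0.
pose d1 : 'rV[F]_(1 + n) := d.
transitivity (\rank (diag_mx d1)); first by [].
rewrite -[d1]hsubmxK diag_mx_row rank_diag_block_mx IH enum_ordSl /= -!map_comp.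
congr (_ + _)%N.
  rewrite rank_rV; congr (nat_of_bool (~~ _)); apply/eqP/eqP => [/rowP/(_ 0)|d0].
    by rewrite !mxE mulr1n => <-; congr (d _ _); apply: val_inj.
  by apply/rowP => i; rewrite !mxE !ord1 -[RHS]d0 mulr1n; congr (d _ _); apply: val_inj.
congr count; apply: eq_map => i /=; rewrite mxE.
by congr (d _ _); apply: val_inj.
Qed.

Lemma count_enum (T : finType) (P : pred T) : count P (enum T) = #|P|.
Proof. by rewrite cardE -size_filter enumT. Qed.

Section Signature.
Variables (R : realType) (n : nat) (S : 'M[R]_n).
Hypothesis (Ss : S^T = S).

Lemma char_poly_spectral (Q : 'M[R]_n) (d : 'rV[R]_n) : Q *m Q^T = 1%:M ->
  S = Q^T *m diag_mx d *m Q ->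
  char_poly S = \prod_(a <- [seq d 0 i | i <- enum 'I_n]) ('X - a%:P).
Proof.
move=> QQ ->; have QQ' := mulmx1C QQ.
pose f (M : 'M[R]_n) := map_mx (@polyC R) M.
have -> : char_poly (Q^T *m diag_mx d *m Q) = char_poly (diag_mx d).
  rewrite /char_poly /char_poly_mx !map_mxM.
  have XE : 'X%:M = f (Q^T) *m 'X%:M *m f Q :> 'M_n.
    by rewrite -mulmxA mul_scalar_mx -scalemxAr /f -map_mxM QQ' map_mx1 scalemx1.
  rewrite [in LHS]XE -mulmxBl -mulmxBr !det_mulmx mulrAC -det_mulmx -map_mxM QQ'.
  by rewrite map_mx1 det1 mul1r.
rewrite char_poly_trig ?diag_mx_is_trig // big_map big_enum /=.
by apply: eq_bigr => i _; rewrite mxE eqxx mulr1n.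
Qed.

Lemma bform_spectral (Q : 'M[R]_n) (d : 'rV[R]_n) x y :
  S = Q^T *m diag_mx d *m Q ->
  bform S x y = \sum_i d 0 i * ((x *m Q^T) 0 i * (y *m Q^T) 0 i).
Proof.
move=> ->; rewrite /bform !mulmxA -mulmxA mxE.
have -> : Q *m y^T = (y *m Q^T)^T by rewrite trmx_mul trmxK.
by apply: eq_bigr => i _; rewrite mul_mx_diag !mxE mulrCA mulrA.
Qed.

Lemma rank_spectral (Q : 'M[R]_n) (d : 'rV[R]_n) : Q *m Q^T = 1%:M ->
  S = Q^T *m diag_mx d *m Q -> \rank S = count (fun a => a != 0) [seq d 0 i | i <- enum 'I_n].
Proof.
move=> QQ ->; have [Qu QTu] := mulmx1_unit QQ.
rewrite mxrankMfree ?row_free_unit // -mxrank_tr trmx_mul tr_diag_mx trmxK.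
rewrite mxrankMfree ?row_free_unit //.
exact: rank_diag.
Qed.

(** An eigenvector for the positive eigenvalue is a positive vector, and its orthogonal complement
    is the required hyperplane. *)
Lemma lorentzian_signature (e : seq R) :
  char_poly S = \prod_(a <- e) ('X - a%:P) ->
  count (fun a => 0 < a) e = 1%N -> lorentzian S.
Proof.
move=> Se e1; have [Q [d QQ SE]] := real_spectral Ss.
have : perm_eq e [seq d 0 i | i <- enum 'I_n].
  by apply: prod_XsubC_eq; rewrite -Se; exact: char_poly_spectral SE.
move=> /permP/(_ (fun a => 0 < a)); rewrite e1 count_map => /esym c1.
have [i di] : exists i, 0 < d 0 i.
  have : has (fun i => 0 < d 0 i) (enum 'I_n) by rewrite has_count c1.
  by case/hasP => i _; exists i.
split.
  exists (row i Q); rewrite (bform_spectral _ _ SE) -row_mul QQ (bigD1 i) //=.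
  rewrite big1 ?addr0 => [|j ji]; first by rewrite !mxE eqxx !mulr1.
  by rewrite !mxE eq_sym (negPf ji) !mulr0.
exists (row i Q)^T => x xQ; rewrite (bform_spectral _ _ SE) (bigD1 i) //=.
have -> : (x *m Q^T) 0 i = 0.
  have /matrixP/(_ 0 0) := xQ; rewrite !mxE => E; rewrite -[RHS]E.
  by apply: eq_bigr => k _; rewrite !mxE.
rewrite !mulr0 add0r; apply: sumr_le0 => j ji.
rewrite mulr_le0_ge0 ?sqr_ge0 // leNgt; apply/negP => dj.
have : (#|[set i; j]| <= #|[pred i | (0 < d 0 i)%R]|)%N.
  by apply/subset_leq_card/fintype.subsetP => k; rewrite !inE => /orP[] /eqP->.
by rewrite cards2 eq_sym ji -count_enum c1.
Qed.

(** Two positive eigenvalues would give orthogonal positive vectors, against the reverse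
    Cauchy-Schwarz inequality. The rank counts the nonzero eigenvalues. *)
Lemma signature_lorentzian : lorentzian S ->
  exists e : seq R, [/\ char_poly S = \prod_(a <- e) ('X - a%:P),
     count (fun a => 0 < a) e = 1%N & (count (fun a => a < 0) e).+1 = \rank S].
Proof.
move=> SL; have [Q [d QQ SE]] := real_spectral Ss.
pose e := [seq d 0 i | i <- enum 'I_n].
have e1 : count (fun a => 0 < a) e = 1%N.
  rewrite count_map count_enum; apply/eqP; rewrite eqn_leq; apply/andP; split.
    apply/card_le1P => i; rewrite inE => di j; rewrite !inE.
    apply/idP/eqP => [dj|->//]; apply/eqP; apply: contraT => ji.
    have bf k l : bform S (row k Q) (row l Q) = d 0 k *+ (k == l).
      rewrite (bform_spectral _ _ SE) -!row_mul QQ (bigD1 k) //=.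
      rewrite big1 ?addr0 => [|h hk]; last first.
        by rewrite !mxE [k == h]eq_sym (negPf hk) mul0r mulr0.
      by rewrite !mxE eqxx mul1r eq_sym mulr_natr.
    have := reverse_cauchy_schwarz Ss SL (row j Q) (x := row i Q).
    rewrite !bf !eqxx [i == j]eq_sym (negPf ji) expr0n => /(_ di).
    by rewrite leNgt mulr_gt0.
  have [[x qx] _] := SL; rewrite lt0n; apply/negP => /eqP d0.
  move: qx; rewrite ltNge (bform_spectral _ _ SE) => /negP; apply.
  apply: sumr_le0 => i _; rewrite mulr_le0_ge0 ?sqr_ge0 // leNgt; apply/negP => di.
  by have := card0_eq d0 i; rewrite inE /= di.
exists e; split=> //; first exact: char_poly_spectral SE.
rewrite (rank_spectral QQ SE) -/e -[_.+1]add1n -e1 -count_predUI.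
rewrite [X in (_ + X)%N](_ : _ = 0%N) ?addn0; last first.
  by apply/eqP; rewrite -leqn0 leqNgt -has_count; apply/hasPn => a _ /=; lra.
by apply: eq_count => a /=; rewrite [RHS]neq_lt orbC.
Qed.

End Signature.

(** * Configurations of lightlike vectors *)

Section Matroid.
Variables (n : nat) (P : matroid n).
Implicit Types i j : 'I_n.

Lemma matroid_trivIset : finset.trivIset P.
Proof. by have /and3P[_ tP _] := parts_partition P. Qed.

Lemma matroid_set0 : (finset.set0 \in parts P) = false.
Proof. by have /and3P[_ _ /negPf] := parts_partition P. Qed.

Definition nonloop i := i \in finset.cover P.

(** On a loop [pblock] returns the empty set, so all loops share one block that is not a part. *)
Definition block i : {set 'I_n} := finset.pblock P i.

Lemma block_part i : nonloop i -> block i \in parts P.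
Proof. exact: finset.pblock_mem. Qed.

Lemma block_loop i : ~~ nonloop i -> block i = finset.set0.
Proof.
move=> il; apply/eqP; apply: contraNT il => /finset.set0Pn[j].
rewrite /block /finset.pblock; case: pickP => [B /andP[BP iB] _|_]; last by rewrite inE.
by apply/finset.bigcupP; exists B.
Qed.

Lemma block_of A i : A \in parts P -> i \in A -> block i = A.
Proof. by move=> AP iA; apply: finset.def_pblock => //; apply: matroid_trivIset. Qed.

Lemma nonloop_of A i : A \in parts P -> i \in A -> nonloop i.
Proof. by move=> AP iA; apply/finset.bigcupP; exists A. Qed.

Lemma part_elt A : A \in parts P -> exists i, [/\ i \in A, nonloop i & block i = A].
Proof.
move=> AP; have /finset.set0Pn[i iA] : A != finset.set0.
  by apply: contraTneq AP => ->; rewrite matroid_set0.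
by exists i; rewrite (block_of AP iA) (nonloop_of AP iA).
Qed.

Lemma matroid_basisE i j : matroid_basis P i j =
  [&& nonloop i, nonloop j & block i != block j].
Proof.
apply/existsP/and3P => [[A /andP[AP /existsP[B /and4P[BP AB iA jB]]]]|[ni nj ij]].
  by rewrite (block_of AP iA) (block_of BP jB) (nonloop_of AP iA) (nonloop_of BP jB).
exists (block i); rewrite block_part //=; apply/existsP; exists (block j).
by rewrite block_part //= ij !finset.mem_pblock; apply/and3P; split.
Qed.

End Matroid.

Definition posdef (R : realType) d (C : 'M[R]_d) :=
  forall v : 'rV[R]_d, v != 0 -> 0 < bform C v v.

(* The vector a_i (1, z_i, z_i C z_i^T) (when fin i) or a_i (0, 0, 1) (point   *)
(* at infinity) is lightlike for the Lorentzian form                           *)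
(* <(u, v, w), (u', v', w')> = u w' + u' w - 2 v C v'^T; the matrix below is   *)
(* the Gram matrix of these n vectors.                                         *)
Section Configuration.
Variables (R : realType) (n d : nat).
Variables (a : 'I_n -> R) (z : 'I_n -> 'rV[R]_d) (C : 'M[R]_d) (fin : 'I_n -> bool).

Definition wt i := if fin i then bform C (z i) (z i) else 1.

Definition gram i j := (fin i)%:R * wt j + wt i * (fin j)%:R - 2 * bform C (z i) (z j).

Definition config_mx : 'M[R]_n := \matrix_(i, j) (a i * a j * gram i j).

Definition momentum :=
  [/\ \sum_i a i * (fin i)%:R = 0, \sum_i a i *: z i = 0 & \sum_i a i * wt i = 0].

Hypothesis Cs : C^T = C.
Hypothesis z_inf : forall i, ~~ fin i -> z i = 0.

Lemma bform0l (S : 'M[R]_d) x : bform S 0 x = 0.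
Proof. by rewrite /bform !mul0mx mxE. Qed.

Lemma bform0r (S : 'M[R]_d) x : bform S x 0 = 0.
Proof. by rewrite /bform trmx0 !mulmx0 mxE. Qed.

Lemma gram_inf i j : ~~ fin i -> gram i j = (fin j)%:R.
Proof.
by move=> fi; rewrite /gram /wt (negPf fi) (z_inf fi) bform0l mulr0 subr0 mul0r add0r mul1r.
Qed.

Lemma gramC i j : gram i j = gram j i.
Proof. by rewrite /gram (bformC _ _ Cs); ring. Qed.

Lemma gram_fin i j : fin i -> fin j -> gram i j = bform C (z i - z j) (z i - z j).
Proof.
move=> fi fj; rewrite /gram /wt fi fj mulr1 mul1r -[- z j]scaleN1r.
by rewrite !(bformDl, bformDr, bformZl, bformZr) (bformC (z j) (z i) Cs); ring.
Qed.

Lemma config_sym : config_mx^T = config_mx.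
Proof. by apply/matrixP => i j; rewrite !mxE gramC [a j * _]mulrC. Qed.

Lemma gram_diag i : gram i i = 0.
Proof.
have [fi|fi] := boolP (fin i); first by rewrite gram_fin // subrr bform0l.
by rewrite gram_inf // (negPf fi).
Qed.

Lemma bform_sumr (I : Type) (r : seq I) (F : I -> 'rV[R]_d) x :
  bform C x (\sum_(i <- r) F i) = \sum_(i <- r) bform C x (F i).
Proof.
elim: r => [|i r IH]; first by rewrite !big_nil bform0r.
by rewrite !big_cons bformDr IH.
Qed.

Lemma config_row_sum i : momentum -> \sum_j config_mx i j = 0.
Proof.
move=> [M1 M2 M3].
transitivity (a i * ((fin i)%:R * (\sum_j a j * wt j) +
    wt i * (\sum_j a j * (fin j)%:R) - 2 * bform C (z i) (\sum_j a j *: z j))).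
  rewrite bform_sumr !mulr_sumr -big_split -sumrB mulr_sumr; apply: eq_bigr => j _.
  by rewrite mxE /gram bformZr /=; ring.
by rewrite M1 M2 M3 bform0r; ring.
Qed.

Variables (ki k0 : 'I_n) (k : 'I_d -> 'I_n).
Hypotheses (fki : ~~ fin ki) (fk0 : fin k0) (fk : forall l, fin (k l)).
Hypotheses (zk0 : z k0 = 0) (zk : forall l, z (k l) = delta_mx 0 l).
Hypotheses (aki : a ki != 0) (ak0 : a k0 != 0) (ak : forall l, a (k l) != 0).
Hypothesis Cpos : posdef C.

Let A : 'M[R]_(n, 1 + (1 + d)) :=
  row_mx (\col_i (a i * (fin i)%:R)) (row_mx (\col_i (a i * wt i)) (\matrix_i (a i *: z i))).

Let wki : wt ki = 1. Proof. by rewrite /wt (negPf fki). Qed.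
Let wk0 : wt k0 = 0. Proof. by rewrite /wt fk0 zk0 bform0l. Qed.

Let xA (x : 'rV[R]_n) : x *m A =
  row_mx (\sum_i x 0 i * (a i * (fin i)%:R))%:M
   (row_mx (\sum_i x 0 i * (a i * wt i))%:M (\sum_i x 0 i *: (a i *: z i))).
Proof.
rewrite /A !mul_mx_row; congr (row_mx _ (row_mx _ _)).
- by apply/matrixP => i j; rewrite !ord1 !mxE; under eq_bigr do rewrite mxE.
- by apply/matrixP => i j; rewrite !ord1 !mxE; under eq_bigr do rewrite mxE.
- by rewrite mulmx_sum_row; apply: eq_bigr => i _; rewrite rowK.
Qed.

Let xS (x : 'rV[R]_n) j : (x *m config_mx) 0 j =
  a j * ((\sum_i x 0 i * (a i * (fin i)%:R)) * wt j +
         (\sum_i x 0 i * (a i * wt i)) * (fin j)%:R -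
         2 * bform C (\sum_i x 0 i *: (a i *: z i)) (z j)).
Proof.
rewrite (bformC _ _ Cs) bform_sumr !mulr_suml !mulr_sumr -big_split -sumrB mulr_sumr mxE.
apply: eq_bigr => i _; rewrite !mxE !bformZr (bformC _ _ Cs) /gram /=; ring.
Qed.

(** [x *m A] is the combination of the lightlike vectors with coefficients [x]. If it is orthogonal
    to all of them, pairing with [k0] and [ki] kills its first two coordinates, and pairing with the
    [k l] kills the rest, as [C] is definite. *)
Let kerSA (x : 'rV[R]_n) : (x *m config_mx == 0) = (x *m A == 0).
Proof.
apply/eqP/eqP => [x0|].
  have E j : (x *m config_mx) 0 j = 0 by rewrite x0 mxE.
  have := E k0; rewrite xS wk0 zk0 bform0r fk0 !mulr0 mulr1 add0r subr0.
  move/eqP; rewrite mulf_eq0 (negPf ak0) /= => /eqP be0.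
  have := E ki; rewrite xS be0 wki (z_inf fki) bform0r mul0r !mulr0 mulr1 addr0 subr0.
  move/eqP; rewrite mulf_eq0 (negPf aki) => /eqP al0.
  rewrite xA be0 al0; set v := \sum_i _; have [-> |v0] := eqVneq v 0.
    by rewrite !raddf0 !row_mx0.
  suff vC : v *m C = 0 by have := Cpos v0; rewrite /bform vC mul0mx mxE ltxx.
  apply/rowP => l; rewrite [RHS]mxE; have := E (k l).
  rewrite xS al0 be0 !mul0r add0r sub0r -/v zk /bform trmx_delta -colE => /eqP.
  by rewrite mulf_eq0 (negPf (ak l)) /= oppr_eq0 mulf_eq0 pnatr_eq0 /= => /eqP; rewrite mxE.
move=> x0; have xA0 := xA x; rewrite x0 in xA0.
have := congr1 (fun M => lsubmx M 0 0) xA0.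
rewrite row_mxKl raddf0 mxE [RHS]mxE mulr1n => /esym al0.
have := congr1 (fun M => lsubmx (rsubmx M) 0 0) xA0.
rewrite row_mxKr row_mxKl !raddf0 mxE [RHS]mxE mulr1n => /esym be0.
have := congr1 (fun M => rsubmx (rsubmx M)) xA0; rewrite !row_mxKr !raddf0 => /esym v0.
apply/rowP => j.
by rewrite xS al0 be0 v0 bform0l mxE; ring.
Qed.

Lemma config_rank : \rank config_mx = d.+2.
Proof.
have rA : \rank A = d.+2.
  rewrite -mxrank_tr; apply/eqP; rewrite -/(row_free _) -kermx_eq0; apply/rowV0P => v.
  move=> /sub_kermxP vA; have E i : (v *m A^T) 0 i = 0 by rewrite vA mxE.
  pose al := lsubmx v; pose be := lsubmx (rsubmx v); pose u := rsubmx (rsubmx v).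
  have vE : v = row_mx al (row_mx be u) by rewrite !hsubmxK.
  clearbody al be u.
  have {}E i : a i * (al 0 0 * (fin i)%:R + be 0 0 * wt i + (u *m (z i)^T) 0 0) = 0.
    rewrite -[RHS](E i) vE /A !tr_row_mx !mul_row_col !mxE !big_ord1 !mxE !mulrDr -addrA; congr (_ + _).
      by ring.
    congr (_ + _); first by ring.
    by rewrite mulr_sumr; apply: eq_bigr => l _; rewrite !mxE; ring.
  have be0 : be 0 0 = 0.
    have := E ki; rewrite (negPf fki) wki (z_inf fki) trmx0 mulmx0 mxE mulr0 mulr1.
    by rewrite add0r addr0 => /eqP; rewrite mulf_eq0 (negPf aki) => /eqP.
  have al0 : al 0 0 = 0.
    have := E k0; rewrite fk0 wk0 zk0 trmx0 mulmx0 mxE !mulr0 mulr1 !addr0.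
    by move/eqP; rewrite mulf_eq0 (negPf ak0) => /eqP.
  have u0 : u = 0.
    apply/rowP => l; rewrite [RHS]mxE; have := E (k l); rewrite al0 be0 !mul0r !add0r zk.
    rewrite trmx_delta -colE => /eqP; rewrite mulf_eq0 (negPf (ak l)) /= mxE.
    by move/eqP.
  by rewrite vE [al]mx11_scalar [be]mx11_scalar al0 be0 u0 !raddf0 !row_mx0.
have : \rank (kermx config_mx) = \rank (kermx A).
  apply: eqmx_rank; apply/andP; split.
    by apply/row_subP => i; apply/sub_kermxP/eqP; rewrite -kerSA -row_mul mulmx_ker row0.
  by apply/row_subP => i; apply/sub_kermxP/eqP; rewrite kerSA -row_mul mulmx_ker row0.
rewrite !mxrank_ker rA => E; have := rank_leq_row config_mx; have := rank_leq_row A.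
by rewrite rA; lia.
Qed.

(** With coordinates al, be, v of the combined vector, the quadratic form is 2 (al be - C(v, v)),
    which is nonpositive on the hyperplane al + be = 0. *)
Lemma config_lorentzian : lorentzian config_mx.
Proof.
have qE x : bform config_mx x x = 2 * ((\sum_i x 0 i * (a i * (fin i)%:R)) *
    (\sum_i x 0 i * (a i * wt i)) -
    bform C (\sum_i x 0 i *: (a i *: z i)) (\sum_i x 0 i *: (a i *: z i))).
  rewrite [LHS]/bform mxE; under eq_bigr do rewrite xS !mxE.
  set al := \sum_i x 0 i * (a i * (fin i)%:R).
  set be := \sum_i x 0 i * (a i * wt i); set v := \sum_i x 0 i *: (a i *: z i).
  have vv : bform C v v = \sum_i bform C v (x 0 i *: (a i *: z i)).
    by rewrite -bform_sumr.
  have ab : al * be = \sum_i al * (x 0 i * (a i * wt i)) by rewrite -mulr_sumr.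
  have ba : be * al = \sum_i be * (x 0 i * (a i * (fin i)%:R)) by rewrite -mulr_sumr.
  transitivity (al * be + be * al - 2 * bform C v v); last by ring.
  rewrite vv ab ba mulr_sumr -big_split -sumrB; apply: eq_bigr => i _ /=.
  by rewrite !bformZr; ring.
split.
  have S0 : config_mx ki k0 != 0.
    by rewrite mxE gram_inf // fk0 mulr1 mulf_neq0.
  exists (delta_mx 0 ki + config_mx ki k0 *: delta_mx 0 k0).
  rewrite !(bformDl, bformDr, bformZl, bformZr) !bform_delta.
  have -> : config_mx k0 ki = config_mx ki k0 by rewrite -[in LHS]config_sym mxE.
  have dg i : config_mx i i = 0 by rewrite mxE gram_diag mulr0.
  rewrite !dg !mulr0 add0r addr0 -mulr2n pmulrn_lgt0 // -expr2.
  by rewrite exprn_even_gt0.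
exists (\col_i (a i * (fin i)%:R + a i * wt i)) => x /matrixP/(_ 0 0).
rewrite [LHS]mxE [RHS]mxE; under eq_bigr do rewrite mxE mulrDr.
rewrite big_split /= qE; set al := \sum_i x 0 i * (a i * (fin i)%:R).
set be := \sum_i x 0 i * (a i * wt i); set v := \sum_i x 0 i *: (a i *: z i).
have : 0 <= bform C v v.
  by have [->|/Cpos/ltW//] := eqVneq v 0; rewrite bform0l.
move=> v0 /eqP; rewrite addrC addr_eq0 => /eqP->; rewrite mulrN.
by have := sqr_ge0 al; rewrite expr2; lra.
Qed.

End Configuration.

(** Gram entries of finite points are squared [C]-distances, hence positive exactly between distinct
    points; the signs of the matrix entries come from the weights alone. *)
Lemma config_mmc (R : realType) n (P : matroid n) (s : signs n) d
    (a : 'I_n -> R) (z : 'I_n -> 'rV[R]_d) (C : 'M[R]_d)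
    (ki k0 : 'I_n) (k : 'I_d -> 'I_n) (fin := fun i => block P i != block P ki) :
  C^T = C -> posdef C -> nonloop P ki -> nonloop P k0 -> (forall l, nonloop P (k l)) ->
  (forall i, ~~ nonloop P i -> a i = 0) ->
  (forall i, nonloop P i -> Num.sg (a i) = sign_val R (s i)) ->
  (forall i, ~~ fin i -> z i = 0) ->
  fin k0 -> (forall l, fin (k l)) -> z k0 = 0 -> (forall l, z (k l) = delta_mx 0 l) ->
  (forall i j, nonloop P i -> nonloop P j -> fin i -> fin j ->
     (block P i == block P j) = (z i == z j)) ->
  momentum a z C fin ->
  mmc_stratum P s d.+2 (config_mx a z C fin).
Proof.
move=> Cs Cpos nki nk0 nk aloop asg zinf fk0 fk zk0 zk zinj mom.
have a0 i : nonloop P i -> a i != 0.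
  by move=> /asg E; rewrite -sgr_eq0 E /sign_val; case: ifP; rewrite ?oppr_eq0 oner_eq0.
have fki : ~~ fin ki by rewrite /fin eqxx.
have rk : \rank (config_mx a z C fin) = d.+2.
  by apply: (config_rank Cs zinf fki fk0 zk0 zk) => // *; apply: a0.
have SL : lorentzian (config_mx a z C fin).
  by apply: (config_lorentzian Cs zinf fki fk0) => //; apply: a0.
have Ss : (config_mx a z C fin)^T = config_mx a z C fin by exact: config_sym.
have dg i : config_mx a z C fin i i = 0 by rewrite mxE gram_diag // mulr0.
split; last by move=> i; apply: config_row_sum.
split.
- split=> //; have [e [ce e1 e2]] := signature_lorentzian Ss SL.
  by split=> // [i|]; [rewrite dg|exists e; split=> //; rewrite e2].
- move=> i j; rewrite matroid_basisE => /and3P[ni nj ij]; rewrite mxE !sgrM !asg //.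
  rewrite [Num.sg (gram _ _ _ _ _)](_ : _ = 1) ?mulr1 //; apply/gtr0_sg.
  have [fi|fi] := boolP (fin i); last first.
    rewrite gram_inf // [fin j](_ : _ = true) // /fin.
    by move: fi ij; rewrite negbK => /eqP->; rewrite eq_sym.
  have [fj|fj] := boolP (fin j); last by rewrite gramC // gram_inf // fi.
  by rewrite gram_fin //; apply: Cpos; rewrite subr_eq0 -zinj.
move=> i j ij; rewrite matroid_basisE mxE => nb.
have [ni|/aloop->] := boolP (nonloop P i); last by rewrite !mul0r.
have [nj|/aloop->] := boolP (nonloop P j); last by rewrite mulr0 mul0r.
move: nb; rewrite ni nj /= negbK => /eqP Bij.
have fij : fin i = fin j by rewrite /fin Bij.
have [fi|fi] := boolP (fin i); last by rewrite gram_inf // -fij (negPf fi) mulr0.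
rewrite gram_fin // -?fij //; have /eqP-> : z i == z j by rewrite -zinj -?fij // Bij.
by rewrite subrr bform0l mulr0.
Qed.

(** * Charts of the strata *)

Section Chart.
Variables (R : realType) (n d : nat) (P : matroid n).
Variables (ki k0 : 'I_n) (k : {ffun 'I_d -> 'I_n}) (i0 : 'I_n).
Local Notation B := (block P).

Definition basis_elt i := [|| i == ki, i == k0 | [exists l, i == k l]].

Definition basis_block (A : {set 'I_n}) :=
  [|| A == B ki, A == B k0 | [exists l, A == B (k l)]].

Definition fin i := B i != B ki.

(* A Lorentz transformation and a rescaling of the parts normalize a           *)
(* configuration: the part of ki is at infinity, the part of k0 at the origin, *)
(* the part of k l at the l-th unit vector, and a i0 = 1.  What remains free   *)
(* are the form C, the positions of the other parts, and the weights a i of    *)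
(* the elements other than i0 and the basis elements ki, k0, k l, whose        *)
(* weights are solved for from the conservation of momentum.                   *)
Record valid_chart : Prop := ValidChart {
  vc_ki : nonloop P ki; vc_k0 : nonloop P k0; vc_k : forall l, nonloop P (k l);
  vc_fk0 : fin k0; vc_fk : forall l, fin (k l);
  vc_kk0 : forall l, B (k l) != B k0; vc_inj : injective (fun l => B (k l));
  vc_i0 : nonloop P i0; vc_fi0 : fin i0; vc_bi0 : ~~ basis_elt i0 }.

(** Contains spurious indices so as not to depend on the matroid; [free_param] selects the actual
    coordinates, and parameters are taken to vanish elsewhere. *)
Definition param : finType := ('I_d * 'I_d + {set 'I_n} * 'I_d + 'I_n)%type.

Definition free_param : {pred param} := fun t =>
  match t with
  | inl (inl pq) => (pq.1 <= pq.2)%N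
  | inl (inr Al) => (Al.1 \in parts P) && ~~ basis_block Al.1
  | inr i => [&& nonloop P i, ~~ basis_elt i & i != i0]
  end.

Section Decode.
Variable Y : param -> R.

(* The configuration with free parameters Y; dec_af are the free weights, and  *)
(* dec_ak, dec_a0, dec_ai the weights of k l, k0, ki.                          *)
Definition dec_c (p q : 'I_d) : R := Y (inl (inl (if (p <= q)%N then (p, q) else (q, p)))).

Definition dec_z A l : R :=
  if basis_block A then (A == B (k l))%:R else Y (inl (inr (A, l))).

Definition dec_w i : R :=
  if fin i then \sum_p \sum_q dec_z (B i) p * dec_c p q * dec_z (B i) q else 1.

Definition dec_af i := if i == i0 then 1 else Y (inr i).

Definition dec_ak l : R := - \sum_i dec_af i * dec_z (B i) l.

Definition dec_a0 := - \sum_i dec_af i * (fin i)%:R - \sum_l dec_ak l.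

Definition dec_ai := - \sum_i dec_af i * dec_w i - \sum_l dec_ak l * dec_c l l.

(** Keeping [dec_af] at the basis elements makes momentum conservation an identity in [Y]; it
    contributes 0 there once [Y] vanishes off [free_param]. *)
Definition dec_a i := dec_af i + (i == ki)%:R * dec_ai + (i == k0)%:R * dec_a0 +
  \sum_l (i == k l)%:R * dec_ak l.

Definition dec_zz i : 'rV[R]_d := \row_l dec_z (B i) l.

Definition dec_C : 'M[R]_d := \matrix_(p, q) dec_c p q.

Definition dec_mx := config_mx dec_a dec_zz dec_C fin.

Lemma dec_C_sym : dec_C^T = dec_C.
Proof.
by apply/matrixP => p q; rewrite !mxE /dec_c; case: ltngtP => // /val_inj->.
Qed.

Lemma dec_wt i : wt dec_zz dec_C fin i = dec_w i.
Proof.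
rewrite /wt /dec_w; case: ifP => // _; rewrite bformE.
by apply: eq_bigr => p _; apply: eq_bigr => q _; rewrite !mxE.
Qed.

Lemma sum_dec_a (g : 'I_n -> R) : \sum_i dec_a i * g i =
  \sum_i dec_af i * g i + dec_ai * g ki + dec_a0 * g k0 + \sum_l dec_ak l * g (k l).
Proof.
have pick1 j (x : R) : \sum_i (i == j)%:R * x * g i = x * g j.
  rewrite (bigD1 j) //= eqxx mul1r big1 ?addr0 // => i /negPf->.
  by rewrite !mul0r.
rewrite /dec_a; under eq_bigr do rewrite !mulrDl.
rewrite !big_split /= !pick1; congr (_ + _).
under eq_bigr do rewrite mulr_suml.
by rewrite exchange_big; apply: eq_bigr => l _; rewrite pick1.
Qed.

Hypothesis V : valid_chart.

Let bbi : basis_block (B ki). Proof. by rewrite /basis_block eqxx. Qed.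
Let bb0 : basis_block (B k0). Proof. by rewrite /basis_block eqxx orbT. Qed.
Let bbk l : basis_block (B (k l)).
Proof. by rewrite /basis_block; apply/or3P/Or33/existsP; exists l. Qed.

Lemma dec_z_ki l : dec_z (B ki) l = 0.
Proof. by rewrite /dec_z bbi eq_sym (negPf (vc_fk V l)). Qed.

Lemma dec_z_k0 l : dec_z (B k0) l = 0.
Proof. by rewrite /dec_z bb0 eq_sym (negPf (vc_kk0 V l)). Qed.

Lemma dec_z_k l' l : dec_z (B (k l')) l = (l' == l)%:R.
Proof. by rewrite /dec_z bbk (inj_eq (vc_inj V)). Qed.

Lemma dec_zz_inf i : ~~ fin i -> dec_zz i = 0.
Proof.
by rewrite negbK => /eqP E; apply/rowP => l; rewrite !mxE E dec_z_ki.
Qed.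

Lemma dec_zz_k0 : dec_zz k0 = 0.
Proof. by apply/rowP => l; rewrite !mxE dec_z_k0. Qed.

Lemma dec_zz_k l : dec_zz (k l) = delta_mx 0 l.
Proof. by apply/rowP => l'; rewrite !mxE dec_z_k eq_sym. Qed.

Lemma dec_w_k l : dec_w (k l) = dec_c l l.
Proof.
by rewrite -dec_wt /wt (vc_fk V) dec_zz_k bform_delta mxE.
Qed.

Lemma dec_w_k0 : dec_w k0 = 0.
Proof. by rewrite -dec_wt /wt (vc_fk0 V) dec_zz_k0 bform0l. Qed.

Lemma dec_w_ki : dec_w ki = 1.
Proof. by rewrite /dec_w /fin eqxx. Qed.

Lemma dec_momentum : momentum dec_a dec_zz dec_C fin.
Proof.
split.
- have fki : fin ki = false by rewrite /fin eqxx.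
  rewrite sum_dec_a (vc_fk0 V) fki mulr0 mulr1 addr0.
  under [X in _ + X]eq_bigr do rewrite (vc_fk V) mulr1.
  by rewrite /dec_a0; ring.
- apply/rowP => l; rewrite summxE [RHS]mxE.
  under eq_bigr do rewrite !mxE.
  rewrite (sum_dec_a (fun i => dec_z (B i) l)) dec_z_ki dec_z_k0 !mulr0 !addr0.
  rewrite (bigD1 l) //= dec_z_k eqxx mulr1 [X in _ + (_ + X)]big1 ?addr0.
    by rewrite /dec_ak addrN.
  by move=> l' /negPf ll; rewrite dec_z_k ll mulr0.
- under eq_bigr do rewrite dec_wt.
  rewrite sum_dec_a dec_w_ki dec_w_k0 mulr1 mulr0 addr0.
  under [X in _ + X]eq_bigr do rewrite dec_w_k.
  by rewrite /dec_ai; ring.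
Qed.

Hypothesis Y0 : forall t, t \notin free_param -> Y t = 0.

Lemma dec_af_loop i : ~~ nonloop P i -> dec_af i = 0.
Proof.
move=> il; rewrite /dec_af; case: eqP => [ii|_]; last by rewrite Y0 // unfold_in (negPf il).
by rewrite ii (vc_i0 V) in il.
Qed.

Lemma basis_elt_nonloop i : basis_elt i -> nonloop P i.
Proof.
by case/or3P => [/eqP->|/eqP->|/existsP[l /eqP->]];
  [apply: vc_ki|apply: vc_k0|apply: vc_k].
Qed.

Lemma dec_a_free i : ~~ basis_elt i -> dec_a i = dec_af i.
Proof.
rewrite /dec_a !negb_or => /and3P[/negPf-> /negPf-> /existsPn ik].
by rewrite !mul0r !addr0 big1 ?addr0 // => l _; rewrite (negPf (ik l)) mul0r.
Qed.

Lemma dec_a_loop i : ~~ nonloop P i -> dec_a i = 0.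
Proof.
move=> il; rewrite dec_a_free ?dec_af_loop //.
by apply: contra il; apply: basis_elt_nonloop.
Qed.

Lemma dec_a_i0 : dec_a i0 = 1.
Proof. by rewrite dec_a_free ?(vc_bi0 V) // /dec_af eqxx. Qed.

End Decode.

(* On the basis elements the weights a are determined by the other data,       *)
(* because the vectors at the basis elements are linearly independent.         *)
Lemma momentum_basis_uniq (b : 'I_n -> R) (z : 'I_n -> 'rV[R]_d) C : valid_chart ->
  (forall i, ~~ basis_elt i -> b i = 0) ->
  (forall i, ~~ fin i -> z i = 0) -> z k0 = 0 -> (forall l, z (k l) = delta_mx 0 l) ->
  momentum b z C fin -> forall i, b i = 0.
Proof.
move=> V b0 zi zk0 zk [M1 M2 M3].
have bk l : b (k l) = 0.
  have /rowP/(_ l) := M2; rewrite summxE (bigD1 (k l)) //= !mxE zk mxE !eqxx mulr1.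
  rewrite big1 ?addr0 // => i ik; rewrite mxE.
  have [bi|/b0->] := boolP (basis_elt i); last by rewrite mul0r.
  case/or3P: bi => [/eqP->|/eqP->|/existsP[l' /eqP E]].
  - by rewrite zi ?mxE ?mulr0 // /fin eqxx.
  - by rewrite zk0 mxE mulr0.
  - move: ik; rewrite E zk mxE eqxx => ik.
    have [ll|] := eqVneq l l'; first by rewrite ll eqxx in ik.
    by rewrite mulr0.
have bk0 : b k0 = 0.
  move: M1; rewrite (bigD1 k0) //= (vc_fk0 V) mulr1 big1 ?addr0 // => i ik0.
  have [bi|/b0->] := boolP (basis_elt i); last by rewrite mul0r.
  case/or3P: bi => [/eqP->|/eqP E|/existsP[l' /eqP->]].
  - by rewrite /fin eqxx mulr0.
  - by rewrite E eqxx in ik0.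
  - by rewrite bk mul0r.
have bki : b ki = 0.
  move: M3; rewrite (bigD1 ki) //= /wt {1}/fin eqxx mulr1 big1 ?addr0 // => i iki.
  have [bi|/b0->] := boolP (basis_elt i); last by rewrite mul0r.
  case/or3P: bi => [/eqP E|/eqP->|/existsP[l' /eqP->]].
  - by rewrite E eqxx in iki.
  - by rewrite bk0 mul0r.
  - by rewrite bk mul0r.
move=> i; have [bi|/b0//] := boolP (basis_elt i).
by case/or3P: bi => [/eqP->|/eqP->|/existsP[l' /eqP->]].
Qed.

Local Notation D := #|free_param|.

Definition extend (y : 'rV[R]_D) (t : param) : R :=
  \sum_(j < D) (enum_val j == t)%:R * y 0 j.

Lemma extend_free y j : extend y (enum_val j) = y 0 j.
Proof.
rewrite /extend (bigD1 j) //= eqxx mul1r big1 ?addr0 // => j' jj.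
by rewrite (inj_eq enum_val_inj) (negPf jj) mul0r.
Qed.

Lemma extend_notfree y t : t \notin free_param -> extend y t = 0.
Proof.
move=> tf; rewrite /extend big1 // => j _; case: eqP => [E|_]; last by rewrite mul0r.
by rewrite -E enum_valP in tf.
Qed.

Lemma extend_onto (Y : param -> R) : (forall t, t \notin free_param -> Y t = 0) ->
  exists y, extend y = Y.
Proof.
move=> Y0; exists (\row_j Y (enum_val j)); apply/funext => t.
have [tf|tf] := boolP (t \in free_param); last by rewrite extend_notfree ?Y0.
by rewrite -(enum_rankK_in tf tf) extend_free mxE.
Qed.

(** [cp_set0] concerns the loops, whose block is the empty set. *)
Record chart_point (a : 'I_n -> R) (z : {set 'I_n} -> 'rV[R]_d) (C : 'M[R]_d) : Prop :=
  ChartPoint {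
  cp_sym : C^T = C; cp_loop : forall i, ~~ nonloop P i -> a i = 0; cp_i0 : a i0 = 1;
  cp_ki : z (B ki) = 0; cp_k0 : z (B k0) = 0;
  cp_k : forall l, z (B (k l)) = delta_mx 0 l; cp_set0 : z finset.set0 = 0;
  cp_mom : momentum a (fun i => z (B i)) C fin }.

(** The free parameters are read off the configuration. The decoded weights then agree with [a] off
    the basis elements, and the difference satisfies momentum conservation, so [momentum_basis_uniq]
    makes it vanish. *)
Lemma chart_onto (a : 'I_n -> R) (z : {set 'I_n} -> 'rV[R]_d) (C : 'M[R]_d) :
  valid_chart -> chart_point a z C ->
  exists y, [/\ dec_a (extend y) = a, dec_zz (extend y) = (fun i => z (B i)) &
                dec_C (extend y) = C].
Proof.
move=> V [Cs al ai0 zki zk0 zk zl mom].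
pose Y (t : param) : R := if t \in free_param then
  match t with inl (inl pq) => C pq.1 pq.2 | inl (inr Al) => z Al.1 0 Al.2 | inr i => a i end
  else 0.
have Y0 t : t \notin free_param -> Y t = 0 by rewrite /Y => /negPf->.
have [y yE] := extend_onto Y0; exists y; rewrite yE.
have CE : dec_C Y = C.
  apply/matrixP => p q; rewrite mxE /dec_c /Y; case: leqP => pq.
    by rewrite unfold_in /= pq.
  by rewrite unfold_in /= (ltnW pq) -[in RHS]Cs mxE.
have zE : dec_zz Y = fun i => z (B i).
  apply/funext => i; apply/rowP => l; rewrite mxE /dec_z.
  have [bb|bb] := boolP (basis_block (B i)).
    case/or3P: bb => [/eqP->|/eqP->|/existsP[l' /eqP->]].
    - by rewrite zki mxE eq_sym (negPf (vc_fk V l)).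
    - by rewrite zk0 mxE eq_sym (negPf (vc_kk0 V l)).
    - by rewrite zk mxE (inj_eq (vc_inj V)) eq_sym.
  rewrite /Y unfold_in /= bb andbT.
  have [ni|ni] := boolP (nonloop P i); first by rewrite block_part.
  by rewrite block_loop // matroid_set0 zl mxE.
have aE i : ~~ basis_elt i -> dec_a Y i = a i.
  move=> bi; rewrite dec_a_free // /dec_af; case: eqP => [->//|/eqP ii].
  rewrite /Y unfold_in /= bi ii !andbT; case: ifP => // /negbT/al->//.
split=> //; apply/funext => i.
pose b i := dec_a Y i - a i.
apply/eqP; rewrite -subr_eq0 -/(b i); apply/eqP.
apply: (momentum_basis_uniq (C := C) (z := dec_zz Y)) => //.
- by move=> j bj; rewrite /b aE ?subrr.
- by move=> j; apply: dec_zz_inf.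
- exact: dec_zz_k0.
- by move=> l; apply: dec_zz_k.
have [N1 N2 N3] := dec_momentum Y V; have [M1 M2 M3] := mom.
rewrite zE CE in N2 N3 *; split.
- by under eq_bigr do rewrite mulrBl; rewrite sumrB N1 M1 subrr.
- by under eq_bigr do rewrite scalerBl; rewrite sumrB N2 M2 subrr.
- by under eq_bigr do rewrite mulrBl; rewrite sumrB N3 M3 subrr.
Qed.

Section Polynomial.

Lemma extend_polyfun t : polyfun (fun y => extend y t).
Proof.
by apply: polyfun_sum => j _; apply: polyfunM; [apply: polyfunC|apply: polyfunX].
Qed.

Lemma dec_c_polyfun p q : polyfun (fun y => dec_c (extend y) p q).
Proof. exact: extend_polyfun. Qed.

Lemma dec_z_polyfun A l : polyfun (fun y => dec_z (extend y) A l).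
Proof.
by rewrite /dec_z; case: (basis_block A); [apply: polyfunC|apply: extend_polyfun].
Qed.

Lemma dec_w_polyfun i : polyfun (fun y => dec_w (extend y) i).
Proof.
rewrite /dec_w; case: (fin i); last exact: polyfunC.
apply: polyfun_sum => p _; apply: polyfun_sum => q _.
by apply: polyfunM; [apply: polyfunM|]; (apply: dec_z_polyfun || apply: dec_c_polyfun).
Qed.

Lemma dec_af_polyfun i : polyfun (fun y => dec_af (extend y) i).
Proof.
by rewrite /dec_af; case: (i == i0); [apply: polyfunC|apply: extend_polyfun].
Qed.

Lemma dec_ak_polyfun l : polyfun (fun y => dec_ak (extend y) l).
Proof.
apply: polyfunN; apply: polyfun_sum => i _; apply: polyfunM.
  exact: dec_af_polyfun.
exact: dec_z_polyfun.
Qed.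

Lemma dec_a_polyfun i : polyfun (fun y => dec_a (extend y) i).
Proof.
apply: polyfunD; last first.
  apply: polyfun_sum => l _; apply: polyfunM; [exact: polyfunC|exact: dec_ak_polyfun].
apply: polyfunD; first (apply: polyfunD; first exact: dec_af_polyfun).
  apply: polyfunM; first exact: polyfunC.
  apply: polyfunD; apply: polyfunN; apply: polyfun_sum => j _; apply: polyfunM.
  - exact: dec_af_polyfun.
  - exact: dec_w_polyfun.
  - exact: dec_ak_polyfun.
  - exact: dec_c_polyfun.
apply: polyfunM; first exact: polyfunC.
apply: polyfunD; apply: polyfunN; apply: polyfun_sum => j _; last exact: dec_ak_polyfun.
by apply: polyfunM; [exact: dec_af_polyfun|exact: polyfunC].
Qed.

Definition dec_b Y i j : R :=
  \sum_p \sum_q dec_z Y (B i) p * dec_c Y p q * dec_z Y (B j) q.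

Lemma dec_bE Y i j : bform (dec_C Y) (dec_zz Y i) (dec_zz Y j) = dec_b Y i j.
Proof.
by rewrite bformE; apply: eq_bigr => p _; apply: eq_bigr => q _; rewrite !mxE.
Qed.

Lemma dec_b_polyfun i j : polyfun (fun y => dec_b (extend y) i j).
Proof.
apply: polyfun_sum => p _; apply: polyfun_sum => q _.
by apply: polyfunM; [apply: polyfunM|]; (apply: dec_z_polyfun || apply: dec_c_polyfun).
Qed.

Definition dec_gram Y i j : R :=
  (fin i)%:R * dec_w Y j + dec_w Y i * (fin j)%:R - 2 * dec_b Y i j.

Lemma dec_gramE Y i j : gram (dec_zz Y) (dec_C Y) fin i j = dec_gram Y i j.
Proof. by rewrite /gram !dec_wt dec_bE. Qed.

Lemma dec_gram_polyfun i j : polyfun (fun y => dec_gram (extend y) i j).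
Proof.
apply: polyfunD; last apply: polyfunN.
  apply: polyfunD; apply: polyfunM; by [apply: polyfunC|apply: dec_w_polyfun].
by apply: polyfunM; [apply: polyfunC|apply: dec_b_polyfun].
Qed.

Lemma dec_mxE Y i j : dec_mx Y i j = dec_a Y i * dec_a Y j * dec_gram Y i j.
Proof. by rewrite mxE dec_gramE. Qed.

Lemma dec_mx_polyfun i j : polyfun (fun y => dec_mx (extend y) i j).
Proof.
apply: (eq_polyfun (f := fun y => dec_a (extend y) i * dec_a (extend y) j *
                                  dec_gram (extend y) i j)).
  by move=> y; rewrite dec_mxE.
by apply: polyfunM; [apply: polyfunM; apply: dec_a_polyfun|apply: dec_gram_polyfun].
Qed.

End Polynomial.

End Chart.

(** * Number of free parameters *)

Section Count.
Variables (n d : nat) (P : matroid n).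
Variables (ki k0 : 'I_n) (k : {ffun 'I_d -> 'I_n}) (i0 : 'I_n).
Hypothesis V : valid_chart P ki k0 k i0.
Local Notation B := (block P).

Let elt (t : option (option 'I_d)) : 'I_n :=
  if t is Some t' then if t' is Some l then k l else k0 else ki.

Let elt_block_inj : injective (fun t => B (elt t)).
Proof.
have [_ _ _ fk0 fk kk0 kinj _ _ _] := V; rewrite /fin in fk0 fk.
move=> [[l|]|] [[l'|]|] //= E.
- by rewrite (kinj _ _ E).
- by have := kk0 l; rewrite E eqxx.
- by have := fk l; rewrite E eqxx.
- by have := kk0 l'; rewrite E eqxx.
- by rewrite E eqxx in fk0.
- by have := fk l'; rewrite E eqxx.
- by rewrite E eqxx in fk0.
Qed.

Let elt_inj : injective elt.
Proof. by move=> t t' E; apply: elt_block_inj; rewrite E. Qed.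

Let card_oo : #|{: option (option 'I_d)}| = d.+2.
Proof. by rewrite !card_option card_ord. Qed.

Lemma card_basis_elt : #|[set i | basis_elt ki k0 k i]%SET| = d.+2.
Proof.
rewrite -card_oo -(card_imset _ elt_inj); apply: eq_card => i; rewrite inE.
apply/or3P/imsetP => [[/eqP->|/eqP->|/existsP[l /eqP->]]|[[[l|]|] _ ->] /=].
- by exists None.
- by exists (Some None).
- by exists (Some (Some l)).
- by apply/Or33/existsP; exists l.
- by apply/Or32.
- by apply/Or31.
Qed.

Lemma card_basis_block : #|[set A | basis_block P ki k0 k A]%SET| = d.+2.
Proof.
rewrite -card_oo -(card_imset _ elt_block_inj); apply: eq_card => A; rewrite inE.
apply/or3P/imsetP => [[/eqP->|/eqP->|/existsP[l /eqP->]]|[[[l|]|] _ ->] /=].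
- by exists None.
- by exists (Some None).
- by exists (Some (Some l)).
- by apply/Or33/existsP; exists l.
- by apply/Or32.
- by apply/Or31.
Qed.

Lemma basis_block_part A : basis_block P ki k0 k A -> A \in parts P.
Proof.
by case/or3P => [/eqP->|/eqP->|/existsP[l /eqP->]]; apply: block_part;
  [apply: (vc_ki V)|apply: (vc_k0 V)|apply: (vc_k V)].
Qed.

Lemma chart_rank_le : (d.+2 <= #|parts P|)%N.
Proof.
rewrite -card_basis_block; apply/subset_leq_card/fintype.subsetP => A; rewrite inE.
exact: basis_block_part.
Qed.

Lemma chart_card_cover : (d.+3 <= #|finset.cover P|)%N.
Proof.
rewrite -card_basis_elt -[X in (X <= _)%N]add1n.
have -> : (1 + #|[set i | basis_elt ki k0 k i]| = #|i0 |: [set i | basis_elt ki k0 k i]|)%N%SET.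
  by rewrite cardsU1 inE (vc_bi0 V).
apply/subset_leq_card/fintype.subsetP => i; rewrite !inE => /orP[/eqP->|].
  exact: (vc_i0 V).
exact: (basis_elt_nonloop V).
Qed.

(** The summands count the symmetric form, [d] coordinates for each part outside the basis, and the
    weights of the nonloops other than the [d.+2] basis elements and [i0]. *)
Lemma card_free_param : #|free_param P ki k0 k i0| =
  ('C(d.+1, 2) + (#|parts P| - d.+2) * d + (#|finset.cover P| - d.+3))%N.
Proof.
rewrite -sum1_card big_sumType big_sumType /=; congr (_ + _ + _)%N.
- rewrite -(pair_big_dep xpredT (fun p q : 'I_d => p <= q)%N (fun _ _ => 1%N)) /=.
  rewrite (exchange_big_dep xpredT) //= -bin2_sum big_nat_recl // add0n big_mkord.
  apply: eq_bigr => q _; rewrite sum1_card.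
  rewrite -[RHS](card_ord q.+1) -sum1_card -[RHS]sum1_card.
  by rewrite (big_ord_widen d (fun=> 1%N)) //.
- pose N := [set A | (A \in parts P) && ~~ basis_block P ki k0 k A]%SET.
  rewrite sum1_card (eq_card (B := finset.setX N (finset.setT : {set 'I_d}))); last first.
    by move=> [A l]; rewrite finset.in_setX !inE andbT unfold_in.
  rewrite cardsX cardsT card_ord; congr (_ * _)%N.
  rewrite -card_basis_block -cardsDS; last first.
    by apply/fintype.subsetP => A; rewrite inE; apply: basis_block_part.
  by apply: eq_card => A; rewrite !inE andbC.
rewrite sum1_card -card_basis_elt -[X in (_ - X)%N]add1n.
have -> : (1 + #|[set i | basis_elt ki k0 k i]| = #|i0 |: [set i | basis_elt ki k0 k i]|)%N%SET.
  by rewrite cardsU1 inE (vc_bi0 V).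
rewrite -cardsDS; last first.
  apply/fintype.subsetP => i; rewrite !inE => /orP[/eqP->|].
    exact: (vc_i0 V).
  exact: (basis_elt_nonloop V).
apply: eq_card => i; rewrite !inE negb_or [RHS]andbC; congr (_ && _).
by rewrite andbC.
Qed.

End Count.

(** * The differential of a chart *)

(** The directional derivative along [h], locked so that unification does not unfold gradients. *)
HB.lock Definition dirder (R : realType) D (y0 h : 'rV[R]_D) (f : 'rV[R]_D -> R) : R :=
  (grad f y0 *m h^T) 0 0.

Lemma sumr_delta (R : pzSemiRingType) (I : finType) (F : I -> R) l :
  \sum_q F q * (l == q)%:R = F l.
Proof.
rewrite (bigD1 l) //= eqxx mulr1 big1 ?addr0 // => q /negPf ql.
by rewrite eq_sym ql mulr0.
Qed.

Section Dirder.
Variables (R : realType) (D : nat) (y0 h : 'rV[R]_D).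
Implicit Types f g : 'rV[R]_D -> R.
Local Notation dd := (dirder y0 h).

Lemma dirderC c : dd (fun=> c) = 0.
Proof. by rewrite unlock gradC mul0mx mxE. Qed.

Lemma dirderX i : dd (fun y => y 0 i) = h 0 i.
Proof. by rewrite unlock gradX -rowE !mxE. Qed.

Lemma dirderD f g : polyfun f -> polyfun g -> dd (fun y => f y + g y) = dd f + dd g.
Proof. by move=> pf pg; rewrite unlock gradD // mulmxDl mxE. Qed.

Lemma dirderM f g : polyfun f -> polyfun g ->
  dd (fun y => f y * g y) = f y0 * dd g + g y0 * dd f.
Proof. by move=> pf pg; rewrite unlock gradM // mulmxDl -!scalemxAl !mxE. Qed.

Lemma dirderZ c f : polyfun f -> dd (fun y => c * f y) = c * dd f.
Proof. by move=> pf; rewrite dirderM ?dirderC ?mulr0 ?addr0 //; apply: polyfunC. Qed.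

Lemma dirder_sum (I : Type) (r : seq I) (F : I -> 'rV[R]_D -> R) :
  (forall i, polyfun (F i)) ->
  dd (fun y => \sum_(i <- r) F i y) = \sum_(i <- r) dd (F i).
Proof. by move=> pF; rewrite unlock grad_sum // mulmx_suml summxE. Qed.

End Dirder.

Section ChartGradient.
Variables (R : realType) (n d : nat) (P : matroid n).
Variables (ki k0 : 'I_n) (k : {ffun 'I_d -> 'I_n}) (i0 : 'I_n).
Hypothesis V : valid_chart P ki k0 k i0.
Local Notation B := (block P).
Local Notation D := #|free_param P ki k0 k i0|.
Local Notation fin := (fin P ki).
Variables (y0 h : 'rV[R]_D).
Local Notation dd := (dirder y0 h).
Local Notation Y := extend.
Local Notation va i y := (dec_a P ki k0 k i0 (Y y) i).
Local Notation vz A l y := (dec_z P ki k0 k (Y y) A l).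
Local Notation vc p q y := (dec_c (Y y) p q).
Local Notation vw i y := (dec_w P ki k0 k (Y y) i).
Local Notation vb i j y := (dec_b P ki k0 k (Y y) i j).
Local Notation vg i j y := (dec_gram P ki k0 k (Y y) i j).
Local Notation da i := (fun y : 'rV[R]_D => va i y).
Local Notation dz A l := (fun y : 'rV[R]_D => vz A l y).
Local Notation dc p q := (fun y : 'rV[R]_D => vc p q y).
Local Notation dw i := (fun y : 'rV[R]_D => vw i y).
Local Notation db i j := (fun y : 'rV[R]_D => vb i j y).
Local Notation dg i j := (fun y : 'rV[R]_D => vg i j y).
Local Notation dS i j := (fun y : 'rV[R]_D => dec_mx P ki k0 k i0 (Y y) i j).

Hypothesis a0 : forall i, nonloop P i -> va i y0 != 0.
Hypothesis C1 : dec_C (Y y0) = 1%:M.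
Hypothesis hS : forall i j, dd (dS i j) = 0.

Let pa i := dec_a_polyfun R P ki k0 k i0 i.
Let pz A l := dec_z_polyfun R P ki k0 k i0 A l.
Let pc p q := dec_c_polyfun R P ki k0 k i0 p q.
Let pw i := dec_w_polyfun R P ki k0 k i0 i.
Let pb i j := dec_b_polyfun R P ki k0 k i0 i j.
Let pg i j := dec_gram_polyfun R P ki k0 k i0 i j.

Let vg_def i j (y : 'rV[R]_D) :
  vg i j y = (fin i)%:R * vw j y + vw i y * (fin j)%:R - 2 * vb i j y.
Proof. by []. Qed.

Let vb_def i j (y : 'rV[R]_D) : vb i j y = \sum_p \sum_q vz (B i) p y * vc p q y * vz (B j) q y.
Proof. by []. Qed.

Let vz_free A l (y : 'rV[R]_D) : ~~ basis_block P ki k0 k A ->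
  vz A l y = Y y (inl (inr (A, l))).
Proof. by rewrite /dec_z => /negPf->. Qed.

Let vc_free (p q : 'I_d) (y : 'rV[R]_D) : (p <= q)%N -> vc p q y = Y y (inl (inl (p, q))).
Proof. by rewrite /dec_c => ->. Qed.

Let va_free i (y : 'rV[R]_D) : ~~ basis_elt ki k0 k i -> i != i0 -> va i y = Y y (inr i).
Proof. by move=> bi /negPf ii; rewrite dec_a_free // /dec_af ii. Qed.

(* Keeps unification from unfolding the derivatives of these polynomials. *)
Local Opaque dec_a dec_z dec_c dec_w dec_b dec_gram dec_mx extend dirder.

Let gram_inf_l i j (y : 'rV[R]_D) : ~~ fin i -> vg i j y = (fin j)%:R.
Proof. by move=> fi; rewrite -dec_gramE gram_inf // => l; exact: (dec_zz_inf _ V). Qed.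

Let gram_inf_r i j (y : 'rV[R]_D) : ~~ fin j -> vg i j y = (fin i)%:R.
Proof.
move=> fj; rewrite -dec_gramE gramC ?dec_C_sym // gram_inf // => l.
exact: (dec_zz_inf _ V).
Qed.

(** Since [a i0 = 1], the entry at [i0] and an element [i] at infinity is the weight [a i]
    itself. *)
Let da_inf i : ~~ fin i -> dd (da i) = 0.
Proof.
move=> fi; rewrite -[RHS](hS i0 i); apply: (congr1 (dirder y0 h)); apply/funext => y.
by rewrite dec_mxE (dec_a_i0 _ V) gram_inf_r // (vc_fi0 V) mul1r mulr1.
Qed.

Let da_fin i : fin i -> dd (da i) = 0.
Proof.
move=> fi; have fki : ~~ fin ki by rewrite /fin eqxx.
have E : dS ki i = fun y => va ki y * va i y.
  by apply/funext => y; rewrite dec_mxE gram_inf_l // fi mulr1.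
have := hS ki i; rewrite E dirderM // (da_inf fki) mulr0 addr0 => /eqP.
by rewrite mulf_eq0 (negPf (a0 (vc_ki V))) => /eqP.
Qed.

Let da0 i : dd (da i) = 0.
Proof. by have [/da_fin|/da_inf] := boolP (fin i). Qed.

Let dg0 i j : nonloop P i -> nonloop P j -> dd (dg i j) = 0.
Proof.
move=> ni nj; have E : dS i j = fun y => va i y * va j y * vg i j y.
  by apply/funext => y; rewrite dec_mxE.
have := hS i j; rewrite E dirderM //; last exact: polyfunM.
rewrite [dd (fun y => va i y * va j y)]dirderM // !da0 !mulr0 addr0 mulr0 addr0.
by move/eqP; rewrite !mulf_eq0 (negPf (a0 ni)) (negPf (a0 nj)) => /eqP.
Qed.

(** The Gram entry of [i] with the origin [k0] is [w i], so the Gram entries determine [w] and, by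
    polarization, the bilinear values. *)
Let db0 i j : nonloop P i -> nonloop P j -> fin i -> fin j -> dd (db i j) = 0.
Proof.
have bk0 i' (y : 'rV[R]_D) : vb i' k0 y = 0.
  rewrite -dec_bE (dec_zz_k0 _ V) /bform trmx0 mulmx0 mxE //.
have dw0 i' : nonloop P i' -> fin i' -> dd (dw i') = 0.
  move=> ni fi; rewrite -[RHS](dg0 ni (vc_k0 V)); apply: (congr1 (dirder y0 h)); apply/funext => y.
  by rewrite vg_def bk0 (dec_w_k0 _ V) fi (vc_fk0 V) !mulr0 mulr1 add0r subr0.
move=> ni nj fi fj.
have E : dg i j = fun y => (vw j y + vw i y) + - 2 * vb i j y.
  by apply/funext => y; rewrite vg_def fi fj mul1r mulr1 mulNr.
have p1 : polyfun (fun y => vw j y + vw i y) := polyfunD (pw j) (pw i).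
have p2 : polyfun (fun y => - 2 * vb i j y) := polyfunM (polyfunC (-2)) (pb i j).
have D1 : dd (dg i j) = dd (fun y => vw j y + vw i y) + dd (fun y => - 2 * vb i j y).
  by rewrite E; exact: (dirderD _ _ p1 p2).
have D2 : dd (fun y => vw j y + vw i y) = dd (dw j) + dd (dw i).
  exact: (dirderD _ _ (pw j) (pw i)).
have D3 : dd (fun y => - 2 * vb i j y) = - 2 * dd (db i j).
  exact: (dirderZ _ _ _ (pb i j)).
have D0 : 0 = dd (dw j) + dd (dw i) + - 2 * dd (db i j).
  by rewrite -D2 -D3 -D1 dg0.
have := congr2 (fun a b => a + b + - 2 * dd (db i j)) (dw0 j nj fj) (dw0 i ni fi).
move=> /(etrans D0); rewrite !add0r => /esym/eqP.
by rewrite mulf_eq0 oppr_eq0 pnatr_eq0 => /eqP.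
Qed.

Let db_k i l (y : 'rV[R]_D) : vb i (k l) y = \sum_p vz (B i) p y * vc p l y.
Proof.
rewrite vb_def; apply: eq_bigr => p _.
transitivity (\sum_q vz (B i) p y * vc p q y * (l == q)%:R).
  by apply: eq_bigr => q _; congr (_ * _); apply: dec_z_k V l q.
exact: sumr_delta.
Qed.

Let dc0 p q : dd (dc p q) = 0.
Proof.
transitivity (dd (db (k p) (k q))); last exact: db0 (vc_k V p) (vc_k V q) (vc_fk V p) (vc_fk V q).
apply: (congr1 (dirder y0 h)); apply/funext => y.
transitivity (\sum_p' vc p' q y * (p == p')%:R); last first.
  rewrite db_k; apply: eq_bigr => p' _; rewrite mulrC; congr (_ * _).
  exact/esym/(dec_z_k _ V).
exact/esym/sumr_delta.
Qed.

(** The derivative of the product with the unit vector [k l] only sees the positions, since that of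
    [C] vanishes; at [C = 1] it is the derivative of coordinate [l]. *)
Let dz0 i l : nonloop P i -> fin i -> dd (dz (B i) l) = 0.
Proof.
move=> ni fi; have := db0 ni (vc_k V l) fi (vc_fk V l).
have -> : db i (k l) = fun y => \sum_p vz (B i) p y * vc p l y.
  by apply/funext => y; apply: db_k.
have pzc p : polyfun (fun y => vz (B i) p y * vc p l y) := polyfunM (pz (B i) p) (pc p l).
have -> := dirder_sum y0 h (index_enum 'I_d) pzc.
have cE p : vc p l y0 = (p == l)%:R by have /matrixP/(_ p l) := C1; rewrite !mxE.
have zcE p : dd (fun y => vz (B i) p y * vc p l y) = (p == l)%:R * dd (dz (B i) p).
  have -> : dd (fun y => vz (B i) p y * vc p l y) =
    vz (B i) p y0 * dd (dc p l) + vc p l y0 * dd (dz (B i) p).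
    exact: (dirderM _ _ (pz (B i) p) (pc p l)).
  by rewrite (_ : dd (dc p l) = 0) ?mulr0 ?add0r ?cE //; exact: dc0.
under eq_bigr do rewrite zcE.
under eq_bigr do rewrite mulrC eq_sym.
by rewrite sumr_delta.
Qed.

(** If no matrix entry varies along [h], then neither do the weights, the Gram entries, the form and
    the positions, each recovered from the preceding ones. These include all free parameters. *)
Lemma chart_gradient_inj : h = 0.
Proof.
apply/rowP => j; rewrite mxE -(dirderX y0 h j).
pose t := enum_val j; have tf : t \in free_param P ki k0 k i0 by apply: enum_valP.
have -> : (fun y : 'rV[R]_D => y 0 j) = fun y => Y y t.
  by apply/funext => y; rewrite extend_free.
move: tf; rewrite unfold_in; case: t => [[[p q]|[A l]]|i] /=.
- move=> pq; transitivity (dd (dc p q)); last exact: dc0.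
  by apply: (congr1 (dirder y0 h)); apply/funext => y; rewrite vc_free.
- move=> /andP[AP nb]; have [i [_ ni Bi]] := part_elt AP.
  have fi : fin i.
    by move: nb; rewrite /fin Bi; apply: contraNneq => ->; rewrite /basis_block eqxx.
  transitivity (dd (dz (B i) l)); last exact: dz0.
  by apply: (congr1 (dirder y0 h)); apply/funext => y; rewrite Bi vz_free.
- move=> /and3P[ni bi ii]; transitivity (dd (da i)); last exact: da0.
  by apply: (congr1 (dirder y0 h)); apply/funext => y; rewrite va_free.
Qed.

End ChartGradient.

Local Transparent dec_a dec_z dec_c dec_w dec_b dec_gram dec_mx extend.

(** * Charts fill an open set of coordinates *)

Local Open Scope classical_set_scope.

(** The deviation from the identity contributes at most d/(d+1) times the squared length of [v]. *)
Lemma posdef_near1 (R : realType) d (C : 'M[R]_d) :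
  (forall p q, `|C p q - (p == q)%:R| < d.+1%:R^-1) -> posdef C.
Proof.
move=> C1 v v0.
have d0 : 0 < d.+1%:R^-1 :> R by rewrite invr_gt0.
pose N := \sum_p v 0 p ^+ 2.
have N0 : 0 < N.
  rewrite lt_def sumr_ge0 ?andbT => [|p _]; last exact: sqr_ge0.
  apply: contraNneq v0 => /eqP; rewrite psumr_eq0 => [/allP v0|p _]; last exact: sqr_ge0.
  apply/eqP/rowP => p; have := v0 p (mem_index_enum p).
  by rewrite mxE sqrf_eq0 => /eqP.
have E : bform C v v = N + \sum_p \sum_q v 0 p * (C p q - (p == q)%:R) * v 0 q.
  have -> : N = \sum_p \sum_q v 0 p * v 0 q * (p == q)%:R.
    by apply: eq_bigr => p _; rewrite sumr_delta expr2.
  rewrite bformE -big_split; apply: eq_bigr => p _; rewrite -big_split.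
  by apply: eq_bigr => q _ /=; ring.
have b p q : - (d.+1%:R^-1 / 2 * (v 0 p ^+ 2 + v 0 q ^+ 2)) <=
    v 0 p * (C p q - (p == q)%:R) * v 0 q.
  rewrite lerNl; apply: le_trans (ler_norm _) _; rewrite normrN !normrM.
  apply: le_trans (_ : d.+1%:R^-1 * (`|v 0 p| * `|v 0 q|) <= _).
    rewrite mulrAC mulrC; apply: ler_wpM2r; first by rewrite mulr_ge0.
    exact/ltW/C1.
  rewrite -mulrA; apply: ler_wpM2l; first exact: ltW.
  rewrite -[v 0 p ^+ 2]real_normK ?num_real // -[v 0 q ^+ 2]real_normK ?num_real //.
  by have := sqr_ge0 (`|v 0 p| - `|v 0 q|); rewrite sqrrB; lra.
rewrite E; apply: lt_le_trans (_ : N - d%:R / d.+1%:R * N <= _).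
  rewrite subr_gt0 gtr_pMl // ltr_pdivrMr // mul1r ltr_nat //.
rewrite lerD2l; apply: le_trans (_ : \sum_p \sum_q
    - (d.+1%:R^-1 / 2 * (v 0 p ^+ 2 + v 0 q ^+ 2)) <= _); last first.
  by apply: ler_sum => p _; apply: ler_sum => q _; apply: b.
have S2 : \sum_p \sum_q (v 0 p ^+ 2 + v 0 q ^+ 2) = d%:R * N + d%:R * N.
  under eq_bigr do rewrite big_split /= sumr_const card_ord -/N -[_ *+ d]mulr_natl.
  by rewrite big_split /= -mulr_sumr sumr_const card_ord -[N *+ d]mulr_natl.
under eq_bigr do rewrite sumrN -mulr_sumr.
rewrite sumrN -mulr_sumr S2; move: (d.+1%:R^-1) (d%:R) => x y.
by rewrite [X in _ <= X](_ : _ = - (y * x * N)) //; field.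
Qed.

Lemma near_all (T : topologicalType) (I : finType) (Q : I -> T -> Prop) (x : T) :
  (forall i, \forall y \near x, Q i y) -> \forall y \near x, forall i, Q i y.
Proof. exact: filter_forall. Qed.

Section LowerBound.
Variables (R : realType) (n d : nat) (P : matroid n) (s : signs n).
Variables (ki k0 : 'I_n) (k : {ffun 'I_d -> 'I_n}) (i0 : 'I_n).
Hypothesis V : valid_chart P ki k0 k i0.
Local Notation B := (block P).
Local Notation D := #|free_param P ki k0 k i0|.
Local Notation fin := (fin P ki).
Local Notation da y i := (dec_a P ki k0 k i0 (extend y) i).
Local Notation dz y A l := (dec_z P ki k0 k (extend y) A l).

Lemma dec_mmc (y : 'rV[R]_D) :
  (forall i, nonloop P i -> Num.sg (da y i) = sign_val R (s i)) ->
  (forall i j, nonloop P i -> nonloop P j -> fin i -> fin j -> B i != B j ->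
     exists l, dz y (B i) l != dz y (B j) l) ->
  posdef (dec_C (extend y)) ->
  mmc_stratum P s d.+2 (dec_mx P ki k0 k i0 (extend y)).
Proof.
move=> asg zinj Cpos; apply: (@config_mmc _ _ _ _ _ _ _ _ ki k0 k) => //.
- exact: dec_C_sym.
- exact: vc_ki V.
- exact: vc_k0 V.
- exact: vc_k V.
- by move=> i; apply: (dec_a_loop V) => t; apply: extend_notfree.
- by move=> i; apply: (dec_zz_inf _ V).
- exact: vc_fk0 V.
- exact: vc_fk V.
- exact: (dec_zz_k0 _ V).
- exact: (dec_zz_k _ V).
- move=> i j ni nj fi fj; apply/eqP/eqP => [E|/rowP E].
    by rewrite /dec_zz E.
  apply/eqP; apply: contraT => /(zinj _ _ ni nj fi fj)[l].
  move: (E l); rewrite [X in X = _ -> _]mxE [X in _ = X -> _]mxE => ->.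
  by rewrite eqxx.
- exact: (dec_momentum _ V).
Qed.

Variable y0 : 'rV[R]_D.
Hypothesis asg : forall i, nonloop P i -> Num.sg (da y0 i) = sign_val R (s i).
Hypothesis zinj : forall i j, nonloop P i -> nonloop P j -> fin i -> fin j ->
  B i != B j -> exists l, dz y0 (B i) l != dz y0 (B j) l.
Hypothesis C1 : dec_C (extend y0) = 1%:M.

Let a0 i : nonloop P i -> da y0 i != 0.
Proof.
by move=> /asg E; rewrite -sgr_eq0 E /sign_val; case: ifP; rewrite ?oppr_eq0 oner_eq0.
Qed.

(** The signs of the weights, the distinctness of positions and the definiteness of [C] persist near
    [y0]; momentum conservation holds throughout the chart. *)
Lemma dec_mmc_near : \forall y \near y0,
  mmc_stratum P s d.+2 (dec_mx P ki k0 k i0 (extend y)).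
Proof.
have Ha : \forall y \near y0, forall i, 0 < da y0 i -> 0 < da (y : 'rV[R]_D) i.
  apply: near_all => i; have [a0i|_] := boolP (0 < da y0 i); last exact: filterE.
  have oa : open [set y : 'rV[R]_D | 0 < da y i].
    apply: (@open_comp _ _ (fun y : 'rV[R]_D => da y i) _ _ (@open_gt R 0)) => y _.
    by apply: (polyfun_cont (dec_a_polyfun R P ki k0 k i0 i)).
  by apply: filterS (open_nbhs_nbhs (conj oa a0i)).
have Hb : \forall y \near y0, forall i, da y0 i < 0 -> da (y : 'rV[R]_D) i < 0.
  apply: near_all => i; have [a0i|_] := boolP (da y0 i < 0); last exact: filterE.
  have oa : open [set y : 'rV[R]_D | da y i < 0].
    apply: (@open_comp _ _ (fun y : 'rV[R]_D => da y i) _ _ (@open_lt _ (0 : R))) => y _.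
    by apply: (polyfun_cont (dec_a_polyfun R P ki k0 k i0 i)).
  by apply: filterS (open_nbhs_nbhs (conj oa a0i)).
have Hz : \forall y \near y0, forall t : 'I_n * 'I_n * 'I_d,
    dz y0 (B t.1.1) t.2 - dz y0 (B t.1.2) t.2 != 0 ->
    dz (y : 'rV[R]_D) (B t.1.1) t.2 - dz y (B t.1.2) t.2 != 0.
  apply: near_all => -[[i j] l] /=.
  have [z0|_] := boolP (dz y0 (B i) l - dz y0 (B j) l != 0); last exact: filterE.
  have oz : open [set y : 'rV[R]_D | dz y (B i) l - dz y (B j) l != 0].
    apply: (@open_comp _ _ (fun y : 'rV[R]_D => dz y (B i) l - dz y (B j) l) _ _
      (@open_neq _ (0 : R))) => y _.
    exact: (polyfun_cont (polyfunD (dec_z_polyfun R P ki k0 k i0 (B i) l)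
      (polyfunN (dec_z_polyfun R P ki k0 k i0 (B j) l)))).
  by apply: filterS (open_nbhs_nbhs (conj oz z0)).
have HC : \forall y \near y0, forall t : 'I_d * 'I_d,
    `|dec_c (extend y) t.1 t.2 - (t.1 == t.2)%:R| < d.+1%:R^-1.
  apply: near_all => -[p q] /=.
  have d0 : 0 < d.+1%:R^-1 :> R by rewrite invr_gt0.
  have := polyfun_cont (dec_c_polyfun R P ki k0 k i0 p q).
  move=> /(_ y0)/cvgrPdist_lt/(_ _ d0); apply: filterS => y.
  have /matrixP/(_ p q) := C1; rewrite !mxE => ->.
  by rewrite distrC.
near=> y; apply: dec_mmc.
- move=> i ni; have := asg ni; rewrite /sign_val; case: (s i).
    move=> /eqP; rewrite sgr_cp0 => ai; apply/gtr0_sg; move: i ai {ni}; near: y; exact: Ha.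
  move=> /eqP; rewrite sgr_cp0 => ai; apply/ltr0_sg; move: i ai {ni}; near: y; exact: Hb.
- move=> i j ni nj fi fj ij; have [l zl] := zinj ni nj fi fj ij; exists l.
  rewrite -subr_eq0; move: zl; rewrite -subr_eq0.
  suff : forall t : 'I_n * 'I_n * 'I_d,
    dz y0 (B t.1.1) t.2 - dz y0 (B t.1.2) t.2 != 0 ->
    dz y (B t.1.1) t.2 - dz y (B t.1.2) t.2 != 0 by move=> H; exact: (H (i, j, l)).
  by near: y; exact: Hz.
- apply: posdef_near1 => p q; rewrite mxE.
  suff : forall t : 'I_d * 'I_d,
    `|dec_c (extend y) t.1 t.2 - (t.1 == t.2)%:R| < d.+1%:R^-1 by move=> H; exact: (H (p, q)).
  by near: y; exact: HC.
Unshelve. all: by end_near. Qed.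

Local Notation E := #|{: 'I_n * 'I_n}|.
Let entry (t : 'I_E) (y : 'rV[R]_D) : R :=
  dec_mx P ki k0 k i0 (extend y) (enum_val t).1 (enum_val t).2.

(** Injectivity of the differential says that the matrix of gradients has full column rank.
    [fullrankfun] selects [D] entries with an invertible Jacobian, to which [local_surjectivity]
    applies. *)
Lemma mmc_interior : exists2 f : 'I_D -> 'I_n * 'I_n, injective f &
  interior (coord_proj f @` mmc_stratum (R := R) P s d.+2) !=set0.
Proof.
have pe t : polyfun (entry t) by apply: dec_mx_polyfun.
pose G : 'M[R]_(E, D) := \matrix_t grad (entry t) y0.
have Gfull : row_full G.
  rewrite /row_full -mxrank_tr -/(row_free G^T) -kermx_eq0; apply/rowV0P => h /sub_kermxP hG.
  apply: (chart_gradient_inj V a0 C1) => i j.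
  pose t : 'I_E := enum_rank (i, j).
  have -> : (fun y : 'rV[R]_D => dec_mx P ki k0 k i0 (extend y) i j) = entry t.
    by rewrite /entry /t enum_rankK.
  rewrite unlock -[grad _ _](rowK (fun t => grad (entry t) y0)) -/G.
  have /(congr1 trmx) := hG; rewrite trmx_mul trmxK trmx0 => Gh.
  by rewrite -row_mul Gh row0 mxE.
pose g := fullrankfun Gfull.
exists (fun j => enum_val (g j)).
  by move=> j j' /enum_val_inj/fullrankfun_inj.
have [H HP] := choice (fun t => polyfun_hadamard (pe t)).
pose F (y : 'rV[R]_D) : 'rV[R]_D := \row_j entry (g j) y.
pose HM (p : 'rV[R]_D * 'rV[R]_D) : 'M[R]_D := \matrix_(i, j) H (g j) i p.
have cHM : continuous HM.
  move=> p; apply/cvgrPdist_lt => e e0.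
  have : \forall q \near p, forall t : 'I_D * 'I_D,
      `|H (g t.2) t.1 p - H (g t.2) t.1 q| < e.
    apply: near_all => -[i j] /=; have [cH _] := HP (g j).
    by have /cvgrPdist_lt := cH i p; apply.
  apply: filterS => q Hq; rewrite [ltLHS]mx_normrE; apply/bigmax_ltP; split=> // t _.
  by rewrite !mxE; apply: Hq.
have FH y y' : F y - F y' = (y - y') *m HM (y, y').
  apply/rowP => j; have [_ hE] := HP (g j); rewrite !mxE hE.
  by apply: eq_bigr => i _; rewrite !mxE.
have HMu : HM (y0, y0) \in unitmx.
  rewrite -unitmx_tr; suff -> : (HM (y0, y0))^T = rowsub g G by apply: fullrowsub_unit.
  apply/matrixP => j i; rewrite [LHS]mxE [LHS]mxE [RHS]mxE [RHS]mxE.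
  by rewrite (gradE _ (HP (g j))) mxE.
have := local_surjectivity cHM FH HMu dec_mmc_near.
move=> nF; exists (F y0); rewrite /interior /=; apply: filterS nF.
by move=> _ [y My <-]; exists (dec_mx P ki k0 k i0 (extend y)) => //.
Qed.

End LowerBound.

Local Close Scope classical_set_scope.

(** * Charts cover the strata *)

Section Stratum.
Variables (R : realType) (n : nat) (P : matroid n) (s : signs n) (r : nat).
Variable S : 'M[R]_n.
Hypothesis SM : mmc_stratum P s r S.
Local Notation B := (block P).

Lemma stratum_sym i j : S i j = S j i.
Proof. by have [[[[Ss _ _ _] _] _ _] _] := SM; rewrite -[in LHS]Ss mxE. Qed.

Lemma stratum_diag i : S i i = 0.
Proof. by have [[[_ dg] _ _] _] := SM. Qed.

Lemma stratum_row_sum i : \sum_j S i j = 0.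
Proof. by have [_ rs] := SM. Qed.

Lemma stratum_col_sum i : \sum_j S j i = 0.
Proof. by under eq_bigr do rewrite stratum_sym; apply: stratum_row_sum. Qed.

Lemma stratum_sg i j : nonloop P i -> nonloop P j -> B i != B j ->
  Num.sg (S i j) = sign_val R (s i) * sign_val R (s j).
Proof. by have [[_ sg _] _] := SM => ni nj ij; apply: sg; rewrite matroid_basisE ni nj. Qed.

Lemma stratum_zero i j : ~~ [&& nonloop P i, nonloop P j & B i != B j] -> S i j = 0.
Proof.
have [[_ _ nb] _] := SM; have [->|ij] := eqVneq i j; first by rewrite stratum_diag.
by rewrite -matroid_basisE; apply: nb.
Qed.

Lemma sign_val_neq0 b : sign_val R b != 0.
Proof. by rewrite /sign_val; case: b; rewrite ?oppr_eq0 oner_eq0. Qed.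

Lemma sign_valM b : sign_val R b * sign_val R b = 1.
Proof. by rewrite /sign_val; case: b; rewrite ?mulrNN mulr1. Qed.

Lemma stratum_neq0 i j : nonloop P i -> nonloop P j -> B i != B j -> S i j != 0.
Proof.
move=> ni nj ij; rewrite -sgr_eq0 stratum_sg //.
by rewrite mulf_neq0 // sign_val_neq0.
Qed.

Lemma stratum_lorentzian : lorentzian S.
Proof.
have [[[[Ss _ _ [e [ce e1 _]]] _] _ _] _] := SM.
exact: lorentzian_signature ce e1.
Qed.

Lemma other_block i : exists j, nonloop P j /\ B i != B j.
Proof.
have [A AP iA] : exists2 A, A \in parts P & A != B i.
  apply/exists_inP; have := parts_ge2 P; rewrite ltnNge.
  apply: contraNT => /exists_inPn nA.
  rewrite -(cards1 (B i)); apply/subset_leq_card/fintype.subsetP => A AP.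
  by rewrite inE; have := nA A AP; rewrite negbK.
have [j [_ nj Bj]] := part_elt AP; exists j; split=> //.
by rewrite Bj eq_sym.
Qed.

(* For i, j in one part, v = S_je e_i - S_ie e_j is isotropic and orthogonal   *)
(* to the positive vector e_j + S_je e_e, hence in the kernel of S.            *)
Lemma stratum_proportional i j : nonloop P i -> nonloop P j -> B i = B j ->
  exists2 c, c != 0 & forall h, S i h = c * S j h.
Proof.
move=> ni nj eqB; have [e [ne je]] := other_block j.
have Sje := stratum_neq0 nj ne je.
have Sie : S i e != 0 by apply: stratum_neq0 => //; rewrite eqB.
have Sij : S i j = 0 by rewrite stratum_zero // eqB eqxx !andbF.
have Ss : S^T = S by apply/matrixP => p q; rewrite mxE stratum_sym.
have /isotropic_orthogonal iso := stratum_lorentzian.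
have := iso Ss (delta_mx 0 j + S j e *: delta_mx 0 e)
  (S j e *: delta_mx 0 i + - S i e *: delta_mx 0 j).
rewrite !(bformDl, bformDr, bformZl, bformZr, bform_delta) !stratum_diag.
rewrite (stratum_sym j i) Sij (stratum_sym e i) (stratum_sym e j) => vS.
exists (S i e / S j e); first by rewrite mulf_neq0 ?invr_neq0.
have vS0 : (S j e *: delta_mx 0 i + - S i e *: delta_mx 0 j : 'rV[R]_n) *m S = 0.
  apply: vS; [|by ring|by ring].
  by rewrite !mulr0 add0r addr0 -mulr2n pmulrn_lgt0 // -expr2 exprn_even_gt0.
move=> h; have /rowP/(_ h) := vS0; rewrite mulmxDl -!scalemxAl -!rowE !mxE mulNr => /eqP; rewrite subr_eq0 => /eqP E.
by apply: (mulfI Sje); rewrite E; field.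
Qed.

Section Schur.
Variables (ki k0 : 'I_n).
Hypotheses (nki : nonloop P ki) (nk0 : nonloop P k0) (k0i : B k0 != B ki).
Local Notation sg0 := (S ki k0).
Local Notation fin := (fin P ki).

Let sg00 : sg0 != 0. Proof. by apply: stratum_neq0; rewrite // eq_sym. Qed.

(** The Gram matrix of the projections to the orthogonal complement of the hyperbolic plane spanned
    by the vectors of [ki] and [k0]. *)
Definition schur : 'M[R]_n :=
  \matrix_(i, j) (S i j - (S i ki * S j k0 + S i k0 * S j ki) / sg0).

Local Notation W := schur.

Lemma schur_sym i j : W i j = W j i.
Proof. by rewrite !mxE stratum_sym; ring. Qed.

Lemma schur_ki j : W ki j = 0.
Proof. by rewrite !mxE stratum_diag (stratum_sym ki j); field. Qed.

Lemma schur_k0 j : W k0 j = 0.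
Proof. by rewrite !mxE stratum_diag (stratum_sym k0 ki) (stratum_sym k0 j); field. Qed.

Lemma schur_proportional c i j : (forall h, S i h = c * S j h) ->
  forall h, W i h = c * W j h.
Proof. by move=> E h; rewrite !mxE !E; ring. Qed.

Lemma schur_loop i : ~~ nonloop P i -> forall h, W i h = 0.
Proof.
move=> il h; have E h' : S i h' = 0 by rewrite stratum_zero // (negPf il).
by rewrite !mxE !E; ring.
Qed.

Lemma schur_col_sum j : \sum_i W i j = 0.
Proof.
under eq_bigr do rewrite mxE; rewrite sumrB stratum_col_sum -mulr_suml big_split /=.
by rewrite -!mulr_suml !stratum_col_sum; ring.
Qed.

(** Rows of [W] vanish in columns [ki] and [k0], whereas a combination of rows [ki] and [k0] of [S]
    vanishing there is trivial; together they span the row space of [S]. *)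
Lemma schur_rank : \rank S = (\rank W).+2.
Proof.
pose U := col_mx (row ki S) (row k0 S).
have Ux (x : 'rV[R]_(1 + 1)) h : (x *m U) 0 h =
    lsubmx x 0 0 * S ki h + rsubmx x 0 0 * S k0 h.
  rewrite -[x in LHS]hsubmxK mul_row_col !mxE !big_ord1 !mxE.
  by [].
have Ufree (x : 'rV[R]_(1 + 1)) : (x *m U) 0 ki = 0 -> (x *m U) 0 k0 = 0 -> x = 0.
  rewrite !Ux !stratum_diag !mulr0 addr0 add0r (stratum_sym k0 ki) => /eqP.
  rewrite mulf_eq0 (negPf sg00) orbF => /eqP x2 /eqP.
  rewrite mulf_eq0 (negPf sg00) orbF => /eqP x1.
  by rewrite -[x]hsubmxK [lsubmx x]mx11_scalar [rsubmx x]mx11_scalar x1 x2 !raddf0 row_mx0.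
have rU : \rank U = 2.
  apply/eqP; rewrite -/(row_free _) -kermx_eq0; apply/rowV0P => x /sub_kermxP xU.
  by apply: Ufree; rewrite xU mxE.
have WE x : x *m W = x *m S - (x *m S) 0 ki / sg0 *: row k0 S - (x *m S) 0 k0 / sg0 *: row ki S.
  apply/rowP => h; rewrite !mxE !mulr_suml -!sumrB; apply: eq_bigr => i _.
  by rewrite !mxE (stratum_sym k0 h) (stratum_sym ki h); ring.
have UW : (U :&: W = 0)%MS.
  apply/eqP; rewrite -submx0; apply/rV_subP => v; rewrite sub_capmx.
  move=> /andP[/submxP[x ->] /submxP[y xy]].
  have W0 h : (y *m W) 0 h = \sum_i y 0 i * W i h by rewrite mxE.
  rewrite (Ufree x) ?mul0mx ?submx0 //.
    by rewrite xy W0 big1 // => i _; rewrite schur_sym schur_ki mulr0.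
  by rewrite xy W0 big1 // => i _; rewrite schur_sym schur_k0 mulr0.
have -> : \rank S = \rank (U + W)%MS.
  apply: eqmx_rank; apply/andP; split.
    apply/row_subP => i; rewrite rowE; move: (delta_mx 0 i : 'rV[R]_n) => e.
    have -> : e *m S = e *m W + ((e *m S) 0 ki / sg0 *: row k0 S +
        (e *m S) 0 k0 / sg0 *: row ki S).
      by rewrite WE -[X in _ = X + _]addrA -opprD subrK.
    rewrite addmx_sub ?addmx_sub ?scalemx_sub //.
    - by apply: submx_trans (addsmxSr _ _); apply: submxMl.
    - apply: submx_trans (addsmxSl _ _); rewrite /U; apply: submx_trans (_ : _ <= row k0 S)%MS _ => //.
      by rewrite -addsmxE addsmxSr.
    - apply: submx_trans (addsmxSl _ _); rewrite /U; apply: submx_trans (_ : _ <= row ki S)%MS _ => //.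
      by rewrite -addsmxE addsmxSl.
  rewrite addsmx_sub /U -addsmxE addsmx_sub !row_sub /=; apply/row_subP => i.
  rewrite rowE WE !addmx_sub ?eqmx_opp ?scalemx_sub ?row_sub ?submxMl //.
by rewrite mxrank_disjoint_sum // rU.
Qed.

End Schur.

End Stratum.

Section StratumChart.
Variables (R : realType) (n : nat) (P : matroid n) (s : signs n) (r : nat).
Variable S : 'M[R]_n.
Hypothesis SM : mmc_stratum P s r S.
Local Notation B := (block P).
Variables (ki k0 : 'I_n).
Hypotheses (nki : nonloop P ki) (nk0 : nonloop P k0) (k0i : B k0 != B ki).
Local Notation fin := (fin P ki).
Local Notation sg0 := (S ki k0).
Local Notation W := (schur S ki k0).
Local Notation d := (\rank W).

(** Elements whose rows form a basis of the row space of [W]; they become the unit vectors of the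
    chart, and [schur_coord] gives the coordinates of all rows in this basis. *)
Definition schur_basis : {ffun 'I_d -> 'I_n} := maxrankfun W.
Local Notation k := schur_basis.

Definition schur_coord : 'M[R]_(n, d) := W *m pinvmx (rowsub k W).
Local Notation X := schur_coord.

Let sg00 : sg0 != 0. Proof. by apply: (stratum_neq0 SM); rewrite // eq_sym. Qed.

Let XW i : row i W = row i X *m rowsub k W.
Proof.
by rewrite -row_mul /X mulmxKpV // -(eq_maxrowsub W) submx_refl.
Qed.

Let XWE i h : W i h = \sum_p X i p * W (k p) h.
Proof.
have /rowP/(_ h) := XW i; rewrite [LHS]mxE [RHS]mxE => ->.
by apply: eq_bigr => p _; congr (_ * _); rewrite mxE.
Qed.

Let Xinj (x y : 'rV[R]_d) : x *m rowsub k W = y *m rowsub k W -> x = y.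
Proof. exact: (row_free_inj (maxrowsub_free W)). Qed.

Let Xk q p : X (k q) p = (q == p)%:R.
Proof.
have /rowP/(_ p) : row (k q) X = delta_mx 0 q.
  by apply: Xinj; rewrite -XW -rowE row_rowsub.
by rewrite [LHS]mxE [RHS]mxE eqxx /= eq_sym.
Qed.

Let Xprop c i j : (forall h, W i h = c * W j h) -> forall p, X i p = c * X j p.
Proof.
move=> E p; have /rowP/(_ p) : row i X = c *: row j X.
  apply: Xinj; rewrite -scalemxAl -!XW; apply/rowP => h.
  by rewrite [LHS]mxE [RHS]mxE E; congr (_ * _); rewrite [RHS]mxE.
by rewrite [in X in X -> _]mxE [X in _ = X -> _]mxE [X in _ = _ * X -> _]mxE.
Qed.

Let X0 i : (forall h, W i h = 0) -> forall p, X i p = 0.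
Proof. by move=> E p; rewrite (@Xprop 0 i i) ?mul0r // => h; rewrite E mul0r. Qed.

Let same_ki i : nonloop P i -> ~~ fin i -> forall p, X i p = 0.
Proof.
move=> ni; rewrite negbK => /eqP Bi; apply: X0 => h.
have [c _ /(@schur_proportional _ _ _ ki k0)->] := stratum_proportional SM ni nki Bi.
by rewrite (schur_ki SM nki nk0 k0i) mulr0.
Qed.

Let same_k0 i : nonloop P i -> B i = B k0 -> forall p, X i p = 0.
Proof.
move=> ni Bi; apply: X0 => h.
have [c _ /(@schur_proportional _ _ _ ki k0)->] := stratum_proportional SM ni nk0 Bi.
by rewrite (schur_k0 SM nki nk0 k0i) mulr0.
Qed.

Let Xloop i : ~~ nonloop P i -> forall p, X i p = 0.
Proof. by move=> il; apply: X0; apply: (schur_loop SM). Qed.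

Let Xkk p : X (k p) p != 0. Proof. by rewrite Xk eqxx oner_eq0. Qed.

Let nk p : nonloop P (k p).
Proof. by apply: contraNT (Xkk p) => /Xloop->. Qed.

Let fk p : fin (k p).
Proof. by apply: contraNT (Xkk p) => /same_ki->. Qed.

Let kk0 p : B (k p) != B k0.
Proof. by apply: contraNN (Xkk p) => /eqP/same_k0->. Qed.

Let kinj : injective (fun p => B (k p)).
Proof.
move=> p q Bpq; have [c _ /(@schur_proportional _ _ _ ki k0)/Xprop/(_ p)] :=
  stratum_proportional SM (nk p) (nk q) Bpq.
rewrite !Xk eqxx; case: eqP => [//|_]; rewrite mulr0 => /eqP.
by rewrite oner_eq0.
Qed.

Let Xsum p : \sum_i X i p = 0.
Proof.
have /rowP/(_ p) : \sum_i row i X = 0.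
  apply: Xinj; rewrite mulmx_suml mul0mx; under eq_bigr do rewrite -XW.
  by apply/rowP => h; rewrite summxE mxE -[RHS](schur_col_sum SM ki k0 h);
     apply: eq_bigr => i _; rewrite mxE.
rewrite summxE [RHS]mxE => E; rewrite -[RHS]E.
by apply: eq_bigr => i _; rewrite [RHS]mxE.
Qed.

Let SkiE i : ~~ fin i -> S i ki = 0.
Proof. by rewrite negbK => E; apply: (stratum_zero SM); rewrite E !andbF. Qed.

Let Sloop i j : ~~ nonloop P i -> S i j = 0.
Proof. by move=> il; apply: (stratum_zero SM); rewrite (negPf il). Qed.

(** Without such an element, the p-th coordinates would sum to that of [k p], which is 1 and not 0;
    when the rank is 0, column [ki] of [S] would sum to its nonzero entry at [k0]. *)
Lemma spare_elt : exists i0, [/\ nonloop P i0, fin i0 & ~~ basis_elt ki k0 k i0].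
Proof.
apply: contrapT => no.
have all i : nonloop P i -> fin i -> i = k0 \/ exists l, i = k l.
  move=> ni fi; have : basis_elt ki k0 k i.
    by apply: contrapT => /negP nb; apply: no; exists i.
  case/or3P => [/eqP E|/eqP|/existsP[l /eqP]]; [|by left|by right; exists l].
  by move: fi; rewrite /fin E eqxx.
have [p _|nop] := pickP 'I_d.
  have := Xsum p; rewrite (bigD1 (k p)) //= Xk eqxx big1 ?addr0 => [/eqP|i ik].
    by rewrite oner_eq0.
  have [ni|/Xloop-> //] := boolP (nonloop P i).
  have [fi|/same_ki-> //] := boolP (fin i).
  have [->|[l il]] := all _ ni fi; first exact: same_k0.
  rewrite il Xk; case: eqP => // lp; by rewrite il lp eqxx in ik.
have := stratum_col_sum SM ki; rewrite (bigD1 k0) //= big1 ?addr0 => [/eqP|i ik].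
  by rewrite (stratum_sym SM) (negPf sg00).
have [ni|/Sloop-> //] := boolP (nonloop P i).
have [fi|/SkiE-> //] := boolP (fin i).
have [ii|[l _]] := all _ ni fi; first by rewrite ii eqxx in ik.
by have := nop l.
Qed.

Variable i0 : 'I_n.
Hypotheses (ni0 : nonloop P i0) (fi0 : fin i0) (bi0 : ~~ basis_elt ki k0 k i0).
Local Notation t := (S i0 ki).

Let t0 : t != 0. Proof. exact: (stratum_neq0 SM). Qed.

Lemma schur_valid : valid_chart P ki k0 k i0.
Proof. by split. Qed.

(** Solves the chart equations for the weights: [a i0 = 1] gives [a ki = t], then [a i = S i ki / t]
    at finite [i], in particular [a k0 = sg0 / t], which determines the weights at infinity. *)
Definition schur_a i : R :=
  if nonloop P i then if fin i then S i ki / t else t * S i k0 / sg0 else 0.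
Local Notation a := schur_a.

Definition schur_zi i : 'rV[R]_d := \row_p (X i p * a (k p) / a i).

(** Any representative serves, because proportional rows give the same [schur_zi]; the empty block
    of the loops gets 0. *)
Definition schur_z (A : {set 'I_n}) : 'rV[R]_d :=
  if [pick i in A] is Some i then schur_zi i else 0.
Local Notation z := schur_z.

Definition schur_C : 'M[R]_d := \matrix_(p, q) (- W (k p) (k q) / (2 * a (k p) * a (k q))).
Local Notation C := schur_C.

Lemma schur_a_sg i : nonloop P i -> Num.sg (a i) = sign_val R (s i) * sign_val R (s i0).
Proof.
move=> ni; rewrite /a ni; have sM := sign_valM R.
have sg2 := stratum_sg SM; have := sM (s ki); have := sM (s k0).
case: ifP => fi.
  rewrite sgrM sgrV !sg2 //; set x := sign_val R (s ki) => _ xx.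
  by rewrite mulrACA xx mulr1.
have Bi : B i = B ki by move/negbT: fi; rewrite negbK => /eqP.
rewrite !sgrM sgrV !sg2 // ?Bi 1?eq_sym //.
set x := sign_val R (s ki); set y := sign_val R (s k0) => yy xx.
transitivity (sign_val R (s i) * sign_val R (s i0) * (x * x) * (y * y)); first by ring.
by rewrite xx yy !mulr1.
Qed.

Let an0 i : nonloop P i -> a i != 0.
Proof. by move=> ni; rewrite -sgr_eq0 schur_a_sg // mulf_neq0 // sign_val_neq0. Qed.

Let a_fin i : a i * (fin i)%:R = S i ki / t.
Proof.
rewrite /a; have [ni|/Sloop->] := boolP (nonloop P i); last by rewrite !mul0r.
by have [fi|fi] := boolP (fin i); rewrite ?mulr1 // mulr0 SkiE // mul0r.
Qed.

Let a_prop c i j : nonloop P i -> nonloop P j -> B i = B j ->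
  (forall h, S i h = c * S j h) -> a i = c * a j.
Proof.
by move=> ni nj eqB E; rewrite /a ni nj /fin eqB -/(fin j) !E; case: (fin j); ring.
Qed.

Let schurE i j : W i j = S i j - (S i ki * S j k0 + S i k0 * S j ki) / sg0.
Proof. exact: mxE. Qed.

Let CE p q : C p q = - W (k p) (k q) / (2 * a (k p) * a (k q)).
Proof. exact: mxE. Qed.

Let ziE i p : schur_zi i 0 p = X i p * a (k p) / a i.
Proof. exact: mxE. Qed.

Let zB i : nonloop P i -> z (B i) = schur_zi i.
Proof.
move=> ni; rewrite /z; case: pickP => [j jB|no]; last first.
  have := no i; rewrite -[in X in X -> _]/(i \in B i).
  by rewrite /block finset.mem_pblock -/(nonloop P i) ni.
have Bj : B j = B i by apply: block_of jB; apply: block_part.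
have nj : nonloop P j by apply: nonloop_of (block_part ni) jB.
have [c c0 E] := stratum_proportional SM nj ni Bj.
apply/rowP => p; rewrite !ziE (a_prop nj ni Bj E) (Xprop (schur_proportional ki k0 E)).
by field; rewrite c0 an0.
Qed.

(** With [ki] at infinity and [k0] at the origin, only the term -2 C(z_i, z_j) of the Gram entry
    survives in the Schur complement. *)
Let key i j : nonloop P i -> nonloop P j ->
  a i * a j * bform C (schur_zi i) (schur_zi j) = - W i j / 2.
Proof.
move=> ni nj; rewrite bformE mulr_sumr XWE -sumrN mulr_suml; apply: eq_bigr => p _.
rewrite (schur_sym SM) XWE !mulr_sumr -sumrN mulr_suml; apply: eq_bigr => q _.
rewrite !ziE CE (schur_sym SM ki k0 (k q)); field.
by rewrite !an0.
Qed.

Let aw i : nonloop P i -> a i * wt (fun i => z (B i)) C fin i = t * S i k0 / sg0.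
Proof.
move=> ni; rewrite /wt; have [fi|fi] := boolP (fin i); last first.
  by rewrite mulr1 /a ni (negPf fi).
apply: (mulfI (an0 ni)); rewrite mulrA zB // key // schurE (stratum_diag SM).
by rewrite /a ni fi; field; rewrite t0 sg00.
Qed.

Lemma schur_config : S = config_mx a (fun i => z (B i)) C fin.
Proof.
apply/matrixP => i j; rewrite mxE.
have [ni|il] := boolP (nonloop P i); last by rewrite Sloop // /a (negPf il) !mul0r.
have [nj|jl] := boolP (nonloop P j); last first.
  by rewrite (stratum_sym SM) Sloop // /a (negPf jl) mulr0 mul0r.
rewrite /gram; set wi := wt _ _ _ i; set wj := wt _ _ _ j.
transitivity ((a i * (fin i)%:R) * (a j * wj) + (a i * wi) * (a j * (fin j)%:R)
   - 2 * (a i * a j * bform C (z (B i)) (z (B j)))); last by ring.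
rewrite !a_fin !aw // !zB // key // schurE; field.
by rewrite t0 sg00.
Qed.

Lemma schur_chart_point : chart_point P ki k0 k i0 a z C.
Proof.
split.
- apply/matrixP => p q; rewrite mxE !CE (schur_sym SM).
  by rewrite -mulrA [a _ * _]mulrC mulrA.
- by move=> i il; rewrite /a (negPf il).
- by rewrite /a ni0 fi0 divff.
- by rewrite zB //; apply/rowP => p; rewrite ziE [RHS]mxE same_ki ?mul0r // /fin eqxx.
- by rewrite zB //; apply/rowP => p; rewrite ziE [RHS]mxE same_k0 ?mul0r.
- move=> l; rewrite zB //; apply/rowP => p; rewrite ziE [RHS]mxE Xk eqxx eq_sym /=.
  by case: eqP => [->|_]; rewrite ?mul0r //= mul1r divff ?an0.
- by rewrite /z; case: pickP => // j; rewrite inE.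
split.
- by under eq_bigr do rewrite a_fin; rewrite -mulr_suml (stratum_col_sum SM) mul0r.
- apply/rowP => p; rewrite summxE [RHS]mxE.
  transitivity ((\sum_i X i p) * a (k p)); last by rewrite Xsum mul0r.
  rewrite mulr_suml; apply: eq_bigr => i _; rewrite [LHS]mxE.
  have [ni|il] := boolP (nonloop P i); last by rewrite Xloop // /a (negPf il) !mul0r.
  by rewrite zB // ziE; field; apply: an0.
- transitivity (\sum_i t / sg0 * S i k0); last by rewrite -mulr_sumr (stratum_col_sum SM) mulr0.
  apply: eq_bigr => i _; have [ni|il] := boolP (nonloop P i); first by rewrite aw //; ring.
  by rewrite (Sloop k0 il) /a (negPf il) mul0r mulr0.
Qed.

End StratumChart.

Lemma stratum_chart (R : realType) n (P : matroid n) (s : signs n) r (S : 'M[R]_n) :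
  mmc_stratum P s r S ->
  exists d (ki k0 : 'I_n) (k : {ffun 'I_d -> 'I_n}) i0 a z C,
  [/\ r = d.+2, valid_chart P ki k0 k i0, chart_point P ki k0 k i0 a z C,
   forall i, nonloop P i -> Num.sg (a i) = sign_val R (s i) * sign_val R (s i0) &
   S = config_mx a (fun i => z (block P i)) C (fin P ki)].
Proof.
move=> SM; have [A AP] : exists A, A \in parts P.
  by apply/card_gt0P; apply: ltnW (parts_ge2 P).
have [ki [_ nki _]] := part_elt AP.
have [k0 [nk0 k0i]] := other_block P ki; rewrite eq_sym in k0i.
have [i0 [ni0 fi0 bi0]] := spare_elt SM nki nk0 k0i.
exists (\rank (schur S ki k0)), ki, k0, (schur_basis S ki k0), i0.
exists (schur_a P S ki k0 i0), (schur_z P S ki k0 i0), (schur_C P S ki k0 i0); split.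
- rewrite -(schur_rank SM nki nk0 k0i).
  by have [[[[_ <- _ _] _] _ _] _] := SM.
- exact: (schur_valid SM).
- exact: (schur_chart_point SM).
- exact: (schur_a_sg SM).
- exact: (schur_config SM).
Qed.

(** * Existence of momentum conserving configurations *)

Lemma small_perturbation (R : realType) (I : finType) (U U' : I -> R) :
  (forall i, 0 < U i) -> exists2 e, 0 < e & forall i, 0 < U i + e * U' i.
Proof.
move=> U0; pose M := 1 + \sum_i `|U' i| / U i.
have M0 : 0 < M by rewrite ltr_wpDr // sumr_ge0 // => i _; rewrite divr_ge0 // ltW.
exists M^-1 => [|i]; first by rewrite invr_gt0.
have : `|U' i| / U i < M.
  rewrite /M (bigD1 i) //= addrCA ltrDl ltr_wpDr // sumr_ge0 // => j _.
  by rewrite divr_ge0 // ltW.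
rewrite ltr_pdivrMr // mulrC -ltr_pdivrMr // mulrC => lt.
by rewrite -ltrBlDr sub0r; apply: le_lt_trans lt;
  rewrite -mulrN ler_pM2l ?invr_gt0 // -normrN ler_norm.
Qed.

Lemma sign_valN (R : realType) b : sign_val R (~~ b) = - sign_val R b.
Proof. by case: b; rewrite /sign_val ?opprK. Qed.

Lemma sgr_sign_val (R : realType) (x : R) b :
  (Num.sg x == sign_val R b) = (0 < sign_val R b * x).
Proof. by case: b; rewrite /sign_val ?mul1r ?mulN1r ?oppr_gt0 sgr_cp0. Qed.

Section Perturb.
Variables (R : realType) (n d : nat) (P : matroid n) (t : signs n).
Variables (ki k0 : 'I_n) (k : {ffun 'I_d -> 'I_n}) (i0 : 'I_n).
Hypothesis V : valid_chart P ki k0 k i0.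
Local Notation B := (block P).
Local Notation fin := (fin P ki).
Local Notation free := (free_param P ki k0 k i0).
Local Notation tau := (fun i => sign_val R (t i)).

Let kin : forall j, basis_elt ki k0 k j -> j != i0 /\ (inr j \in free) = false.
Proof.
move=> j bj; split; first by apply: contraTneq bj => ->; rewrite (vc_bi0 V).
by rewrite unfold_in bj andbF.
Qed.

Lemma dec_a_basis (Y : param n d -> R) : (forall t, t \notin free -> Y t = 0) ->
  [/\ dec_a P ki k0 k i0 Y ki = dec_ai P ki k0 k i0 Y,
      dec_a P ki k0 k i0 Y k0 = dec_a0 P ki k0 k i0 Y &
      forall p, dec_a P ki k0 k i0 Y (k p) = dec_ak P ki k0 k i0 Y p].
Proof.
move=> Y0; have [_ _ _ fk0 fk kk0 kinj _ _ _] := V.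
have af j : basis_elt ki k0 k j -> dec_af i0 Y j = 0.
  by move=> bj; have [/negPf ji jf] := kin bj; rewrite /dec_af ji Y0 // jf.
have ek0 : (k0 == ki) = false.
  by apply: contraTF fk0 => /eqP->; rewrite negbK.
have eki p : (k p == ki) = false.
  by apply: contraTF (fk p) => /eqP->; rewrite negbK.
have ekk0 p : (k p == k0) = false.
  by apply: contraNF (kk0 p) => /eqP->.
rewrite /dec_a; split=> [||p]; rewrite af /basis_elt ?eqxx ?orbT ?mul1r ?add0r //.
- rewrite eq_sym ek0 mul0r addr0 big1 ?addr0 // => l _.
  by rewrite eq_sym eki mul0r.
- rewrite ek0 mul0r add0r big1 ?addr0 // => l _.
  by rewrite eq_sym ekk0 mul0r.
- rewrite eki ekk0 !mul0r !add0r (bigD1 p) //= eqxx mul1r big1 ?addr0 // => l lp.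
  case: eqP => [E|_]; last by rewrite mul0r.
  by have := kinj _ _ (congr1 B E) => E'; rewrite E' eqxx in lp.
- by apply/orP; right; apply/orP; right; apply/existsP; exists p.
Qed.

Variables (u : 'I_n -> R) (zeta : {set 'I_n} -> 'I_d -> R).

Definition base_param (x : param n d) : R :=
  if x \in free then
    match x with
    | inl (inl pq) => (pq.1 == pq.2)%:R
    | inl (inr Al) => zeta Al.1 Al.2
    | inr i => u i
    end
  else 0.

Local Notation Y0 := base_param.

Hypothesis ti0 : t i0.
Hypothesis usg : forall i, inr i \in free -> u i = 0 \/ Num.sg (u i) = tau i.
Hypothesis ksg : forall p, Num.sg (dec_ak P ki k0 k i0 Y0 p) = tau (k p).
Hypothesis k0sg : Num.sg (dec_a0 P ki k0 k i0 Y0) = tau k0.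
Hypothesis kisg : Num.sg (dec_ai P ki k0 k i0 Y0) = tau ki.

(** Vanishing free weights are moved to [e] times their prescribed signs. The solved weights are
    affine in [e], so their signs persist for small [e], and positions and form do not change. *)
Lemma perturb_point : exists y : 'rV[R]_#|free|,
  [/\ forall i, nonloop P i -> Num.sg (dec_a P ki k0 k i0 (extend y) i) = tau i,
      forall A l, dec_z P ki k0 k (extend y) A l = dec_z P ki k0 k Y0 A l &
      dec_C (extend y) = 1%:M].
Proof.
pose v i : R := if (inr i \in free) && (u i == 0) then tau i else 0.
pose Y e (x : param n d) := Y0 x + e * (if x is inr i then v i else 0).
have Yz e A l : dec_z P ki k0 k (Y e) A l = dec_z P ki k0 k Y0 A l.
  by rewrite /dec_z /Y mulr0 addr0.
have Yc e p q : dec_c (Y e) p q = dec_c Y0 p q by rewrite /dec_c /Y mulr0 addr0.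
have Yw e i : dec_w P ki k0 k (Y e) i = dec_w P ki k0 k Y0 i.
  rewrite /dec_w; case: ifP => // _; apply: eq_bigr => p _; apply: eq_bigr => q _.
  by rewrite !Yz Yc.
have Yaf e i : dec_af i0 (Y e) i = dec_af i0 Y0 i + e * v i.
  rewrite /dec_af /Y; case: eqP => // ->.
  by rewrite /v unfold_in /= eqxx !andbF mulr0 addr0.
pose vk p := - \sum_i v i * dec_z P ki k0 k Y0 (B i) p.
have Yak e p : dec_ak P ki k0 k i0 (Y e) p = dec_ak P ki k0 k i0 Y0 p + e * vk p.
  rewrite /dec_ak /vk mulrN mulr_sumr -opprD -big_split; congr (- _).
  by apply: eq_bigr => i _ /=; rewrite Yaf Yz; ring.
pose v0 := - \sum_i v i * (fin i)%:R - \sum_l vk l.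
have Ya0 e : dec_a0 P ki k0 k i0 (Y e) = dec_a0 P ki k0 k i0 Y0 + e * v0.
  rewrite /dec_a0 /v0; under eq_bigr do rewrite Yaf mulrDl -mulrA.
  under [X in _ - X]eq_bigr do rewrite Yak.
  by rewrite !big_split /= -!mulr_sumr; ring.
pose vi := - \sum_i v i * dec_w P ki k0 k Y0 i - \sum_l vk l * dec_c Y0 l l.
have Yai e : dec_ai P ki k0 k i0 (Y e) = dec_ai P ki k0 k i0 Y0 + e * vi.
  rewrite /dec_ai /vi; under eq_bigr do rewrite Yaf Yw mulrDl -mulrA.
  under [X in _ - X]eq_bigr do rewrite Yak Yc mulrDl -mulrA.
  by rewrite !big_split /= -!mulr_sumr; ring.
pose U (x : option (option 'I_d)) : R := match x with
  | None => tau ki * dec_ai P ki k0 k i0 Y0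
  | Some None => tau k0 * dec_a0 P ki k0 k i0 Y0
  | Some (Some p) => tau (k p) * dec_ak P ki k0 k i0 Y0 p end.
pose U' (x : option (option 'I_d)) : R := match x with
  | None => tau ki * vi | Some None => tau k0 * v0 | Some (Some p) => tau (k p) * vk p end.
have U0 x : 0 < U x by case: x => [[p|]|] /=; rewrite -sgr_sign_val; apply/eqP.
have [e e0 Ue] := small_perturbation U' U0.
have Yfree x : x \notin free -> Y e x = 0.
  move=> xf; rewrite /Y /base_param (negPf xf) add0r.
  by case: x xf => [x|i] xf; rewrite ?mulr0 // /v (negPf xf) mulr0.
have [y yE] := extend_onto Yfree; exists y; rewrite yE; split.
- move=> i ni; apply/eqP; rewrite sgr_sign_val.
  have [ai a0 ak] := dec_a_basis Yfree.
  have [/or3P bi|bi] := boolP (basis_elt ki k0 k i).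
    case: bi => [/eqP->|/eqP->|/existsP[p /eqP->]].
    - by have := Ue None; rewrite ai Yai /= mulrCA -mulrDr.
    - by have := Ue (Some None); rewrite a0 Ya0 /= mulrCA -mulrDr.
    - by have := Ue (Some (Some p)); rewrite ak Yak /= mulrCA -mulrDr.
  rewrite dec_a_free // Yaf /dec_af; case: eqP => [->|/eqP ii].
    by rewrite /v unfold_in /= eqxx !andbF mulr0 addr0 /sign_val ti0 mulr1.
  have fi : inr i \in free by rewrite unfold_in ni bi ii.
  rewrite /base_param fi /v fi; have [ui|ui] := eqVneq (u i) 0.
    by rewrite ui add0r mulrCA sign_valM mulr1.
  by rewrite mulr0 addr0 -sgr_sign_val; case: (usg fi) => [/eqP|->//]; rewrite (negPf ui).
- by move=> A l; apply: Yz.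
- apply/matrixP => p q; rewrite !mxE Yc /dec_c.
  case: leqP => pq; rewrite /base_param unfold_in /=; first by rewrite pq.
  by rewrite (ltnW pq) eq_sym.
Qed.

End Perturb.

(** The enumeration of [X] is rotated so as to start at [x0]. *)
Lemma injection_into (T : finType) (X : {set T}) (x0 : T) d : (d <= #|X|)%N ->
  exists f : 'I_d -> T, [/\ injective f, forall p, f p \in X &
    x0 \in X -> forall p : 'I_d, p = 0%N :> nat -> f p = x0].
Proof.
move=> dX; pose L := rot (index x0 (enum X)) (enum X).
have sL : size L = #|X| by rewrite size_rot -cardE.
have lt (p : 'I_d) : (p < size L)%N by rewrite sL; apply: leq_trans (ltn_ord p) dX.
exists (fun p => nth x0 L p); split.
- move=> p q /eqP; rewrite nth_uniq ?lt // ?rot_uniq ?enum_uniq // => /eqP.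
  exact: val_inj.
- by move=> p; have := mem_nth x0 (lt p); rewrite mem_rot mem_enum.
- by move=> x0X p ->; rewrite /L rot_index ?mem_enum.
Qed.

Lemma leq_sub_le3 d a b : (d.+2 < b -> a <= 3 -> d <= b - a)%N.
Proof. by move=> *; lia. Qed.

Lemma half_neq_nat (R : numFieldType) (a : nat) : (1 / 2 : R) != a%:R.
Proof.
apply/eqP => E; have : (1 : R) = (a * 2)%:R by rewrite natrM -E divfK // pnatr_eq0.
by move/eqP; rewrite (eqr_nat R 1) muln2 => /eqP/(congr1 odd); rewrite odd_double.
Qed.

Section Existence.
Variables (R : realType) (n : nat) (P : matroid n) (t : signs n).
Local Notation B := (block P).

(** A point around which a chart parametrizes an open piece of its image in the stratum; it gives
    both nonemptiness and the dimension. *)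
Definition good_point d := exists (ki k0 : 'I_n) (k : {ffun 'I_d -> 'I_n}) i0,
  exists2 y : 'rV[R]_#|free_param P ki k0 k i0|,
    valid_chart P ki k0 k i0 &
  [/\ forall i, nonloop P i -> Num.sg (dec_a P ki k0 k i0 (extend y) i) = sign_val R (t i),
      forall i j, nonloop P i -> nonloop P j -> fin P ki i -> fin P ki j -> B i != B j ->
        exists l, dec_z P ki k0 k (extend y) (B i) l != dec_z P ki k0 k (extend y) (B j) l &
      dec_C (extend y) = 1%:M].

Lemma sgr_sign_valE b : Num.sg (sign_val R b) = sign_val R b.
Proof. by case: b; rewrite /sign_val ?sgrN sgr1. Qed.

Lemma dec_z_basis d (ki k0 : 'I_n) (k : {ffun 'I_d -> 'I_n}) (Y : param n d -> R) A l :
  basis_block P ki k0 k A -> dec_z P ki k0 k Y A l = (A == B (k l))%:R.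
Proof. by rewrite /dec_z => ->. Qed.

(** All parts are basis parts. Two elements of opposite signs in each part get weights 1 and -1, so
    each part sums to zero; the zero weights left are perturbed afterwards. *)
Lemma good_point_full d : #|parts P| = d.+2 ->
  (forall A, A \in parts P -> exists i j, [/\ i \in A, j \in A & t i != t j]) ->
  good_point d.
Proof.
move=> Pd mixed.
have pm A : exists ij : 'I_n * 'I_n, A \in parts P ->
    [/\ ij.1 \in A, ij.2 \in A, t ij.1 & ~~ t ij.2].
  have [/mixed[i [j [iA jA ij]]]|_] := boolP (A \in parts P); last first.
    have [i _] : exists i : 'I_n, i \in predT.
      have /card_gt0P[C /part_elt[i _]] : (0 < #|parts P|)%N by rewrite Pd.
      by exists i.
    by exists (i, i).
  case ti: (t i) ij => ij.
    by exists (i, j); split; rewrite /= ?ti //; case: (t j) ij.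
  by exists (j, i); split; rewrite /= ?ti //; case: (t j) ij.
have [pn pnP] := choice pm.
have /card_gt0P[Ai AiP] : (0 < #|parts P|)%N by rewrite Pd.
have [i1 [_ ni1 Bi1]] := part_elt AiP.
have [i2 [ni2]] := other_block P i1; rewrite Bi1; set A0 := B i2 => Ai0.
have A0P : A0 \in parts P by apply: block_part.
(* [ka] gives the basis elements and [pa] their partners. The roles are exchanged in [A0] so that
   [i0 = pa A0] is positive, as the normalization [a i0 = 1] demands. *)
pose ka A := if A == A0 then (pn A).2 else (pn A).1.
pose pa A := if A == A0 then (pn A).1 else (pn A).2.
have kaA A : A \in parts P -> ka A \in A by move=> /pnP[? ? _ _]; rewrite /ka; case: eqP.
have paA A : A \in parts P -> pa A \in A by move=> /pnP[? ? _ _]; rewrite /pa; case: eqP.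
have tpa A : A \in parts P -> t (pa A) = ~~ t (ka A).
  by move=> /pnP[_ _ t1 /negPf t2]; rewrite /pa /ka; case: eqP => _; rewrite t1 t2.
have Bka A : A \in parts P -> B (ka A) = A by move=> AP; apply: block_of (kaA _ AP).
have Bpa A : A \in parts P -> B (pa A) = A by move=> AP; apply: block_of (paA _ AP).
have nka A : A \in parts P -> nonloop P (ka A) by move=> AP; apply: nonloop_of AP (kaA _ AP).
have npa A : A \in parts P -> nonloop P (pa A) by move=> AP; apply: nonloop_of AP (paA _ AP).
have pka A : A \in parts P -> pa A != ka A.
  by move=> /tpa E; apply: contra_eqN E => /eqP->; case: (t _).
pose T := (parts P :\: [set Ai; A0])%SET.
have cT : #|T| = d.
  rewrite cardsDS ?cards2 ?Ai0 ?Pd ?subn2 //.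
  by apply/fintype.subsetP => A; rewrite !inE => /orP[] /eqP->.
have [|f [finj fT _]] := @injection_into _ T Ai d; first by rewrite cT.
have fP p : f p \in parts P by have := fT p; rewrite inE => /andP[].
have fi p : f p != Ai by have := fT p; rewrite !inE negb_or => /andP[/andP[]].
have f0 p : f p != A0 by have := fT p; rewrite !inE negb_or => /andP[/andP[]].
have fsurj A : A \in parts P -> A != Ai -> A != A0 -> exists p, A = f p.
  move=> AP Ai' A0'; have : A \in [set f p | p : 'I_d]%SET.
    have -> : [set f p | p : 'I_d]%SET = T.
      apply/eqP; rewrite eqEcard card_imset // card_ord cT leqnn andbT.
      by apply/fintype.subsetP => _ /imsetP[p _ ->].
    by rewrite !inE negb_or Ai' A0' AP.
  by case/imsetP => p _ ->; exists p.
pose ki := ka Ai; pose k0 := ka A0; pose i0 := pa A0.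
pose k := [ffun p => ka (f p)] : {ffun 'I_d -> 'I_n}.
have Bki : B ki = Ai by rewrite Bka.
have Bk0 : B k0 = A0 by rewrite Bka.
have Bi0 : B i0 = A0 by rewrite Bpa.
have Bk p : B (k p) = f p by rewrite ffunE Bka.
have bka j : basis_elt ki k0 k j -> j = ka (B j).
  by case/or3P => [/eqP->|/eqP->|/existsP[p /eqP->]]; rewrite ?Bki ?Bk0 ?Bk ?ffunE.
have V : valid_chart P ki k0 k i0.
  split; rewrite /fin ?Bki ?Bk0 ?Bi0 ?[A0 == _]eq_sym //.
  - exact: nka.
  - exact: nka.
  - by move=> l; rewrite ffunE nka.
  - by move=> l; rewrite Bk fi.
  - by move=> l; rewrite Bk f0.
  - by move=> p q; rewrite !Bk => /finj.
  - exact: npa.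
  - by apply: contraTN (pka _ A0P) => /bka; rewrite Bi0 -/i0 => ->; rewrite negbK.
have bb i : nonloop P i -> basis_block P ki k0 k (B i).
  move=> ni; rewrite /basis_block Bki Bk0.
  have [//|iAi] := eqVneq (B i) Ai; have [//|iA0 /=] := eqVneq (B i) A0.
  by have [p E] := fsurj _ (block_part ni) iAi iA0; apply/existsP; exists p; rewrite Bk E.
pose u i := if nonloop P i && (i == pa (B i)) then sign_val R (t i) else 0.
pose Y0 := base_param P ki k0 k i0 u (fun _ _ => 0).
have ti0 : t i0 by have [_ _ ? _] := pnP _ A0P; rewrite /i0 /pa eqxx.
have afE i : dec_af i0 Y0 i = u i.
  rewrite /dec_af; case: eqP => [->|/eqP ii].
    by rewrite /u npa // Bi0 eqxx /sign_val ti0.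
  rewrite /Y0 /base_param; case: ifP => // /negbT.
  rewrite unfold_in /= ii andbT negb_and => /orP[/negPf ni|]; first by rewrite /u ni.
  rewrite negbK => bi; rewrite /u; case: ifP => // /andP[ni /eqP ip].
  by have := pka _ (block_part ni); rewrite -ip -(bka _ bi) eqxx.
have zE i l : nonloop P i -> dec_z P ki k0 k Y0 (B i) l = (B i == f l)%:R.
  by move=> ni; rewrite dec_z_basis ?Bk // bb.
have cE p q : dec_c Y0 p q = (p == q)%:R.
  rewrite /dec_c; case: leqP => pq; rewrite /Y0 /base_param unfold_in /=; first by rewrite pq.
  by rewrite (ltnW pq) eq_sym.
have blk A : A \in parts P -> \sum_i u i * (B i == A)%:R = sign_val R (t (pa A)).
  move=> AP; rewrite (bigD1 (pa A)) //= Bpa // eqxx mulr1 big1 ?addr0 => [|i ip].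
    by rewrite /u npa // Bpa // eqxx.
  rewrite /u; have [E|_] := eqVneq (B i) A; last by rewrite mulr0.
  by rewrite E (negPf ip) andbF mul0r.
have uloop i x y : (nonloop P i -> x = y) -> u i * x = u i * y.
  by rewrite /u; case: (nonloop P i) => [->//|_]; rewrite !mul0r.
have tka A : A \in parts P -> sign_val R (t (pa A)) = - sign_val R (t (ka A)).
  by move=> AP; rewrite tpa // sign_valN.
have akE p : dec_ak P ki k0 k i0 Y0 p = sign_val R (t (k p)).
  rewrite /dec_ak (eq_bigr (fun i => u i * (B i == f p)%:R)).
    by rewrite blk // tka // opprK ffunE.
  by move=> i _; rewrite afE; apply: uloop => ni; rewrite zE.
have exch A (g : 'I_n -> R) : A \in parts P ->
    (forall i, nonloop P i -> g i = (B i == A)%:R + \sum_p (B i == f p)%:R) ->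
    \sum_i u i * g i = - sign_val R (t (ka A)) - \sum_p sign_val R (t (k p)).
  move=> AP gE; rewrite -tka // -blk // -sumrN.
  rewrite (eq_bigr (fun i => u i * (B i == A)%:R + \sum_p u i * (B i == f p)%:R)).
    rewrite big_split exchange_big /=; congr (_ + _); apply: eq_bigr => p _.
    by rewrite blk // tka // ffunE.
  by move=> i _; rewrite -mulr_sumr -mulrDr; apply: uloop; apply: gE.
have fE i : nonloop P i -> (fin P ki i)%:R = (B i == A0)%:R + \sum_p (B i == f p)%:R :> R.
  move=> ni; rewrite /fin Bki; have [->|iAi] /= := eqVneq (B i) Ai.
    by rewrite (negPf Ai0) add0r big1 // => p _; rewrite eq_sym (negPf (fi p)).
  have [->|iA0] := eqVneq (B i) A0.
    by rewrite big1 ?addr0 // => p _; rewrite eq_sym (negPf (f0 p)).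
  have [p ->] := fsurj _ (block_part ni) iAi iA0; rewrite add0r (bigD1 p) //= eqxx.
  by rewrite big1 ?addr0 // => q qp; rewrite (inj_eq finj) eq_sym (negPf qp).
have wE i : nonloop P i -> dec_w P ki k0 k Y0 i = (B i == Ai)%:R + \sum_p (B i == f p)%:R.
  move=> ni; rewrite /dec_w /fin Bki; have [->|iAi] /= := eqVneq (B i) Ai.
    by rewrite big1 ?addr0 // => p _; rewrite eq_sym (negPf (fi p)).
  rewrite add0r; apply: eq_bigr => p _; rewrite (bigD1 p) //= cE eqxx mulr1 big1 ?addr0.
    by rewrite zE //; case: eqP => _; rewrite ?mulr1 ?mulr0.
  by move=> q qp; rewrite cE eq_sym (negPf qp) mulr0 mul0r.
have a0E : dec_a0 P ki k0 k i0 Y0 = sign_val R (t k0).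
  rewrite /dec_a0; under eq_bigr do rewrite afE.
  rewrite (exch A0) //; under [X in _ - X = _]eq_bigr do rewrite akE.
  by rewrite -/k0; ring.
have aiE : dec_ai P ki k0 k i0 Y0 = sign_val R (t ki).
  rewrite /dec_ai; under eq_bigr do rewrite afE.
  rewrite (exch Ai) //; under [X in _ - X = _]eq_bigr do rewrite akE cE eqxx mulr1.
  by rewrite -/ki; ring.
have [||||y [ysg yz yC]] := perturb_point V (u := u) (zeta := fun _ _ => 0) ti0.
- move=> i _; rewrite /u; case: ifP => _; last by left.
  by right; rewrite sgr_sign_valE.
- by move=> p; rewrite akE sgr_sign_valE.
- by rewrite a0E sgr_sign_valE.
- by rewrite aiE sgr_sign_valE.
exists ki, k0, k, i0, y => //; split=> // i j ni nj; rewrite /fin Bki => fi' fj' ij.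
have [iA0|iA0] := eqVneq (B i) A0.
  have jA0 : B j != A0 by rewrite -iA0 eq_sym.
  have [p E] := fsurj _ (block_part nj) fj' jA0; exists p; rewrite !yz !zE //.
  by rewrite E eqxx iA0 [A0 == _]eq_sym (negPf (f0 p)) eq_sym oner_eq0.
have [p E] := fsurj _ (block_part ni) fi' iA0; exists p; rewrite !yz !zE //.
by rewrite -E eqxx [B j == _]eq_sym (negPf ij) oner_eq0.
Qed.

(** Place [j] at infinity, [l1] at the origin, [l2] at the first unit vector and [i], with weight 1,
    at the point [zw]. The solved weights are [- zw p] at [k p], [- 1 + \sum_p zw p] at [l1] and
    [\sum_p zw p * (1 - zw p)] at [j]; first coordinate 1/2 and small others give the signs. *)
Lemma good_point_generic d (i j l1 l2 : 'I_n) : (0 < d)%N -> (d.+2 < #|parts P|)%N ->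
  nonloop P i -> nonloop P j -> nonloop P l1 -> nonloop P l2 ->
  uniq [:: B i; B j; B l1; B l2] -> t i -> t j -> ~~ t l1 -> ~~ t l2 ->
  good_point d.
Proof.
move=> d0 dP ni nj n1 n2; rewrite /= !inE !negb_or.
move=> /and4P[/and3P[ij il1 il2] /andP[jl1 jl2] l12 _] ti tj /negPf t1 /negPf t2.
pose T := (parts P :\: [set B i; B j; B l1])%SET.
have cT : (d <= #|T|)%N.
  rewrite cardsDS; last first.
    by apply/fintype.subsetP => A; rewrite !inE -orbA => /or3P[] /eqP->; apply: block_part.
  have c3 : (#|[set B i; B j; B l1]%SET| <= 3)%N.
    apply: leq_trans (leq_card_setU _ _) _; rewrite cards1 addn1 ltnS cards2.
    by case: (_ != _).
  exact: leq_sub_le3 dP c3.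
have [f [finj fT fl2]] := injection_into (B l2) cT.
pose p0 := Ordinal d0.
have fp0 : f p0 = B l2.
  by apply: fl2 => //; rewrite !inE !negb_or block_part // eq_sym il2 eq_sym jl2 eq_sym l12.
have fP p : f p \in parts P by have := fT p; rewrite inE => /andP[].
have [fi fj fl1] : [/\ forall p, f p != B i, forall p, f p != B j & forall p, f p != B l1].
  by split=> p; have := fT p; rewrite !inE !negb_or => /andP[/andP[/andP[]]].
have ex A : exists x, A \in parts P -> nonloop P x /\ B x = A.
  have [/part_elt[x [_ nx Bx]]|_] := boolP (A \in parts P); first by exists x.
  by exists i.
have [rep repP] := choice ex.
pose k := [ffun p => if p == p0 then l2 else rep (f p)] : {ffun 'I_d -> 'I_n}.
have kp p : nonloop P (k p) /\ B (k p) = f p.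
  by rewrite ffunE; case: eqP => [->|_]; rewrite ?fp0 //; apply: repP.
have nk p : nonloop P (k p) by have [] := kp p.
have Bk p : B (k p) = f p by have [] := kp p.
have kp0 : k p0 = l2 by rewrite ffunE eqxx.
have nbi : ~~ basis_block P j l1 k (B i).
  by rewrite !negb_or ij il1; apply/existsPn => p; rewrite Bk eq_sym fi.
have V : valid_chart P j l1 k i.
  split=> //; rewrite /fin.
  - by rewrite eq_sym.
  - by move=> l; rewrite Bk fj.
  - by move=> l; rewrite Bk fl1.
  - by move=> p q; rewrite !Bk => /finj.
  - apply: contra nbi => /or3P[/eqP->|/eqP->|/existsP[l /eqP->]]; apply/or3P.
    + by apply: Or31.
    + by apply: Or32.
    + by apply/Or33/existsP; exists l.
(* All the small coordinates together contribute at most [d * e = 1/16], too little to change the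
   signs at [l1] and [j]. *)
pose e : R := (16 * d%:R)^-1.
have dR : 0 < d%:R :> R by rewrite ltr0n.
have e0 : 0 < e by rewrite invr_gt0 mulr_gt0.
have e1 : e <= 1 by rewrite invf_le1 ?mulr_gt0 // -natrM ler1n muln_gt0.
pose zw p : R := if p == p0 then 1 / 2 else - sign_val R (t (k p)) * e.
(* The remaining parts get distinct first coordinates that are integers at least 2, hence different
   from the values 0 and 1 of the basis parts and from 1/2. *)
pose zeta A p : R := if A == B i then zw p else if p == p0 then (enum_rank A).+2%:R else 0.
pose u x : R := (x == i)%:R.
pose Y0 := base_param P j l1 k i u zeta.
have afE x : dec_af i Y0 x = (x == i)%:R.
  rewrite /dec_af; case: eqP => // /eqP xi; rewrite /Y0 /base_param /u (negPf xi).
  by case: ifP.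
have zi p : dec_z P j l1 k Y0 (B i) p = zw p.
  by rewrite /dec_z (negPf nbi) /Y0 /base_param unfold_in /= block_part // nbi /zeta eqxx.
have cE p q : dec_c Y0 p q = (p == q)%:R.
  rewrite /dec_c; case: leqP => pq; rewrite /Y0 /base_param unfold_in /=; first by rewrite pq.
  by rewrite (ltnW pq) eq_sym.
have sum_i (g : 'I_n -> R) : \sum_x (x == i)%:R * g x = g i.
  by rewrite (bigD1 i) //= eqxx mul1r big1 ?addr0 // => x /negPf->; rewrite mul0r.
have akE p : dec_ak P j l1 k i Y0 p = - zw p.
  by rewrite /dec_ak; under eq_bigr do rewrite afE; rewrite sum_i zi.
have fii : fin P j i by [].
have a0E : dec_a0 P j l1 k i Y0 = - 1 + \sum_p zw p.
  rewrite /dec_a0; under eq_bigr do rewrite afE.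
  by rewrite sum_i fii; under eq_bigr do rewrite akE; rewrite sumrN opprK.
have wi : dec_w P j l1 k Y0 i = \sum_p zw p * zw p.
  rewrite /dec_w fii; apply: eq_bigr => p _; rewrite (bigD1 p) //= cE eqxx mulr1 zi.
  by rewrite big1 ?addr0 // => q qp; rewrite cE eq_sym (negPf qp) mulr0 mul0r.
have aiE : dec_ai P j l1 k i Y0 = \sum_p zw p * (1 - zw p).
  rewrite /dec_ai; under eq_bigr do rewrite afE.
  rewrite sum_i wi; under [X in _ - X = _]eq_bigr do rewrite akE cE eqxx mulr1.
  rewrite -opprD -big_split -sumrN; apply: eq_bigr => p _ /=; ring.
have bound (g : 'I_d -> R) c : 0 <= c -> (forall p, p != p0 -> g p <= c) ->
    \sum_p g p <= g p0 + d%:R * c.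
  move=> c0 gc; rewrite (bigD1 p0) //= lerD2l.
  apply: le_trans (_ : \sum_(p | p != p0) c <= _); first by apply: ler_sum.
  rewrite mulr_natl -[d in leRHS]card_ord -sumr_const [leRHS](bigD1 p0) //=.
  by rewrite lerDr.
have zp0 : zw p0 = 1 / 2 by rewrite /zw eqxx.
have de : d%:R * e = 1 / 16 by rewrite /e; field; rewrite gt_eqF.
have zw_e p : p != p0 -> zw p = e \/ zw p = - e.
  move=> /negPf pp; rewrite /zw pp /sign_val; case: (t _); last by left; rewrite opprK mul1r.
  by right; rewrite mulN1r.
have a0neg : dec_a0 P j l1 k i Y0 < 0.
  rewrite a0E; have := bound zw e (ltW e0); rewrite zp0 de => /(_ _)-H.
  have {}H : \sum_p zw p <= 1 / 2 + 1 / 16 by apply: H => p /zw_e[]->; lra.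
  lra.
have aipos : 0 < dec_ai P j l1 k i Y0.
  rewrite aiE; have := bound (fun p => - (zw p * (1 - zw p))) (2 * e).
  rewrite zp0 mulrCA de sumrN => H.
  have {}H : - \sum_p zw p * (1 - zw p) <= - (1 / 2 * (1 - 1 / 2)) + 2 * (1 / 16).
    by apply: H => [|p /zw_e[]->]; [lra|nra|nra].
  lra.
have [||||y [ysg yz yC]] := perturb_point V (u := u) (zeta := zeta) ti.
- move=> x; rewrite unfold_in /= => /and3P[_ _ /negPf xi]; left.
  by rewrite /u xi.
- move=> p; rewrite akE; apply/eqP; have [->|/negPf pp] := eqVneq p p0.
    by rewrite zp0 kp0 t2 sgr_cp0 oppr_lt0 divr_gt0.
  rewrite /zw pp mulNr opprK sgrM sgr_sign_valE (gtr0_sg e0) mulr1.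
  by [].
- by apply/eqP; rewrite t1 sgr_cp0.
- by apply/eqP; rewrite tj sgr_cp0.
exists j, l1, k, i, y => //; split=> // x x' nx nx' fx fx' xx.
have zb A p : basis_block P j l1 k A ->
    dec_z P j l1 k (extend y) A p = (A == f p)%:R.
  by move=> bA; rewrite yz dec_z_basis // Bk.
have zn A p : A \in parts P -> ~~ basis_block P j l1 k A ->
    dec_z P j l1 k (extend y) A p = zeta A p.
  by move=> AP nA; rewrite yz /dec_z (negPf nA) /base_param unfold_in /= AP nA.
have bf A : basis_block P j l1 k A -> A != B j -> A = B l1 \/ exists p, A = f p.
  move=> /or3P[/eqP->|/eqP->|/existsP[p /eqP->]]; first by rewrite eqxx.
    by left.
  by right; exists p; rewrite Bk.
have nat_neq a b : (a != b)%N -> (a%:R : R) != b%:R by rewrite eqr_nat.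
have bn A A' : basis_block P j l1 k A -> A' \in parts P -> ~~ basis_block P j l1 k A' ->
    dec_z P j l1 k (extend y) A p0 != dec_z P j l1 k (extend y) A' p0.
  move=> bA AP' nA'; rewrite zb // zn // /zeta eqxx; case: ifP => _.
    by rewrite zp0 eq_sym half_neq_nat.
  by apply: nat_neq; case: (A == f p0).
have px := block_part nx; have px' := block_part nx'.
have [bx|bx] := boolP (basis_block P j l1 k (B x)).
  have [bx'|bx'] := boolP (basis_block P j l1 k (B x')); last by exists p0; apply: bn.
  have [E|[p E]] := bf _ bx fx.
    have [E'|[p E']] := bf _ bx' fx'; first by rewrite E E' eqxx in xx.
    by exists p; rewrite !zb // -E' eqxx (negPf xx) eq_sym oner_eq0.
  by exists p; rewrite !zb // -E eqxx [B x' == _]eq_sym (negPf xx) oner_eq0.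
have [bx'|bx'] := boolP (basis_block P j l1 k (B x')); first by exists p0; rewrite eq_sym bn.
exists p0; rewrite !zn // /zeta eqxx.
have [E|ne] := eqVneq (B x) (B i); have [E'|ne'] := eqVneq (B x') (B i).
- by rewrite E E' eqxx in xx.
- by rewrite zp0 half_neq_nat.
- by rewrite zp0 eq_sym half_neq_nat.
- by apply: nat_neq; rewrite !eqSS; apply: contra xx => /eqP/val_inj/enum_rank_inj->.
Qed.

End Existence.

(** * Sign conditions for momentum conservation *)

(* A linear relation with coefficients c between pairwise non-orthogonal       *)
(* lightlike vectors: pairing it with a vector shows that it cannot have a     *)
(* single positive coefficient.                                                *)
Lemma two_positive (R : realFieldType) (I : finType) (P : {set I}) (c : I -> R)
    (G : I -> I -> R) :
  (1 < #|P|)%N -> {in P &, forall A B, A != B -> 0 < G A B} ->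
  {in P, forall A, G A A = 0} ->
  {in P, forall A, \sum_(B in P) c B * G A B = 0} ->
  (exists2 A, A \in P & c A != 0) ->
  exists A B, [/\ A \in P, B \in P, A != B, 0 < c A & 0 < c B].
Proof.
move=> P2 Gpos Gdiag rel [A AP cA]; apply: contrapT => no.
have [A1 A1P A1le] : exists2 A1, A1 \in P & {in P, forall B, B != A1 -> c B <= 0}.
  have [[A1 A1P cA1]|nopos] := pselect (exists2 A1, A1 \in P & 0 < c A1).
    exists A1 => // B BP BA; rewrite leNgt; apply/negP => cB.
    by apply: no; exists A1, B; split; rewrite // eq_sym.
  exists A => // B BP _; rewrite leNgt; apply/negP => cB; apply: nopos.
  by exists B.
have c0 : {in P, forall B, B != A1 -> c B = 0}.
  have := rel _ A1P; rewrite (bigD1 A1) //= Gdiag // mulr0 add0r => /eqP.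
  rewrite -oppr_eq0 -sumrN psumr_eq0 => [/allP all0 B BP BA|B /andP[BP BA]].
    have := all0 B (mem_index_enum _); rewrite BP BA /= oppr_eq0 mulf_eq0.
    by rewrite [G _ _ == 0]gt_eqF ?orbF => [/eqP//|]; apply: Gpos; rewrite // eq_sym.
  by rewrite oppr_ge0 mulr_le0_ge0 ?A1le // ltW // Gpos // eq_sym.
have [B BP BA] : exists2 B, B \in P & B != A1.
  apply/exists_inP; move: P2; rewrite ltnNge; apply: contraNT => /exists_inPn nB.
  rewrite -(cards1 A1); apply/subset_leq_card/fintype.subsetP => B BP.
  by rewrite inE; have := nB B BP; rewrite negbK.
have := rel _ BP; rewrite (bigD1 A1) //= big1 ?addr0 => [/eqP|B' /andP[BP' BA']]; last first.
  by rewrite c0 // mul0r.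
rewrite mulf_eq0 [G _ _ == 0]gt_eqF ?orbF ?Gpos // => cA1.
by have [E|/(c0 _ AP)/eqP] := eqVneq A A1; [rewrite E cA1 in cA|rewrite (negPf cA)].
Qed.

Section Necessity.
Variables (R : realType) (n : nat) (P : matroid n) (s : signs n).
Local Notation B := (block P).

(* The combinatorial condition in (1), in the case of the uniform matroid.     *)
Definition has_U4 (t : signs n) := exists i j l1 l2 : 'I_n,
  [/\ [/\ nonloop P i, nonloop P j, nonloop P l1 & nonloop P l2],
      uniq [:: B i; B j; B l1; B l2] & [/\ t i, t j, ~~ t l1 & ~~ t l2]].

(** Take one element in each of two further parts. If their signs agree, complete them with the two
    elements of the other sign; otherwise with a positive element of one mixed part and a negative
    element of the other. *)
Lemma mixed_has_U4 (t : signs n) i j l1 l2 : (3 < #|parts P|)%N ->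
  [/\ nonloop P i, nonloop P j, nonloop P l1 & nonloop P l2] ->
  B i = B l1 -> B j = B l2 -> B i != B j -> [/\ t i, t j, ~~ t l1 & ~~ t l2] ->
  has_U4 t.
Proof.
move=> P4 [ni nj n1 n2] Bi Bj ij [ti tj t1 t2].
have : (1 < #|parts P :\: [set B i; B j]|)%SET%N.
  rewrite cardsDS ?cards2 ?ij //; first by rewrite ltn_subRL addn1.
  by apply/fintype.subsetP => A; rewrite !inE => /orP[] /eqP->; apply: block_part.
move=> /card_gt1P[C [D []]]; rewrite !inE !negb_or.
move=> /andP[/andP[Ci Cj] /part_elt[x [_ nx Bx]]] /andP[/andP[Di Dj] /part_elt[y [_ ny By]]] CD.
have u (E F G H : {set 'I_n}) : E != F -> E != G -> E != H -> F != G -> F != H -> G != H ->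
    uniq [:: E; F; G; H].
  by move=> e1 e2 e3 e4 e5 e6; rewrite /= !inE !negb_or e1 e2 e3 e4 e5 e6.
case tx: (t x); case ty: (t y).
- exists x, y, l1, l2; rewrite tx ty Bx By -Bi -Bj; split=> //; apply: u => //.
- exists x, i, y, l2; rewrite tx ty Bx By -Bj; split=> //; apply: u => //.
  by rewrite eq_sym.
- exists y, i, x, l2; rewrite tx ty Bx By -Bj; split=> //; apply: u => //.
    by rewrite eq_sym.
  by rewrite eq_sym.
- exists i, j, x, y; rewrite tx ty Bx By; split=> //; apply: u => //; by rewrite eq_sym.
Qed.

Variable r : nat.
Variable S : 'M[R]_n.
Hypothesis SM : mmc_stratum P s r S.

(** Dividing the row sums by the weights gives a relation between the parts with coefficients [c].
    The Gram entries are positive because the weights carry all signs, so [two_positive] applies to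
    [c] and to [- c]. *)
Lemma stratum_dichotomy d (ki k0 : 'I_n) (k : {ffun 'I_d -> 'I_n}) i0
    (a : 'I_n -> R) (z : {set 'I_n} -> 'rV[R]_d) C :
  valid_chart P ki k0 k i0 -> chart_point P ki k0 k i0 a z C ->
  (forall i, nonloop P i -> Num.sg (a i) = sign_val R (s i) * sign_val R (s i0)) ->
  S = config_mx a (fun i => z (B i)) C (fin P ki) ->
  let c (A : {set 'I_n}) := \sum_(i in A) a i in
  {in parts P, forall A, c A = 0} \/
  exists A1 A2 B1 B2, [/\ [/\ A1 \in parts P, A2 \in parts P, B1 \in parts P & B2 \in parts P],
    uniq [:: A1; A2; B1; B2] & [/\ 0 < c A1, 0 < c A2, c B1 < 0 & c B2 < 0]].
Proof.
move=> V [Cs al ai0 zki zk0 zk z0 mom] asg SE c.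
have [all0|nall] := pselect {in parts P, forall A, c A = 0}; first by left.
right; have ex : exists2 A, A \in parts P & c A != 0.
  apply: contrapT => no; apply: nall => A AP; apply/eqP; apply: contrapT => /negP cA.
  by apply: no; exists A.
have a0 i : nonloop P i -> a i != 0.
  by move=> ni; rewrite -sgr_eq0 asg // mulf_neq0 // sign_val_neq0.
have inf i : ~~ fin P ki i -> z (B i) = 0 by rewrite negbK => /eqP->.
pose g i j := gram (fun i => z (B i)) C (fin P ki) i j.
have rep A : exists i, A \in parts P -> nonloop P i /\ B i = A.
  have [/part_elt[i [_ ni Bi]]|_] := boolP (A \in parts P); first by exists i.
  by exists ki.
have [e eP] := choice rep; pose G A A' := g (e A) (e A').
have gpos i j : nonloop P i -> nonloop P j -> B i != B j -> 0 < g i j.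
  move=> ni nj ij; have := stratum_sg SM ni nj ij; rewrite SE mxE !sgrM !asg // -/(g i j).
  set x := sign_val R (s i); set y := sign_val R (s j); set w := sign_val R (s i0).
  have xx : x * x = 1 by apply: sign_valM.
  have yy : y * y = 1 by apply: sign_valM.
  have ww : w * w = 1 by apply: sign_valM.
  have -> : x * w * (y * w) = x * y * (w * w) by ring.
  rewrite ww mulr1 -[in RHS](mulr1 (x * y)) => /(mulfI _) E.
  by rewrite -sgr_cp0 E // mulf_neq0 // sign_val_neq0.
have gdep i j j' : B j = B j' -> g i j = g i j'.
  by move=> Bj; rewrite /g /gram /wt /fin Bj.
have gdep' i i' j : B i = B i' -> g i j = g i' j.
  by move=> Bi; rewrite /g /gram /wt /fin Bi.
have Gpos : {in parts P &, forall A A', A != A' -> 0 < G A A'}.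
  move=> A A' /eP[nA BA] /eP[nA' BA'] AA; apply: gpos => //.
  by rewrite BA BA'.
have Gdiag : {in parts P, forall A, G A A = 0}.
  by move=> A _; rewrite /G /g gram_diag // => j; apply: inf.
have rel : {in parts P, forall A, \sum_(A' in parts P) c A' * G A A' = 0}.
  move=> A AP; have [nA BA] := eP _ AP.
  have := stratum_row_sum SM (e A); rewrite SE.
  have -> : \sum_j config_mx a (fun i => z (B i)) C (fin P ki) (e A) j =
      a (e A) * \sum_j a j * g (e A) j.
    by rewrite mulr_sumr; apply: eq_bigr => j _; rewrite mxE -mulrA.
  move/eqP; rewrite mulf_eq0 (negPf (a0 _ nA)) /= => /eqP E.
  rewrite -[RHS]E [RHS](bigID (nonloop P)) /= [X in _ = _ + X]big1 ?addr0; last first.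
    by move=> j /al->; rewrite mul0r.
  rewrite /nonloop [RHS](big_trivIset _ (matroid_trivIset P)) /=.
  apply: eq_bigr => A' AP'; rewrite mulr_suml; apply: eq_bigr => j jA'.
  by rewrite /G (gdep _ _ j) //; have [_ ->] := eP _ AP'; rewrite (block_of AP' jA').
have [A1 [A2 [A1P A2P A12 c1 c2]]] := two_positive (parts_ge2 P) Gpos Gdiag rel ex.
have relN : {in parts P, forall A, \sum_(A' in parts P) - c A' * G A A' = 0}.
  by move=> A AP; under eq_bigr do rewrite mulNr; rewrite sumrN rel ?oppr0.
have exN : exists2 A, A \in parts P & - c A != 0.
  by have [A AP cA] := ex; exists A; rewrite ?oppr_eq0.
have [B1 [B2 [B1P B2P B12 c1' c2']]] := two_positive (parts_ge2 P) Gpos Gdiag relN exN.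
rewrite !oppr_gt0 in c1' c2'; exists A1, A2, B1, B2; split=> //.
have ne A A' : 0 < c A -> c A' < 0 -> A != A'.
  by move=> cA cA'; apply: contraTneq cA => ->; rewrite -leNgt ltW.
by rewrite /= !inE !negb_or A12 B12 !ne.
Qed.

(** With [b = s i0] this is the representative that is positive at [i0], which matches
    [a i0 = 1]. *)
Definition gauge (b : bool) (t : signs n) : signs n := if b then t else opp_signs t.

Lemma gaugeE b t i : gauge b t i = (t i == b).
Proof. by rewrite /gauge; case: b; rewrite ?ffunE; case: (t i). Qed.

Lemma sgr_sign_gt0 (x : R) i i0 : Num.sg x = sign_val R (s i) * sign_val R (s i0) ->
  (0 < x) = gauge (s i0) s i /\ (x < 0) = ~~ gauge (s i0) s i.
Proof.
rewrite gaugeE -sgr_gt0 -sgr_lt0 => ->; rewrite /sign_val.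
by case: (s i) (s i0) => [] []; rewrite ?mulr1 ?mul1r ?mulrNN ?mulr1 ?oppr_gt0 ?oppr_lt0
  ?ltr01 ?ltr10.
Qed.

Lemma pos_sum_elt (A : {set 'I_n}) (a : 'I_n -> R) :
  0 < \sum_(i in A) a i -> exists2 i, i \in A & 0 < a i.
Proof.
move=> A0; apply/exists_inP; apply: contraTT A0 => /exists_inPn no.
by rewrite -leNgt; apply: sumr_le0 => i /no; rewrite -leNgt.
Qed.

Lemma zero_sum_elts (A : {set 'I_n}) (a : 'I_n -> R) : A != finset.set0 ->
  {in A, forall i, a i != 0} ->
  \sum_(i in A) a i = 0 -> exists i j, [/\ i \in A, j \in A, 0 < a i & a j < 0].
Proof.
move=> /finset.set0Pn[i iA] a0 sA.
have [j [jA aj]] : exists j, j \in A /\ 0 < a j * - a i.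
  have : 0 < \sum_(j in A) (- a i * a j + (if j == i then a i * a i else 0)).
    rewrite big_split /= -mulr_sumr sA mulr0 add0r -big_mkcondr /=.
    rewrite (big_pred1 i) => [|j]; last by rewrite andbC /=; have [->|] := eqVneq j i; rewrite ?iA.
    by rewrite -expr2 exprn_even_gt0 ?a0.
  move=> /pos_sum_elt[j jA]; case: eqP => [->|_]; first by rewrite mulNr addNr ltxx.
  by rewrite addr0 mulrC => aj; exists j.
have := a0 _ iA; rewrite neq_lt => /orP[ai|ai].
  by exists j, i; split=> //; move: aj; rewrite pmulr_lgt0 // oppr_gt0.
by exists i, j; split=> //; move: aj; rewrite nmulr_lgt0 // oppr_lt0.
Qed.

(** If all part sums vanish, every part is mixed, and for r < m two mixed parts give a uniform
    matroid. Otherwise four parts have sums of signs +, +, -, -, which is impossible for r = m and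
    gives a uniform matroid directly for r < m. *)
Lemma stratum_condition : exists2 d, r = d.+2 &
  (d.+2 <= #|parts P|)%N /\
  ((d.+2 = #|parts P| /\
      forall A, A \in parts P -> exists i j, [/\ i \in A, j \in A & s i != s j]) \/
   [/\ (0 < d)%N, (d.+2 < #|parts P|)%N & exists b, has_U4 (gauge b s)]).
Proof.
have [d [ki [k0 [k [i0 [a [z [C [rd V cp asg SE]]]]]]]]] := stratum_chart SM.
have cm := chart_rank_le V; exists d => //; split=> //.
have a0 i : nonloop P i -> a i != 0.
  by move=> ni; rewrite -sgr_eq0 asg // mulf_neq0 // sign_val_neq0.
have mixed A : A \in parts P -> \sum_(i in A) a i = 0 ->
    exists i j, [/\ i \in A, j \in A, gauge (s i0) s i & ~~ gauge (s i0) s j].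
  move=> AP sA; have [||i [j [iA jA ai aj]]] := zero_sum_elts _ _ sA.
  - by apply: contraTneq AP => ->; rewrite matroid_set0.
  - by move=> i iA; apply/a0/(nonloop_of AP).
  exists i, j; split=> //.
    by have [<- _] := sgr_sign_gt0 (asg _ (nonloop_of AP iA)).
  by have [_ <-] := sgr_sign_gt0 (asg _ (nonloop_of AP jA)).
(* For [d = 0] the only positions are infinity and the origin, so a third part would coincide with
   that of [k0] and force a zero entry at a basis. *)
have pos_rank : (d.+2 < #|parts P| -> 0 < d)%N.
  move=> dm; rewrite lt0n; apply/eqP => d0.
  have : (0 < #|parts P :\: [set B ki; B k0]|)%SET%N.
    rewrite cardsD subn_gt0; apply: leq_ltn_trans (subset_leq_card (subsetIr _ _)) _.
    by apply: leq_ltn_trans dm; rewrite cards2; case: (_ != _).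
  move=> /card_gt0P[A]; rewrite !inE negb_or => /andP[/andP[Ai A0] /part_elt[x [_ nx Bx]]].
  have /eqP[] : S x k0 != 0 by apply: (stratum_neq0 SM) => //; rewrite ?Bx //; apply: (vc_k0 V).
  rewrite SE mxE (gram_fin _ (cp_sym cp)); last exact: (vc_fk0 V).
    suff -> : z (B x) - z (B k0) = 0 by rewrite bform0l mulr0.
    by clear -d0; apply/rowP => l; have := ltn_ord l; rewrite {2}d0.
  by rewrite /fin Bx.
have [all0|] := stratum_dichotomy V cp asg SE.
  move: cm; rewrite leq_eqVlt => /orP[/eqP dm|dm].
    left; split=> // A AP; have [i [j [iA jA]]] := mixed _ AP (all0 _ AP).
    rewrite !gaugeE => /eqP ii /eqP jj; exists i, j; split=> //.
    by rewrite ii eq_sym; apply/eqP.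
  right; split; [exact: pos_rank|by []|exists (s i0)].
  have Pki := block_part (vc_ki V); have Pk0 := block_part (vc_k0 V).
  have [i [l1 [iA l1A ti t1]]] := mixed _ Pki (all0 _ Pki).
  have [j [l2 [jA l2A tj t2]]] := mixed _ Pk0 (all0 _ Pk0).
  apply: (@mixed_has_U4 _ i j l1 l2) => //.
  - by apply: leq_trans (dm); rewrite !ltnS; apply: pos_rank.
  - by split; [apply: nonloop_of iA|apply: nonloop_of jA|apply: nonloop_of l1A
      |apply: nonloop_of l2A].
  - by rewrite (block_of Pki iA) (block_of Pki l1A).
  - by rewrite (block_of Pk0 jA) (block_of Pk0 l2A).
  - by rewrite (block_of Pki iA) (block_of Pk0 jA) eq_sym; apply: (vc_fk0 V).
move=> [A1 [A2 [B1 [B2 [[A1P A2P B1P B2P] u [c1 c2 c1' c2']]]]]].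
move: cm; rewrite leq_eqVlt => /orP[/eqP dm|dm].
  have bb A : A \in parts P -> basis_block P ki k0 k A.
    suff -> : parts P = [set A | basis_block P ki k0 k A]%SET by rewrite inE.
    apply/esym; apply/eqP; rewrite eqEcard (card_basis_block V) -dm leqnn andbT.
    by apply/fintype.subsetP => A'; rewrite inE; apply: (basis_block_part V).
  (* When all parts are basis parts, coordinate [l] of momentum conservation only sees the part of
     [k l]. So at most two parts have nonzero sums, not four. *)
  have ck l : \sum_(i in B (k l)) a i = 0.
    have [_ /rowP/(_ l)] := cp_mom cp; rewrite summxE [RHS]mxE => M2 _.
    rewrite -[RHS]M2 [RHS](bigID (nonloop P)) /= [X in _ = _ + X]big1 ?addr0; last first.
      by move=> j /(cp_loop cp) a0j; rewrite mxE a0j mul0r.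
    rewrite /nonloop [RHS](big_trivIset _ (matroid_trivIset P)) /=.
    have zE A i : A \in parts P -> i \in A -> (a i *: z (B i)) 0 l = a i * (A == B (k l))%:R.
      move=> AP iA; rewrite mxE (block_of AP iA); congr (_ * _).
      case/or3P: (bb _ AP) => [/eqP->|/eqP->|/existsP[l' /eqP->]].
      - by rewrite (cp_ki cp) mxE eq_sym (negPf (vc_fk V l)).
      - by rewrite (cp_k0 cp) mxE eq_sym (negPf (vc_kk0 V l)).
      - by rewrite (cp_k cp) mxE eqxx /= (inj_eq (vc_inj V)) eq_sym.
    rewrite [RHS](bigD1 (B (k l))) ?block_part //=; last exact: (vc_k V).
    rewrite [X in _ = _ + X]big1 ?addr0 => [|A /andP[AP /negPf Ak]].
      apply: eq_bigr => i iA; rewrite (zE (B (k l))) ?eqxx ?mulr1 //.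
      by apply/block_part/(vc_k V).
    by apply: big1 => i iA; rewrite (zE A) // Ak mulr0.
  have sub A : A \in parts P -> \sum_(i in A) a i != 0 -> A \in [:: B ki; B k0].
    move=> AP; apply: contraNT; rewrite !inE negb_or => /andP[Ai A0].
    case/or3P: (bb _ AP) => [Ei|E0|/existsP[l /eqP->]]; last by rewrite ck.
      by rewrite Ei in Ai.
    by rewrite E0 in A0.
  have /(uniq_leq_size u) // : {subset [:: A1; A2; B1; B2] <= [:: B ki; B k0]}.
  by move=> A; rewrite in_cons in_cons in_cons mem_seq1 => /or4P[] /eqP->; apply: sub => //;
    rewrite neq_lt ?c1 ?c2 ?c1' ?c2' ?orbT.
right; have pos A : A \in parts P -> 0 < \sum_(i in A) a i ->
    exists2 i, gauge (s i0) s i & nonloop P i /\ B i = A.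
  move=> AP /pos_sum_elt[i iA ai]; exists i; last by rewrite (block_of AP iA) (nonloop_of AP iA).
  by have [<- _] := sgr_sign_gt0 (asg _ (nonloop_of AP iA)).
have neg A : A \in parts P -> \sum_(i in A) a i < 0 ->
    exists2 i, ~~ gauge (s i0) s i & nonloop P i /\ B i = A.
  move=> AP; rewrite -oppr_gt0 -sumrN => /pos_sum_elt[i iA]; rewrite oppr_gt0 => ai.
  exists i; last by rewrite (block_of AP iA) (nonloop_of AP iA).
  by have [_ <-] := sgr_sign_gt0 (asg _ (nonloop_of AP iA)).
have [i ti [ni Bi]] := pos _ A1P c1; have [j tj [nj Bj]] := pos _ A2P c2.
have [l1 t1 [n1 Bl1]] := neg _ B1P c1'; have [l2 t2 [n2 Bl2]] := neg _ B2P c2'.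
split=> //; first exact: pos_rank.
by exists (s i0), i, j, l1, l2; rewrite Bi Bj Bl1 Bl2.
Qed.

End Necessity.

(** * The dimension of a stratum *)

Section Dimension.
Local Open Scope classical_set_scope.
Variables (R : realType) (n : nat) (P : matroid n).
Local Notation B := (block P).

Definition stratum_dim d :=
  ('C(d.+1, 2) + (#|parts P| - d.+2) * d + (#|finset.cover P| - d.+3))%N.

Lemma gauge_stratum b (s : signs n) r :
  mmc_stratum (R := R) P (gauge b s) r = mmc_stratum P s r.
Proof. by case: b => //=; rewrite /mmc_stratum kstratum_opp. Qed.

(** There are finitely many choices of [ki], [k0], [k], [i0], and their charts, all with
    [stratum_dim d] parameters, cover the stratum. *)
Lemma stratum_dim_le (s : signs n) d d' (f : 'I_d' -> 'I_n * 'I_n) :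
  interior (coord_proj f @` mmc_stratum (R := R) P s d.+2) !=set0 ->
  (d' <= stratum_dim d)%N.
Proof.
pose valid (c : 'I_n * 'I_n * {ffun 'I_d -> 'I_n} * 'I_n) :=
  `[< valid_chart P c.1.1.1 c.1.1.2 c.1.2 c.2 >].
pose D (t : {c | valid c}) :=
  #|free_param P (val t).1.1.1 (val t).1.1.2 (val t).1.2 (val t).2|.
pose F (t : {c | valid c}) (l : 'I_d') (y : 'rV[R]_(D t)) : R :=
  dec_mx P (val t).1.1.1 (val t).1.1.2 (val t).1.2 (val t).2 (extend y) (f l).1 (f l).2.
apply: (@polyimage_interior_dim _ _ _ _ D F) => [t|t l|_ [S SM <-]].
- by have /asboolP V := valP t; rewrite /D (card_free_param V).
- exact: dec_mx_polyfun.
have [e [ki [k0 [k [i0 [a [z [C [[de] V cp _ SE]]]]]]]]] := stratum_chart SM.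
move: k a z C V cp SE; rewrite -de => k a z C V cp SE.
have V' : valid (ki, k0, k, i0) by apply/asboolP.
have [y [ya yz yC]] := chart_onto V cp.
exists (Sub (ki, k0, k, i0) V'), y => l.
by rewrite /F /dec_mx ya yz yC -SE mxE.
Qed.

Lemma good_point_conserving (s : signs n) d :
  good_point R P s d -> momentum_conserving R P s d.+2.
Proof.
move=> [ki [k0 [k [i0 [y V [asg zinj C1]]]]]].
exists (dec_mx P ki k0 k i0 (extend y)).
apply: dec_mmc => //; rewrite C1; apply: posdef_near1 => p q.
by rewrite mxE subrr normr0 invr_gt0.
Qed.

Lemma good_point_dim (s : signs n) d : good_point R P s d ->
  sa_dim (mmc_stratum (R := R) P s d.+2) = stratum_dim d.
Proof.
move=> [ki [k0 [k [i0 [y V [asg zinj C1]]]]]].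
have [f fi fS] := mmc_interior V asg zinj C1.
move: f fi fS; rewrite (card_free_param V) -/(stratum_dim d) => f fi fS.
have Dn : (stratum_dim d < (n * n).+1)%N.
  by have := leq_card f fi; rewrite card_prod !card_ord.
apply/eqP; rewrite eqn_leq; apply/andP; split.
  by apply/bigmax_leqP => d' /asboolP[f' _]; apply: stratum_dim_le.
rewrite /sa_dim; apply: (@leq_bigmax_cond _ _ _ (Ordinal Dn)).
by apply/asboolP; exists f.
Qed.

Lemma good_point_bounds (s : signs n) d : good_point R P s d ->
  (d.+2 <= #|parts P|)%N /\ (d.+3 <= #|finset.cover P|)%N.
Proof.
move=> [ki [k0 [k [i0 [y V _]]]]].
by split; [apply: chart_rank_le V|apply: chart_card_cover V].
Qed.

(** The given point may have any form [C]; it is used only for its sign condition, from which a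
    point with [C = 1] is rebuilt. *)
Lemma conserving_good_point (s : signs n) r : momentum_conserving R P s r ->
  exists2 d, r = d.+2 & exists b, good_point R P (gauge b s) d.
Proof.
move=> [S /stratum_condition[d rd [_ cond]]]; exists d => //.
case: cond => [[dm mixed]|[d0 dm [b [i [j [l1 [l2 [[ni nj n1 n2] u [ti tj t1 t2]]]]]]]]].
  by exists true; apply: good_point_full.
by exists b; apply: (good_point_generic R d0 dm ni nj n1 n2 u ti tj t1 t2).
Qed.

(** The bounds make the truncated subtractions of [stratum_dim] exact; what remains is an integer
    identity. *)
Lemma stratum_dimE d : (d.+2 <= #|parts P|)%N -> (d.+3 <= #|finset.cover P|)%N ->
  (stratum_dim d)%:Z = (#|parts P|%:Z - 1) * (d.+2%:Z - 1) - 'C(d.+2, 2)%:Z +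
    (n%:Z - #|matroid_loops P|%:Z - #|parts P|%:Z) - 1.
Proof.
move=> mP cP.
have lE : n%:Z - #|matroid_loops P|%:Z = #|finset.cover P|%:Z.
  by rewrite /matroid_loops -[in n%:Z](card_ord n) -(finset.cardsC (finset.cover P)) PoszD addrK.
have bE : ('C(d.+1, 2) * 2 = d.+1 * d)%N by have := bin_ffact d.+1 2; rewrite ffactnS ffactn1.
rewrite lE binS bin1 /stratum_dim.
move: #|parts P| #|finset.cover P| 'C(d.+1, 2) mP cP bE => m c b mP cP bE.
have [x ->] : exists x, m = (x + d.+2)%N by exists (m - d.+2)%N; rewrite subnK.
have [y ->] : exists y, c = (y + d.+3)%N by exists (c - d.+3)%N; rewrite subnK.
by rewrite !addnK; nia.
Qed.

End Dimension.

(** * Restrictions of the matroid to four elements *)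

Section Restriction.
Variables (n : nat) (P : matroid n).
Local Notation B := (block P).

Lemma restrict_part (X A : {set 'I_n}) x : A \in matroid_restrict P X -> x \in A ->
  nonloop P x /\ A = (B x :&: X)%SET.
Proof.
rewrite !inE => /andP[_ /imsetP[C CP ->]]; rewrite inE => /andP[xC _].
by rewrite (block_of CP xC) (nonloop_of CP xC).
Qed.

Lemma restrict_block (X : {set 'I_n}) x : nonloop P x -> x \in X ->
  (B x :&: X)%SET \in matroid_restrict P X.
Proof.
move=> nx xX; apply/setD1P; split; last by apply/imsetP; exists (B x); rewrite ?block_part.
by apply/finset.set0Pn; exists x; rewrite inE xX andbT finset.mem_pblock.
Qed.

Lemma restrict_U4 i j k l : [/\ nonloop P i, nonloop P j, nonloop P k & nonloop P l] ->
  uniq [:: B i; B j; B k; B l] ->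
  matroid_restrict P [set i; j; k; l]%SET = [set [set i]; [set j]; [set k]; [set l]]%SET.
Proof.
move=> [ni nj nk nl] u; set X := [set i; j; k; l]%SET.
have Binj : {in X &, injective B}.
  move: u; rewrite /= !inE !negb_or => /and4P[/and3P[ij ik il] /andP[jk jl] kl _] x y.
  rewrite !inE -!orbA => /or4P[] /eqP-> /or4P[] /eqP-> // E;
    by move: ij ik il jk jl kl; rewrite E eqxx.
have nX x : x \in X -> nonloop P x by rewrite !inE -!orbA => /or4P[] /eqP->.
have BX x : x \in X -> (B x :&: X)%SET = [set x]%SET.
  move=> xX; apply/setP => y; rewrite finset.in_setI finset.in_set1; apply/andP/eqP => [[yx yX]|->].
    by apply: Binj => //; rewrite (block_of (block_part (nX _ xX)) yx).
  by rewrite finset.mem_pblock; split=> //; apply: nX.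
have iX : i \in X by rewrite !inE eqxx.
have jX : j \in X by rewrite !inE eqxx orbT.
have kX : k \in X by rewrite !inE eqxx orbT.
have lX : l \in X by rewrite !inE eqxx orbT.
apply/setP => A; apply/idP/idP => AX; last first.
  have [x xX ->] : exists2 x, x \in X & A = [set x]%SET.
    by move: AX; rewrite !inE -!orbA => /or4P[] /eqP->; [exists i|exists j|exists k|exists l].
  by rewrite -(BX x xX); apply: restrict_block => //; apply: nX.
have /finset.set0Pn[x xA] : A != finset.set0 by move: AX; rewrite !inE => /andP[].
have [nx AE] := restrict_part AX xA; have xX : x \in X by move: xA; rewrite AE inE => /andP[].
by move: AE xX; rewrite -/X => -> xX; rewrite BX //; move: xX; rewrite !inE -!orbA => /or4P[] /eqP->;
  rewrite eqxx ?orbT.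
Qed.

End Restriction.

Theorem theorem5p1 (R : realType) (n : nat) (P : matroid n) (s : signs n)
    (r : nat) :
  let m := #|parts P| in
  let l := #|matroid_loops P| in
  [/\ (3 <= r < m)%N ->
        (momentum_conserving R P s r <->
         exists t : signs n, (t = s \/ t = opp_signs s) /\
         exists i j k l' : 'I_n,
           [/\ uniq [:: i; j; k; l'],
               t i = true /\ t j = true,
               t k = false /\ t l' = false
             & let Q := matroid_restrict P [set i; j; k; l']%SET in
               Q = [set [set i]; [set j]; [set k]; [set l']]%SET \/
               Q = [set [set i; k]; [set j; l']]%SET]),
      (2 <= r)%N /\ r = m ->
        (momentum_conserving R P s r <->
         forall A, A \in parts P ->
           exists i j, [/\ i \in A, j \in A & s i != s j])
    & momentum_conserving R P s r ->
        (sa_dim (mmc_stratum (R := R) P s r))%:Z =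
          (m%:Z - 1) * (r%:Z - 1) - 'C(r, 2)%:Z + (n%:Z - l%:Z - m%:Z) - 1].
Proof.
move=> m l; split.
- move=> /andP[r3 rm]; split.
    move=> [S /stratum_condition[d rd [_ [[dm _]|[_ _ [b [i [j [k [k' [nl u [ti tj tk tk']]]]]]]]]]]].
      by move: rm; rewrite rd dm ltnn.
    exists (gauge b s); split; first by case: (b); [left|right].
    exists i, j, k, k'; split.
    + by move: u; apply: contraTT => /(contra (@map_uniq _ _ (block P) [:: i; j; k; k'])).
    + by [].
    + by split; apply/negbTE.
    + by left; apply: restrict_U4.
  move=> [t [ts [i [j [k [k' [u [ti tj] [tk tk'] Q]]]]]]].
  have -> : momentum_conserving R P s r = momentum_conserving R P t r.
    by case: ts => -> //; rewrite /momentum_conserving -(gauge_stratum R P false s).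
  have [d rd] : exists d, r = d.+3 by exists (r - 3)%N; rewrite -addn3 subnK.
  rewrite rd in rm *; suff [i' [j' [l1 [l2 [[ni nj n1 n2] u' [ti' tj' t1 t2]]]]]] : has_U4 P t.
    exact: good_point_conserving (good_point_generic R _ rm ni nj n1 n2 u' ti' tj' t1 t2).
  move: u; rewrite /= !inE !negb_or => /and4P[/and3P[ij ik ik'] /andP[jk jk'] kk' _].
  set X := [set i; j; k; k']%SET in Q.
  have iX : i \in X by rewrite !inE eqxx.
  have jX : j \in X by rewrite !inE eqxx orbT.
  have kX : k \in X by rewrite !inE eqxx orbT.
  have k'X : k' \in X by rewrite !inE eqxx orbT.
  have sep x y A : A \in matroid_restrict P X -> x \in A -> y \in X -> y \notin A ->
      nonloop P y -> block P x != block P y.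
    move=> AQ xA yX yA ny; have [_ AE] := restrict_part AQ xA.
    by apply: contraNneq yA => E; rewrite AE E inE yX andbT finset.mem_pblock.
  have tog x y A : A \in matroid_restrict P X -> x \in A -> y \in A ->
      [/\ nonloop P x, nonloop P y & block P x = block P y].
    move=> AQ xA yA; have [nx AE] := restrict_part AQ xA; have [ny _] := restrict_part AQ yA.
    by split=> //; move: yA; rewrite AE inE => /andP[yx _]; rewrite (block_of (block_part nx) yx).
  case: Q => Q.
    have Qx x : x \in X -> [set x]%SET \in matroid_restrict P X.
      by rewrite Q !inE -!orbA => /or4P[] /eqP->; rewrite eqxx ?orbT.
    have nX x : x \in X -> nonloop P x.
      by move=> xX; have [|] := restrict_part (x := x) (Qx _ xX); rewrite ?finset.in_set1.
    have sepX x y : x \in X -> y \in X -> x != y -> block P x != block P y.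
      by move=> xX yX xy; apply: (sep _ _ _ (Qx _ xX)); rewrite ?finset.in_set1 ?nX // eq_sym.
    exists i, j, k, k'; split; [by split; apply: nX| |by rewrite ti tj tk tk'].
    by rewrite /= !inE !negb_or !sepX.
  (* In the case of two mixed pairs, 3 <= r < m provides the two further parts that [mixed_has_U4]
     uses. *)
  have [|||ni nk Bik] := @tog i k [set i; k]%SET; rewrite ?Q ?finset.in_set2 ?eqxx ?orbT //.
  have [|||nj nk' Bjk'] := @tog j k' [set j; k']%SET; rewrite ?Q ?finset.in_set2 ?eqxx ?orbT //.
  apply: (@mixed_has_U4 _ _ _ i j k k') => //.
  + exact: leq_ltn_trans rm.
  + apply: (sep _ _ [set i; k]%SET); rewrite ?Q ?finset.in_set2 ?eqxx ?orbT // negb_or jk eq_sym.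
    by rewrite ij.
  + by rewrite ti tj tk tk'.
- move=> [r2 rm]; split.
    move=> [S /stratum_condition[d rd [_ [[_ //]|[_ dm _]]]]].
    by move: dm; rewrite -rd rm ltnn.
  move=> mixed; have [d rd] : exists d, r = d.+2 by exists (r - 2)%N; rewrite -addn2 subnK.
  by rewrite rd; apply/good_point_conserving/good_point_full; rewrite // -rd rm.
- move=> /conserving_good_point[d -> [b gp]].
  rewrite -(gauge_stratum R P b) (good_point_dim gp).
  by have [mP cP] := good_point_bounds gp; apply: stratum_dimE.
Qed.
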